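(* Let $p$ be a prime, $n\ge 2$, $r=(r_1,\dots,r_n)\in\mathbb{N}_0^n$, $C=(p^{r_1},\dots,p^{r_n})$, and let $\psi,\psi'$ be the characters of $U(\mathbb{Q}_p)/U(\mathbb{Z}_p)$ attached to integers $\psi_1,\dots,\psi_n$ and $\psi'_1,\dots,\psi'_n$. Then $$\mathrm{Kl}_p(\psi,\psi',C^{\ast}w_l)=\sum_{\underline m\in\mathcal{M}_{w_l}(r)}\mathrm{Kl}_p(\underline m,\psi,\psi',w_l),$$ where $$\mathcal{M}_{w_l}(r)=\Big\{\underline m=(m_{ij})_{1\le i\le j\le n}\in\mathbb{N}_0^{n(n+1)/2}\ :\ \sum_{1\le i\le k\le j\le n}m_{ij}=r_k\ \text{ for each } 1\le k\le n\Big\}$$ (for fixed $k$ the sum runs over all pairs $(i,j)$ with $i\le k\le j$), $$\mathcal{C}_{w_l}(\underline m)=\Big\{\underline c=(c_{ij})_{1\le i\le j\le n}\ :\ c_{ij}\in\mathbb{Z}\big/\textstyle\big(\prod_{k=j}^n p^{m_{ik}}\big)\mathbb{Z},\ (c_{ij},p^{m_{ij}})=1\Big\},$$ and $$\mathrm{Kl}_p(\underline m,\psi,\psi',w_l)=\sum_{\underline c\in\mathcal{C}_{w_l}(\underline m)}e\Bigg(\sum_{j=1}^n\sum_{i=1}^j\psi_j\,c_{i(j-1)}\overline{c_{ij}}\prod_{k=1}^{i-1}p^{m_{k(j-1)}}\prod_{k=1}^{i}p^{-m_{kj}}$$ $$\qquad+\sum_{i=1}^n\sum_{j=1}^i\psi'_i\,c_{(n+1-i)(n+1-j)}\overline{c_{(n+2-i)(n+1-j)}}\prod_{k=1}^{j-1}p^{m_{(n+2-i)(n+1-k)}}\prod_{k=1}^{j}p^{-m_{(n+1-i)(n+1-k)}}\Bigg),$$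 with the following conventions: $c_{ij}=\overline{c_{ij}}=1$ and $m_{ij}=0$ whenever $i>j$; for $1\le i\le j\le n$, $\overline{c_{ij}}=0$ if $m_{ij}=0$, and otherwise $\overline{c_{ij}}$ is the inverse of $c_{ij}$.
   Context: Let $G=\mathrm{GL}(n+1)$, $T$ the diagonal torus, $U$ the group of upper triangular unipotent matrices, $U^\top$ the lower triangular unipotent matrices. For $u\in U$ and $1\le i\le j\le n$, $u_{ij}$ denotes the entry of $u$ in row $i$ and column $j+1$, so $u_{jj}$ is the $j$-th superdiagonal entry. $e$ denotes the standard additive character of $\mathbb{Q}_p/\mathbb{Z}_p$ (so $e(x)=\exp(2\pi i x)$ for $x\in\mathbb{Z}[1/p]$). For integers $\psi_j,\psi_j'$ put $\psi(u)=e(\sum_{j=1}^n\psi_ju_{jj})$ and $\psi'(u)=e(\sum_{j=1}^n\psi'_ju_{jj})$. Kloosterman sums: for a signed permutation matrix $w$ put $U_w=U\cap w^{-1}U^\top w$. For $N=tw$ with $t\in T(\mathbb{Q}_p)$ put $C(N)=U(\mathbb{Q}_p)NU(\mathbb{Q}_p)\cap G(\mathbb{Z}_p)$ and $X(N)=U(\mathbb{Z}_p)\backslash C(N)/U_w(\mathbb{Z}_p)$. Each $x\in C(N)$ is uniquely $x=u(x)Nu'(x)$ with $u(x)\in U(\mathbb{Q}_p)$, $u'(x)\in U_w(\mathbb{Q}_p)$; this induces maps $u:X(N)\to U(\mathbb{Z}_p)\backslash U(\mathbb{Q}_p)$ and $u':X(N)\to U_w(\mathbb{Q}_p)/U_w(\mathbb{Z}_p)$,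 and $$\mathrm{Kl}_p(\psi,\psi',N)=\sum_{x\in X(N)}\psi(u(x))\,\psi'(u'(x)).$$ $w_l$ is the $(n+1)\times(n+1)$ antidiagonal matrix whose entry in row $i$ and column $n+2-i$ is $(-1)^{n+1-i}$ (entries $1,-1,1,\dots$ starting from the bottom left corner); here $U_{w_l}=U$. $C^{\ast}=\mathrm{diag}(p^{-r_1},p^{r_1-r_2},\dots,p^{r_{n-1}-r_n},p^{r_n})$. In the partial sum, for each $(i,j)$ one fixes a system of integer representatives of the residue classes for $c_{ij}$; when $m_{ij}\ge1$, $c_{ij}$ is prime to $p$ and $\overline{c_{ij}}$ may be taken to be its inverse in $\mathbb{Z}_p$. The value of the partial sum does not depend on the systems of representatives chosen. *)

(* Defs.v *)
From HB Require Import structures.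
From mathcomp Require Import all_boot all_order all_algebra.
From mathcomp Require Import fraction.
From mathcomp Require Import all_classical all_reals all_analysis.
From mathcomp Require Import complex.
Set Implicit Arguments.
Unset Strict Implicit.
Unset Printing Implicit Defensive.
Import Order.TTheory GRing.Theory Num.Theory.

Local Open Scope ring_scope.
Local Open Scope classical_set_scope.

(* Z_p is the inverse limit of the rings 'Z_(p^(k+1)), k >= 0; since p is     *)
(* prime these moduli are at least 2, so 'Z_(p^(k+1)) is Z/p^(k+1).           *)

Definition Zred p k (x : 'Z_(p ^ k.+2)) : 'Z_(p ^ k.+1) := (x : nat)%:R.

Record coherent (p : nat) := Coherent {
  Zp_res : forall k, 'Z_(p ^ k.+1);
  Zp_coh : forall k, Zred (Zp_res k.+1) = Zp_res k }.

(* The proof of primality is kept as an argument for the ring structure.      *)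
Definition Zp (p : nat) of prime p := coherent p.

Section PadicIntegers.
Variables (p : nat) (hp : prime p).

Lemma pexp_gt1 k : (1 < p ^ k.+1)%N.
Proof. by rewrite -{1}(exp1n k.+1) ltn_exp2r // prime_gt1. Qed.

Lemma Zp_val_natr k a : ((a%:R : 'Z_(p ^ k.+1)) : nat) = (a %% p ^ k.+1)%N.
Proof. by rewrite val_Zp_nat ?pexp_gt1. Qed.

Lemma Zred_natr k a : Zred (a%:R : 'Z_(p ^ k.+2)) = a%:R.
Proof.
apply: val_inj; rewrite /Zred /= !Zp_val_natr.
by rewrite modn_dvdm // dvdn_exp2l.
Qed.

Lemma ZredD k : {morph @Zred p k : x y / x + y}.
Proof.
by move=> x y; rewrite -[x]natr_Zp -[y]natr_Zp -natrD !Zred_natr natrD.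
Qed.

Lemma ZredM k : {morph @Zred p k : x y / x * y}.
Proof.
by move=> x y; rewrite -[x]natr_Zp -[y]natr_Zp -natrM !Zred_natr natrM.
Qed.

Lemma Zred0 k : @Zred p k 0 = 0.
Proof. exact: (Zred_natr k 0). Qed.

Lemma Zred1 k : @Zred p k 1 = 1.
Proof. exact: (Zred_natr k 1). Qed.

Lemma ZredN k : {morph @Zred p k : x / - x}.
Proof.
by move=> x; apply/(addrI (Zred x)); rewrite -ZredD !subrr Zred0.
Qed.

Local Notation Z := (Zp hp).

Lemma Zp_eq (x y : Z) : (forall k, Zp_res x k = Zp_res y k) -> x = y.
Proof.
case: x y => [x hx] [y hy] /= xy.
have e : x = y by apply: functional_extensionality_dep.
by case: y / e hy {xy} => hy; congr Coherent; apply: Prop_irrelevance.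
Qed.

HB.instance Definition _ := gen_eqMixin Z.
HB.instance Definition _ := gen_choiceMixin Z.

Program Definition Zp_zero : Z := @Coherent p (fun=> 0) _.
Next Obligation. by move=> k; rewrite Zred0. Qed.
Program Definition Zp_one : Z := @Coherent p (fun=> 1) _.
Next Obligation. by move=> k; rewrite Zred1. Qed.
Program Definition Zp_opp (x : Z) : Z := @Coherent p (fun k => - Zp_res x k) _.
Next Obligation. by move=> x k; rewrite ZredN Zp_coh. Qed.
Program Definition Zp_add (x y : Z) : Z :=
  @Coherent p (fun k => Zp_res x k + Zp_res y k) _.
Next Obligation. by move=> x y k; rewrite ZredD !Zp_coh. Qed.
Program Definition Zp_mul (x y : Z) : Z :=
  @Coherent p (fun k => Zp_res x k * Zp_res y k) _.
Next Obligation. by move=> x y k; rewrite ZredM !Zp_coh. Qed.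

Lemma Zp_addA : associative Zp_add.
Proof. by move=> x y z; apply: Zp_eq => k /=; rewrite addrA. Qed.
Lemma Zp_addC : commutative Zp_add.
Proof. by move=> x y; apply: Zp_eq => k /=; rewrite addrC. Qed.
Lemma Zp_add0 : left_id Zp_zero Zp_add.
Proof. by move=> x; apply: Zp_eq => k /=; rewrite add0r. Qed.
Lemma Zp_addN : left_inverse Zp_zero Zp_opp Zp_add.
Proof. by move=> x; apply: Zp_eq => k /=; rewrite addNr. Qed.
HB.instance Definition _ :=
  GRing.isZmodule.Build Z Zp_addA Zp_addC Zp_add0 Zp_addN.

Lemma Zp_mulA : associative Zp_mul.
Proof. by move=> x y z; apply: Zp_eq => k /=; rewrite mulrA. Qed.
Lemma Zp_mulC : commutative Zp_mul.
Proof. by move=> x y; apply: Zp_eq => k /=; rewrite mulrC. Qed.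
Lemma Zp_mul1 : left_id Zp_one Zp_mul.
Proof. by move=> x; apply: Zp_eq => k /=; rewrite mul1r. Qed.
Lemma Zp_mulD : left_distributive Zp_mul Zp_add.
Proof. by move=> x y z; apply: Zp_eq => k /=; rewrite mulrDl. Qed.
Lemma Zp_one_neq0 : Zp_one != Zp_zero.
Proof.
apply/eqP => /(congr1 (fun x => Zp_res x 0)) /= /eqP.
by rewrite oner_eq0.
Qed.
HB.instance Definition _ := GRing.Zmodule_isComNzRing.Build Z
  Zp_mulA Zp_mulC Zp_mul1 Zp_mulD Zp_one_neq0.

Definition Zp_unit : pred Z := fun x => `[< exists y, y * x = 1 >].
Definition Zp_inv (x : Z) : Z :=
  if pselect (exists y, y * x = 1) is left h then projT1 (cid h) else x.

Lemma Zp_mulVx : {in Zp_unit, left_inverse 1 Zp_inv *%R}.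
Proof.
move=> x /asboolP h; rewrite /Zp_inv; case: pselect => // h'.
by case: cid.
Qed.
Lemma Zp_unitP x y : y * x = 1 -> Zp_unit x.
Proof. by move=> h; apply/asboolP; exists y. Qed.
Lemma Zp_inv_out : {in [predC Zp_unit], Zp_inv =1 id}.
Proof.
move=> x; rewrite inE => /asboolP h; rewrite /Zp_inv.
by case: pselect.
Qed.
HB.instance Definition _ := GRing.ComNzRing_hasMulInverse.Build Z
  Zp_mulVx Zp_unitP Zp_inv_out.

Lemma Zp_res_mod (x : Z) i d :
  (Zp_res x (i + d) = Zp_res x i %[mod p ^ i.+1])%N.
Proof.
elim: d => [|d IH]; first by rewrite addn0.
rewrite -IH addnS -(Zp_coh x (i + d)) /Zred Zp_val_natr modn_dvdm //.
by rewrite dvdn_exp2l // ltnS leq_addr.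
Qed.

Lemma Zp_res_ndvd (x : Z) : x != 0 ->
  exists i, forall d, ~~ (p ^ i.+1 %| Zp_res x (i + d))%N.
Proof.
move=> x0; have [i xi] : exists i, Zp_res x i != 0.
  apply: contrapT => h; move/eqP: x0; apply; apply: Zp_eq => k /=.
  by apply/eqP; apply: contrapT => hk; apply: h; exists k; apply/negP.
exists i => d; rewrite /dvdn Zp_res_mod; apply: contraNN xi => xi.
apply/eqP/val_inj => /=; move/eqP: xi; rewrite modn_small //.
by have := ltn_ord (Zp_res x i); rewrite [X in (_ < X)%N]Zp_cast ?pexp_gt1.
Qed.

Lemma Zp_integral : GRing.integral_domain_axiom Z.
Proof.
move=> x y xy0; case: eqVneq => //= /Zp_res_ndvd[i hi].
case: eqVneq => //= /Zp_res_ndvd[j hj].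
set k := (i + j.+1)%N.
have hz : Zp_res x k * Zp_res y k = 0 by exact: (congr1 (fun z => Zp_res z k) xy0).
have {}hi := hi j.+1; have {}hj := hj i.+1.
rewrite addnS addnC -addnS -/k in hj.
set a := (Zp_res x k : nat) in hi *; set b := (Zp_res y k : nat) in hj *.
have hd : (p ^ k.+1 %| a * b)%N.
  move: hz; rewrite -[Zp_res x k]natr_Zp -[Zp_res y k]natr_Zp -natrM.
  by move/(congr1 (@nat_of_ord _)); rewrite Zp_val_natr => /eqP.
have a0 : (0 < a)%N by rewrite lt0n; apply: contraNN hi => /eqP ->.
have b0 : (0 < b)%N by rewrite lt0n; apply: contraNN hj => /eqP ->.
rewrite pfactor_dvdn // in hi; rewrite pfactor_dvdn // in hj.
rewrite pfactor_dvdn ?muln_gt0 ?a0 // lognM // in hd.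
rewrite -!ltnNge !ltnS in hi hj.
by have := leq_trans hd (leq_add hi hj); rewrite /k addnS ltnNge leqW.
Qed.
HB.instance Definition _ :=
  GRing.ComUnitRing_isIntegral.Build Z Zp_integral.

End PadicIntegers.

Definition Qp (p : nat) (hp : prime p) := {fraction (Zp hp)}.

Section Kloosterman.
Variables (R : realType) (p : nat) (hp : prime p).
Local Notation Q := (Qp hp).

Definition isZp (x : Q) : Prop := exists a : Zp hp, x = tofrac a.

(* A p-adic fractional part, an element of Z[1/p] unique modulo Z.            *)
Definition fracpart (x : Q) : rat :=
  xget 0 [set q : rat | (exists (a : int) (k : nat), q = a%:~R / p%:R ^+ k)
                        /\ isZp (x - ratr q)].

Definition e (x : Q) : R[i] :=
  let t := 2 * pi * ratr (fracpart x) : R in (cos t +i* sin t)%C.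

Section Groups.
Variable n : nat.
Local Notation M := 'M[Q]_n.+1.

(* G(Z_p), inside the matrices over Q_p. *)
Definition GLZ : set M :=
  [set x : M | exists2 y : 'M[Zp hp]_n.+1,
             y \in unitmx & x = map_mx (@tofrac (Zp hp)) y].

Definition U : set M :=
  [set u : M | (forall i, u i i = 1)
               /\ (forall i j : 'I_n.+1, (j < i)%N -> u i j = 0)].

Definition Utr : set M := [set u : M | U u^T].

Definition UZ : set M := U `&` GLZ.

Definition Uw (w : M) : set M :=
  U `&` [set invmx w *m v *m w | v in Utr].

Definition UwZ (w : M) : set M := Uw w `&` GLZ.

(* For 1 <= i <= j <= n, the entry in row i and column j + 1, counted from 1. *)
Definition uentry (u : M) (i j : nat) : Q := u (inord i.-1) (inord j).

Definition character (psi : nat -> int) (u : M) : R[i] :=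
  e (\sum_(1 <= j < n.+1) (psi j)%:~R * uentry u j j).

Definition Cset (t w : M) : set M :=
  [set x : M | exists u u', [/\ U u, U u' & x = u *m (t *m w) *m u']] `&` GLZ.

(* The unique pair (u(x), u'(x)), for t in T(Q_p), w a signed permutation     *)
(* matrix and x in Cset t w.                                                  *)
Definition bruhat (t w x : M) : M * M :=
  xget (1%:M, 1%:M)
    [set g : M * M | [/\ U g.1, Uw w g.2 & x = g.1 *m (t *m w) *m g.2]].

Definition dcoset (w x : M) : set M :=
  [set y : M | exists v v', [/\ UZ v, UwZ w v' & y = v *m x *m v']].

Definition Xset (t w : M) : set (set M) := dcoset w @` Cset t w.

(* For such t and w the set Xset t w is finite, and the summand does not      *)
(* depend on the element of the double coset D at which it is evaluated.      *)
Definition Kl (psi psi' : nat -> int) (t w : M) : R[i] :=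
  \sum_(D \in Xset t w)
    let g := bruhat t w (xget 0 D) in character psi g.1 * character psi' g.2.

Definition wl : M :=
  \matrix_(i < n.+1, j < n.+1) if (i + j == n)%N then (-1) ^+ (n - i) else 0.

(* p^(r_i - r_(i+1)) for 0 <= i <= n, with r_0 and r_(n+1) read as 0; only    *)
(* the values of r on 1, ..., n are used.                                     *)
Definition Cstar (r : nat -> nat) : M :=
  let r' i := if (0 < i <= n)%N then r i else 0%N in
  diag_mx (\row_(i < n.+1) (p%:R : Q) ^ ((r' i)%:Z - (r' i.+1)%:Z)).

End Groups.

(* The pairs 1 <= i <= j <= n. *)
Definition idx (n : nat) :=
  {ij : 'I_n.+1 * 'I_n.+1 | (0 < ij.1)%N && (ij.1 <= ij.2)%N}.

(* The value of f at (i, j) if 1 <= i <= j <= n, and d otherwise. When i or j *)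
(* exceeds n, inord returns 0, which is not the component of a valid index.   *)
Definition ext (n : nat) (T : Type) (d : T) (f : idx n -> T) (i j : nat) : T :=
  if insub (inord i, inord j) is Some ij then f ij else d.

Section PartialSum.
Variable n : nat.

Definition Mset (r : nat -> nat) : set {ffun idx n -> nat} :=
  [set m : {ffun idx n -> nat} | forall k, (1 <= k <= n)%N ->
    (\sum_(ij : idx n | (val ij).1 <= k <= (val ij).2) m ij = r k)%N].

Variable m : {ffun idx n -> nat}.
Local Notation mm := (ext 0%N m).

Definition cmod (ij : idx n) : nat :=
  (\prod_((val ij).2 <= k < n.+1) p ^ mm (val ij).1 k)%N.

(* Elements of Z/(cmod ij)Z are encoded by their remainders. *)
Definition residues := {dffun forall ij : idx n, 'I_(cmod ij)}.

Definition Cpred (c : residues) : bool :=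
  [forall ij, coprime (c ij) (p ^ m ij)].

Definition rep_system (rep : forall ij : idx n, 'I_(cmod ij) -> int) : Prop :=
  forall ij (a : 'I_(cmod ij)), (rep ij a = (a : nat)%:Z %[mod cmod ij])%Z.

Definition KlM (psi psi' : nat -> int)
    (rep : forall ij : idx n, 'I_(cmod ij) -> int) : R[i] :=
  \sum_(c : residues | Cpred c)
    let cc i j : Q := (ext 1 (fun ij => rep ij (c ij)) i j)%:~R in
    let cbar i j : Q :=
      if (j < i)%N then 1 else if mm i j == 0%N then 0 else (cc i j)^-1 in
    let P i j : Q := p%:R ^+ mm i j in
    e ((\sum_(1 <= j < n.+1) \sum_(1 <= i < j.+1)
         (psi j)%:~R * cc i j.-1 * cbar i j
         * (\prod_(1 <= k < i) P k j.-1)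
         * (\prod_(1 <= k < i.+1) (P k j)^-1))
     + (\sum_(1 <= i < n.+1) \sum_(1 <= j < i.+1)
         (psi' i)%:~R * cc (n.+1 - i)%N (n.+1 - j)%N
         * cbar (n.+2 - i)%N (n.+1 - j)%N
         * (\prod_(1 <= k < j) P (n.+2 - i)%N (n.+1 - k)%N)
         * (\prod_(1 <= k < j.+1) (P (n.+1 - i)%N (n.+1 - k)%N)^-1))).

End PartialSum.
End Kloosterman.

Arguments wl {p} hp n.
Arguments Cstar {p} hp n r.
Arguments Mset : clear implicits.
Arguments Kl R {p hp n} psi psi' t w.
Arguments KlM R {p} hp {n} m psi psi' rep.

(* Main.v *)
Require Import Defs.
From HB Require Import structures.
From mathcomp Require Import all_boot all_order all_algebra.
From mathcomp Require Import all_classical all_reals all_analysis.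
From mathcomp Require Import complex.
From mathcomp Require Import perm fraction zify ring.
From mathcomp Require generic_quotient.
Set Implicit Arguments.
Unset Strict Implicit.
Unset Printing Implicit Defensive.
Import Order.TTheory GRing.Theory Num.Theory.
Local Open Scope ring_scope.
Local Open Scope classical_set_scope.

(* Let x lie in the big cell of GL(n+1, Z_p).  By the Iwasawa decomposition,
   multiplying x on the right by an element of GL(n, Z_p), embedded in the first
   n rows and columns, makes it upper Hessenberg: x = b k, where the subdiagonal
   of b consists of powers p^m_j up to units (these m_j are the m_1j) and k lies
   in the big cell of GL(n, Z_p).  An integral invertible upper Hessenberg matrix
   is, up to an upper triangular factor on the left, a product of n factors
   [[c', c c' - 1], [p^m, c]] placed at the successive diagonal positions, with
   c' = 0 if m = 0 and c' = 1/c otherwise.  The first column of b^-1 has the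
   entries (-1)^j c_j p^(m_1 + ... + m_(j-1)), and modulo p^(r_1) it is a complete
   invariant of b for U(Z_p) acting on the left and the unipotents of the last
   column acting on the right: this is why c_j matters only modulo
   p^(m_j + ... + m_n).  Since no nontrivial pair (h, v) of unipotent matrices
   satisfies h k = k v, induction on n turns X(N) into the disjoint union of the
   sets of pairs (m, c), whichever representatives of the residue classes are used.
   The superdiagonals of u(x) and u'(x) follow the same recursion. *)

(** Why the Iwasawa step gives Hessenberg shape: below its first row and left of its last column,
    the antidiagonal matrix N of size d+1 is an antidiagonal matrix of size d. If x = u N u', making
    this block of N u' upper triangular by a factor on the right makes x vanish below the
    subdiagonal, and the inverse of that factor lies in the big cell one size down. A pair (h, v)
    with h k = k v is trivial because k = u N u' turns it into the equality of an upper and, after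
    conjugation by N, a lower unipotent matrix. Two obstacles shape the induction. The
    representatives allowed for c_ij depend on the whole array m, so a level must fix its exponents
    before the lower levels are treated. Changing a representative produces a column operation
    standing to the left of k; conjugation by k turns it into an integral operation on the same
    column at the right. Finally, the upper triangular factors split off have units on the diagonal;
    these units are seen to be 1 only at the end, when two tori made of powers of p are compared. *)

Lemma ord_gtF n (i j : 'I_n) : (j < i)%N -> (i == j) = false.
Proof. by move=> ji; rewrite -val_eqE gtn_eqF. Qed.

Lemma ord_ltF n (i j : 'I_n) : (i < j)%N -> (i == j) = false.
Proof. by move=> ij; rewrite -val_eqE ltn_eqF. Qed.

(** * Triangular and block matrices *)

Section Triangular.
Variables (F : fieldType) (n : nat).
Local Notation M := 'M[F]_n.+1.
Implicit Types (x y u v : M) (d : nat).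

Definition upper x := forall i j : 'I_n.+1, (j < i)%N -> x i j = 0.

Definition unip u := (forall i, u i i = 1) /\ upper u.

(* GL(d) is embedded in the top left corner of a fixed GL(n+1), so that the
   induction on the size needs no change of dimension. *)
Definition topblk d x :=
  forall i j : 'I_n.+1, (d <= i)%N || (d <= j)%N -> x i j = (i == j)%:R.

Definition trunc d x : M :=
  \matrix_(i, j) if (i < d)%N && (j < d)%N then x i j else (i == j)%:R.

Lemma upper1 : upper 1%:M.
Proof. by move=> i j ji; rewrite !mxE ord_gtF. Qed.

Lemma upperM x y : upper x -> upper y -> upper (x *m y).
Proof.
move=> hx hy i j ji; rewrite mxE big1 // => l _.
by case: (ltnP l i) => [/hx ->|il]; rewrite ?mul0r // hy ?mulr0 // (leq_trans ji).
Qed.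

Lemma upperM_diag x y i : upper x -> upper y -> (x *m y) i i = x i i * y i i.
Proof.
move=> hx hy; rewrite mxE (bigD1 i) //= big1 ?addr0 // => l li.
case: (ltngtP l i) => [/hx ->|/hy ->|/val_inj e]; rewrite ?mul0r ?mulr0 //.
by rewrite e eqxx in li.
Qed.

Lemma upper_unit x : upper x -> (x \in unitmx) = [forall i, x i i != 0].
Proof.
move=> hx; rewrite unitmxE -det_tr det_trig; last first.
  by apply/is_trig_mxP => i j ij; rewrite mxE hx.
rewrite unitfE prodf_seq_neq0; apply/allP/forallP => [h i|h i _].
  by have := h i; rewrite mxE => /(_ (mem_index_enum i)).
by rewrite mxE h.
Qed.

(** Induction on the column: in the entry (i, j) of [invmx x *m x = 1] the terms left of [j] vanish
    by induction and those right of [j] by triangularity of [x], which leaves one term with a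
    nonzero factor. *)
Lemma upperV x : upper x -> x \in unitmx -> upper (invmx x).
Proof.
move=> hx ux i j; have := hx; set y := invmx x => _.
have yx : y *m x = 1%:M by rewrite mulVmx.
have d0 k : x k k != 0 by move: ux; rewrite upper_unit // => /forallP.
have [k jk] := ubnP (j : nat); elim: k j jk i => // k IH j jk i ji.
have := congr1 (fun z : M => z i j) yx; rewrite !mxE (ord_gtF ji) (bigD1 j) //=.
rewrite big1 ?addr0 => [/eqP|l lj]; first by rewrite mulf_eq0 (negPf (d0 j)) orbF => /eqP.
case: (ltngtP l j) => [lt|/hx ->|/val_inj e]; rewrite ?mulr0 //.
  by rewrite IH ?mul0r //; [apply: leq_trans lt _|apply: ltn_trans lt _].
by rewrite e eqxx in lj.
Qed.

Lemma upperV_diag x i : upper x -> x \in unitmx -> invmx x i i = (x i i)^-1.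
Proof.
move=> hx ux; have d0 : x i i != 0 by move: ux; rewrite upper_unit // => /forallP.
apply: (mulIf d0); rewrite mulVf // -upperM_diag //; last exact: upperV.
by rewrite mulVmx // mxE eqxx.
Qed.

Lemma unip1 : unip 1%:M.
Proof. by split=> [i|]; [rewrite mxE eqxx|exact: upper1]. Qed.

Lemma unipM u v : unip u -> unip v -> unip (u *m v).
Proof.
move=> [u1 hu] [v1 hv]; split=> [i|]; last exact: upperM.
by rewrite upperM_diag // u1 v1 mulr1.
Qed.

Lemma unip_unit u : unip u -> u \in unitmx.
Proof. by move=> [u1 hu]; rewrite upper_unit //; apply/forallP=> i; rewrite u1 oner_neq0. Qed.

Lemma unipV u : unip u -> unip (invmx u).
Proof.
move=> hu; have uu := unip_unit hu; case: hu => u1 hu.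
split=> [i|]; last exact: upperV.
by rewrite upperV_diag // u1 invr1.
Qed.

Lemma unipM_super u v (i j : 'I_n.+1) : unip u -> unip v -> j = i.+1 :> nat ->
  (u *m v) i j = u i j + v i j.
Proof.
move=> [u1 hu] [v1 hv] ij; have neq : j != i by rewrite -val_eqE /= ij neq_ltn leqnn orbT.
rewrite mxE (bigD1 j) //= (bigD1 i) 1?eq_sym //= u1 v1 mulr1 mul1r big1 ?addr0 // => l /andP[lj li].
case: (ltnP l i) => [/hu ->|il]; first by rewrite mul0r.
rewrite hv ?mulr0 // ij ltn_neqAle; apply/andP; split.
  by rewrite -ij eq_sym.
by rewrite ltn_neqAle il eq_sym andbT.
Qed.

Lemma mulmx_insert u v x y g : u \in unitmx -> v \in unitmx ->
  x *m g *m y = x *m invmx u *m (u *m g *m v) *m (invmx v *m y).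
Proof. by move=> uu vu; rewrite !mulmxA mulmxKV // mulmxK. Qed.

Lemma topblk_row d x (i j : 'I_n.+1) : topblk d x -> (d <= i)%N -> x i j = (i == j)%:R.
Proof. by move=> h di; rewrite h ?di. Qed.

Lemma topblk_col d x (i j : 'I_n.+1) : topblk d x -> (d <= j)%N -> x i j = (i == j)%:R.
Proof. by move=> h di; rewrite h ?di ?orbT. Qed.

Lemma topblk1 d : topblk d 1%:M.
Proof. by move=> i j _; rewrite mxE. Qed.

Lemma topblkM d x y : topblk d x -> topblk d y -> topblk d (x *m y).
Proof.
move=> hx hy i j /orP[di|dj]; rewrite mxE.
  rewrite (bigD1 i) //= (topblk_row _ hx) // eqxx mul1r big1 ?addr0; first by rewrite (topblk_row _ hy).
  by move=> l li; rewrite (topblk_row _ hx) // eq_sym (negPf li) mul0r.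
rewrite (bigD1 j) //= (topblk_col _ hy) // eqxx mulr1 big1 ?addr0; first by rewrite (topblk_col _ hx).
by move=> l li; rewrite (topblk_col _ hy) // (negPf li) mulr0.
Qed.

Lemma topblkV d x : x \in unitmx -> topblk d x -> topblk d (invmx x).
Proof.
move=> ux hx i j /orP[di|dj].
  have := congr1 (fun z : M => z i j) (mulmxV ux); rewrite !mxE => <-.
  rewrite (bigD1 i) //= (topblk_row _ hx) // eqxx mul1r big1 ?addr0 // => l li.
  by rewrite (topblk_row _ hx) // eq_sym (negPf li) mul0r.
have := congr1 (fun z : M => z i j) (mulVmx ux); rewrite !mxE => <-.
rewrite (bigD1 j) //= (topblk_col _ hx) // eqxx mulr1 big1 ?addr0 // => l li.
by rewrite (topblk_col _ hx) // (negPf li) mulr0.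
Qed.

Lemma topblkW d e x : (d <= e)%N -> topblk d x -> topblk e x.
Proof. by move=> de hx i j h; apply: hx; case/orP: h => h; rewrite (leq_trans de h) ?orbT. Qed.

Lemma topblk_full x : topblk n.+1 x.
Proof. by move=> i j /orP[]; rewrite leqNgt ltn_ord. Qed.

Lemma topblk_mulr m1 d (x : 'M[F]_(m1, n.+1)) y i (j : 'I_n.+1) : topblk d y -> (d <= j)%N -> (x *m y) i j = x i j.
Proof.
move=> hy dj; rewrite mxE (bigD1 j) //= (topblk_col _ hy) // eqxx mulr1 big1 ?addr0 // => l lj.
by rewrite (topblk_col _ hy) // (negPf lj) mulr0.
Qed.

Lemma topblk_mull m1 d x (y : 'M[F]_(n.+1, m1)) (i : 'I_n.+1) j : topblk d x -> (d <= i)%N -> (x *m y) i j = y i j.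
Proof.
move=> hx di; rewrite mxE (bigD1 i) //= (topblk_row _ hx) // eqxx mul1r big1 ?addr0 // => l lj.
by rewrite (topblk_row _ hx) // eq_sym (negPf lj) mul0r.
Qed.

Lemma trunc_topblk d x : topblk d (trunc d x).
Proof. by move=> i j /orP[] h; rewrite mxE [(_ < d)%N]ltnNge ?h // [(j < d)%N]ltnNge h andbF. Qed.

Lemma trunc_unip d x : unip x -> unip (trunc d x).
Proof.
move=> [x1 hx]; split=> [i|i j ji]; rewrite !mxE; first by rewrite x1 eqxx if_same.
by rewrite hx // ord_gtF // if_same.
Qed.

(** Truncation is not multiplicative in general, but it commutes with a factor that is already a
    block. This carries an identity of level d+1 down to level d. *)
Lemma truncMl d x y : topblk d y -> trunc d (x *m y) = trunc d x *m y.
Proof.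
move=> hy; apply/matrixP=> i j; rewrite [LHS]mxE; case: ifPn => [/andP[id jd]|].
  rewrite !mxE; apply: eq_bigr => l _; rewrite mxE id /=; case: ltnP => // dl.
  by rewrite (topblk_row _ hy) // ord_gtF ?mulr0 // (leq_trans jd).
by rewrite negb_and -leqNgt -leqNgt => h; rewrite (topblkM (@trunc_topblk d x) hy).
Qed.

Lemma truncMr d x y : topblk d x -> trunc d (x *m y) = x *m trunc d y.
Proof.
move=> hx; apply/matrixP=> i j; rewrite [LHS]mxE; case: ifPn => [/andP[id jd]|].
  rewrite !mxE; apply: eq_bigr => l _; rewrite mxE jd andbT; case: ltnP => // dl.
  by rewrite (topblk_col _ hx) // ord_ltF ?mul0r // (leq_trans id).
by rewrite negb_and -leqNgt -leqNgt => h; rewrite (topblkM hx (@trunc_topblk d y)).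
Qed.

End Triangular.

(** * Discrete valuation rings and the Iwasawa decomposition *)

Section DVR.
Variables (F : fieldType) (O : subringClosed F) (p : F).

Definition unitO (x : F) := [&& x != 0, x \in O & x^-1 \in O].

(** A discrete valuation ring seen inside its fraction field; the decomposition [dvr_val] plays the
    part of the valuation. The matrix arguments use Q_p through these four properties. *)
Record dvr := Dvr {
  dvr_p : p \in O;
  dvr_p0 : p != 0;
  dvr_pV : p^-1 \notin O;
  dvr_val : forall x, x != 0 -> exists u (k : int), unitO u /\ x = u * p ^ k }.

Lemma unitOM x y : unitO x -> unitO y -> unitO (x * y).
Proof.
by move=> /and3P[x0 xO xVO] /and3P[y0 yO yVO]; rewrite /unitO mulf_neq0 // invfM !rpredM.
Qed.

Lemma unitOV x : unitO x -> unitO x^-1.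
Proof. by move=> /and3P[x0 xO xVO]; rewrite /unitO invr_eq0 invrK xVO xO x0. Qed.

Lemma unitOW x : unitO x -> x \in O.
Proof. by case/and3P. Qed.

Lemma unitO_neq0 x : unitO x -> x != 0.
Proof. by case/and3P. Qed.

Lemma unitO1 : unitO 1.
Proof. by rewrite /unitO oner_neq0 invr1 !rpred1. Qed.

Hypothesis D : dvr.

Lemma unitO_expz k : unitO (p ^ k) -> k = 0.
Proof.
move=> uk; apply/eqP; apply: contraNT (dvr_pV D) => k0.
(* A negative exponent is replaced by its opposite, since units are closed under inversion; [p^-1]
   is then [p ^+ (l - 1)] times the inverse of [p ^+ l]. *)
have [l [l0 /and3P[_ _ lO]]] : exists k : nat, k != 0%N /\ unitO (p ^+ k).
  case: k k0 uk => k k0 uk; first by exists k.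
  by exists k.+1; split=> //; rewrite -[X in unitO X]invrK; apply: unitOV; rewrite -exprVn exprVn.
case: l l0 lO => // l _ lO.
suff -> : p^-1 = p ^+ l * (p ^+ l.+1)^-1 by rewrite rpredM // rpredX // (dvr_p D).
by rewrite exprS invfM mulrCA mulfV ?mulr1 // expf_neq0 // (dvr_p0 D).
Qed.

(** The only unit among the powers of [p] is 1. This removes the diagonal of an upper triangular
    factor once two tori made of powers of [p] are compared. *)
Lemma unitO_expz_eq b k l : unitO b -> p ^ k = b * p ^ l -> b = 1 /\ p ^ l = p ^ k.
Proof.
have p0 := dvr_p0 D; move=> ub e; have bE : b = p ^ (k - l).
  by rewrite expfzDr // -invr_expz e mulfK // expfz_neq0.
have b1 : b = 1 by move: ub; rewrite bE => /unitO_expz ->.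
by rewrite e b1 mul1r.
Qed.

Lemma dvr_int x : x \in O -> x != 0 -> exists u (k : nat), unitO u /\ x = u * p ^+ k.
Proof.
move=> xO x0; have [u [[k|k] [uu xE]]] := dvr_val D x0; first by exists u, k.
have /and3P[u0 uO uVO] := uu.
suff /unitO_expz : unitO (p ^ (k.+1)%:Z) by [].
have px : p ^+ k.+1 * x = u.
  by rewrite xE NegzE -invr_expz -exprnP mulrCA mulfV ?mulr1 // expf_neq0 // (dvr_p0 D).
rewrite /unitO expf_neq0 ?(dvr_p0 D) //= rpredX ?(dvr_p D) //=.
suff -> : (p ^ k.+1)^-1 = x * u^-1 by rewrite rpredM.
by rewrite -px invfM mulrC mulfVK.
Qed.

Lemma dvr_total x y : x != 0 -> y != 0 -> (y / x \in O) || (x / y \in O).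
Proof.
move=> x0 y0; have [u [k [/and3P[u0 uO uVO] ->]]] := dvr_val D x0.
have [v [l [/and3P[v0 vO vVO] ->]]] := dvr_val D y0.
have pz : forall a b : int, p ^ a / p ^ b = p ^ (a - b).
  by move=> a b; rewrite expfzDr ?(dvr_p0 D) // invr_expz.
have key : forall a b : int, (a <= b)%R -> p ^ b / p ^ a \in O.
  move=> a b ab; rewrite pz; have: (0 <= b - a)%R by rewrite subr_ge0.
  by case: (b - a) => // m _; rewrite rpredX // (dvr_p D).
by case: (leP k l) => [kl|/ltW lk]; apply/orP; [left|right];
  rewrite invfM mulrACA rpredM ?key //; apply: rpredM.
Qed.

(** Otherwise [x] would be zero or a multiple of [p], and [p] would divide 1. *)
Lemma unitO_local x y z : x \in O -> y \in O -> z \in O -> x * y + p * z = 1 -> unitO x.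
Proof.
move=> xO yO zO e; have [x0|x0] := eqVneq x 0.
  case/negP: (dvr_pV D); suff -> : p^-1 = z by [].
  by apply: (mulfI (dvr_p0 D)); rewrite mulfV ?(dvr_p0 D) // -e x0 mul0r add0r.
have [u [k [uu xE]]] := dvr_int xO x0.
case: k xE => [|k] xE; first by rewrite xE expr0 mulr1.
case/negP: (dvr_pV D); suff -> : p^-1 = u * p ^+ k * y + z.
  by rewrite rpredD // !rpredM ?rpredX ?(dvr_p D) // unitOW.
by apply: (mulfI (dvr_p0 D)); rewrite mulfV ?(dvr_p0 D) // -e xE exprS; ring.
Qed.

Variable n : nat.
Local Notation M := 'M[F]_n.+1.
Implicit Types (x y u v g : M) (d : nat).

Definition intmx m1 m2 (x : 'M[F]_(m1, m2)) := forall i j, x i j \in O.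

Definition GLO x := intmx x /\ exists2 y : M, intmx y & x *m y = 1%:M.

Lemma intmxM m1 m2 m3 (x : 'M[F]_(m1, m2)) (y : 'M[F]_(m2, m3)) :
  intmx x -> intmx y -> intmx (x *m y).
Proof. by move=> hx hy i j; rewrite mxE rpred_sum // => l _; rewrite rpredM. Qed.

Lemma intmx1 : intmx (1%:M : M).
Proof. by move=> i j; rewrite mxE rpred_nat. Qed.

Lemma GLO1 : GLO 1%:M.
Proof. by split; [exact: intmx1|exists 1%:M; [exact: intmx1|rewrite mulmx1]]. Qed.

Lemma GLOM x y : GLO x -> GLO y -> GLO (x *m y).
Proof.
move=> [xO [x' x'O xx']] [yO [y' y'O yy']]; split; first exact: intmxM.
exists (y' *m x'); first exact: intmxM.
by rewrite mulmxA -(mulmxA x) yy' mulmx1.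
Qed.

Lemma GLO_unit x : GLO x -> x \in unitmx.
Proof. by move=> [_ [y _ /mulmx1_unit[]]]. Qed.

Lemma GLO_invE x y : x *m y = 1%:M -> invmx x = y.
Proof. by move=> e; have [ux _] := mulmx1_unit e; rewrite -[y](mulKmx ux) e mulmx1. Qed.

Lemma GLOV x : GLO x -> GLO (invmx x).
Proof.
move=> hx; have ux := GLO_unit hx; case: hx => xO [y yO xy].
by rewrite (GLO_invE xy); split=> //; exists x => //; apply: mulmx1C.
Qed.

Lemma GLO_det x : intmx x -> unitO (\det x) -> GLO x.
Proof.
move=> xO /and3P[d0 _ dV]; have ux : x \in unitmx by rewrite unitmxE unitfE.
split=> //; exists (invmx x); last by rewrite mulmxV.
move=> i j; rewrite /invmx ux !mxE rpredM // rpredM ?rpredX ?rpredN ?rpred1 //.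
apply: rpred_sum => s _; apply: rpredM; first by rewrite rpredX ?rpredN ?rpred1.
by apply: rpred_prod => k _; rewrite !mxE.
Qed.

Lemma det_unip u : unip u -> \det u = 1.
Proof.
move=> [u1 hu]; rewrite -det_tr det_trig; last by apply/is_trig_mxP => i j ij; rewrite mxE hu.
by rewrite big1 // => i _; rewrite mxE u1.
Qed.

Lemma unip_GLO u : unip u -> intmx u -> GLO u.
Proof. by move=> hu uO; apply: GLO_det => //; rewrite det_unip // unitO1. Qed.

Lemma GLO_upper_diag x i : GLO x -> upper x -> unitO (x i i).
Proof.
move=> hx ux; have uu := GLO_unit hx; apply/and3P; split.
- by move: uu; rewrite upper_unit // => /forallP.
- by case: hx.
- by rewrite -upperV_diag //; case: (GLOV hx).
Qed.

(** Supplies the pivot of the row reduction: an entry of least valuation. *)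
Lemma dvr_min (s : seq F) : has (predC1 0) s ->
  exists a, [/\ a \in s, a != 0 & forall b, b \in s -> b / a \in O].
Proof.
elim: s => //= x s IH; have [->|x0 _] /= := eqVneq x 0.
  move=> /IH[a [aS a0 ha]]; exists a; split=> //; first by rewrite inE aS orbT.
  by move=> b; rewrite inE => /orP[/eqP->|/ha//]; rewrite mul0r rpred0.
have [/IH[a [aS a0 ha]]|nz] := boolP (has (predC1 0) s); last first.
  exists x; split=> [||b]; rewrite ?mem_head // inE => /orP[/eqP->|bs].
    by rewrite divff // rpred1.
  by move/hasPn: nz => /(_ _ bs); rewrite /= negbK => /eqP->; rewrite mul0r rpred0.
have /orP[h|h] := dvr_total x0 a0.
  exists x; split=> [||b]; rewrite ?mem_head // inE => /orP[/eqP->|bs].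
    by rewrite divff // rpred1.
  suff -> : b / x = (b / a) * (a / x) by rewrite rpredM // ha.
  by rewrite mulrA divfK.
exists a; split=> //; first by rewrite inE aS orbT.
by move=> b; rewrite inE => /orP[/eqP->|/ha//].
Qed.

(** A transposition brings an entry of least valuation to position [q]; the quotients by it are
    integral, so column operations clear the rest. Nothing beyond [q] moves because the row vanishes
    there. *)
Lemma row_reduction (q : 'I_n.+1) (v : 'rV[F]_n.+1) :
  v != 0 -> (forall j : 'I_n.+1, (q < j)%N -> v 0 j = 0) ->
  exists x, [/\ GLO x, topblk q.+1 x & forall j, j != q -> (v *m x) 0 j = 0].
Proof.
move=> v0 vq; have /dvr_min[a [/mapP[i0 _ ->] i00 ha]] :
    has (predC1 0) [seq v 0 j | j <- enum 'I_n.+1].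
  rewrite has_map; apply/hasP; have /existsP[j hj] : [exists j, v 0 j != 0].
    apply: contraNT v0 => /existsPn h; apply/eqP/rowP => j; rewrite mxE.
    by have := h j; rewrite negbK => /eqP.
  by exists j; rewrite ?mem_enum.
have {}ha j : v 0 j / v 0 i0 \in O by apply: ha; apply/mapP; exists j; rewrite ?mem_enum.
have i0q : (i0 <= q)%N by rewrite leqNgt; apply: contraNN i00 => /vq ->.
pose s : M := tperm_mx i0 q; have [v' v'D] : {v' | v' = v *m s} by exists (v *m s).
have v'E j : v' 0 j = v 0 (tperm i0 q j).
  rewrite v'D mxE (bigD1 (tperm i0 q j)) //= !mxE tpermK eqxx mulr1 big1 ?addr0 // => l lj.
  rewrite !mxE; case: eqP => [e|]; rewrite ?mulr0 //.
  by rewrite -e tpermK eqxx in lj.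
have sO : intmx s by move=> i j; rewrite !mxE rpred_nat.
have sG : GLO s.
  split=> //; exists s => //.
  by rewrite /s /tperm_mx -perm_mxM tperm2 perm_mx1.
have sB : topblk q.+1 s.
  move=> i j /orP[h|h]; rewrite !mxE; last rewrite (canF_eq (tpermK i0 q));
    rewrite tpermD // -val_eqE ltn_eqF //; apply: leq_ltn_trans h => //.
pose E : M := \matrix_(i, j) if (i == q) && (j != q) then - (v' 0 j / v 0 i0) else (i == j)%:R.
have v'q : v' 0 q = v 0 i0 by rewrite v'E tpermR.
have v'j (j : 'I_n.+1) : (q < j)%N -> v' 0 j = 0.
  move=> qj; rewrite v'E tpermD ?vq // -val_eqE ltn_eqF //.
  by apply: leq_ltn_trans i0q qj.
have EO : intmx E.
  by move=> i j; rewrite mxE; case: ifP => _; rewrite ?rpred_nat // rpredN v'E.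
(* [E] is lower unipotent: its only extra entries are in row [q], and those right of the diagonal
   vanish with [v']. *)
have EU : unip E^T.
  split=> [i|i j ji]; rewrite !mxE; first by case: (i == q); rewrite //= eqxx.
  case: ifP => [/andP[/eqP e _]|_]; last by rewrite ord_ltF.
  by rewrite v'j ?mul0r ?oppr0 // -e.
have EG : GLO E by apply: GLO_det => //; rewrite -det_tr det_unip // unitO1.
exists (s *m E); split; first exact: GLOM.
- apply: topblkM => // i j h; rewrite mxE; case: ifP => // /andP[/eqP iq jq].
  have qj : (q < j)%N by case/orP: h => //; rewrite iq ltnn.
  by rewrite v'j // mul0r oppr0 iq eq_sym (negPf jq).
move=> j jq; rewrite mulmxA -v'D mxE (bigD1 q) //= mxE eqxx jq /= v'q.
rewrite (bigD1 j) //= mxE (negPf jq) eqxx mulr1 big1 ?addr0; last first.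
  by move=> l /andP[lq lj]; rewrite mxE (negPf lq) (negPf lj) mulr0.
by rewrite mulrN mulrC divfK // addNr.
Qed.

(** The rows are treated from the bottom upwards: those of index at least [q] already have
    triangular shape, and operations on the first [q] columns, where these rows are zero, leave it
    intact. *)
Lemma iwasawa_rec q g : (q <= n.+1)%N -> g \in unitmx ->
  (forall i j : 'I_n.+1, (q <= i)%N -> (j < i)%N -> g i j = 0) ->
  (forall i : 'I_n.+1, (q <= i)%N -> g i i != 0) ->
  exists x, [/\ GLO x, topblk q x & upper (g *m x)].
Proof.
elim: q g => [|q IH] g qn gu gT g0.
  by exists 1%:M; split; [exact: GLO1|exact: topblk1|rewrite mulmx1 => i j; apply: gT].
pose iq := Ordinal qn; pose v : 'rV[F]_n.+1 := \row_j if (j <= q)%N then g iq j else 0.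
(* If this part of the row vanished, back substitution would show that column [iq] of the inverse
   [h] vanishes below [iq], and the entry [(iq, iq)] of [g *m h] would be 0 instead of 1. *)
have v0 : v != 0.
  apply/negP => /eqP v0; have gq (j : 'I_n.+1) : (j <= q)%N -> g iq j = 0.
    by move=> jq; have := congr1 (fun z : 'rV_n.+1 => z 0 j) v0; rewrite !mxE jq.
  set h := invmx g; have gh : g *m h = 1%:M by rewrite mulmxV.
  have hq k (i : 'I_n.+1) : (n.+1 - i <= k)%N -> (q < i)%N -> h i iq = 0.
    elim: k i => [|k IHk] i; first by rewrite leqNgt subn_gt0 ltn_ord.
    move=> ik qi; have := congr1 (fun z : M => z i iq) gh; rewrite !mxE ord_gtF //.
    rewrite (bigD1 i) //= big1 ?addr0.
      by move/eqP; rewrite mulf_eq0 (negPf (g0 _ qi)) => /eqP.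
    move=> l li; case: (ltngtP l i) => [lt|lt|/val_inj e]; last by rewrite e eqxx in li.
      by rewrite gT ?mul0r.
    rewrite IHk ?mulr0 //; last exact: ltn_trans lt.
    by move: ik lt; have := ltn_ord l; lia.
  have := congr1 (fun z : M => z iq iq) gh; rewrite !mxE eqxx big1 => [/eqP|l _].
    by rewrite eq_sym oner_eq0.
  by case: (leqP l q) => lq; [rewrite gq ?mul0r|rewrite (hq n.+1) ?mulr0 ?leq_subr].
have [|x [xG xB xv]] := @row_reduction iq v v0.
  by move=> j qj; rewrite mxE leqNgt qj.
have xu := GLO_unit xG.
have gxE (i j : 'I_n.+1) : (iq < i)%N -> (g *m x) i j = if (j < i)%N then 0 else (g *m x) i j.
  move=> qi; case: ifP => // ji; rewrite mxE big1 // => l _.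
  case: (ltnP l i) => [/gT->|il]; rewrite ?mul0r //.
  by rewrite (topblk_row _ xB) ?ord_gtF ?mulr0 ?(leq_trans ji) // (leq_trans qi).
have gxq (j : 'I_n.+1) : (j <= q)%N -> (g *m x) iq j = (v *m x) 0 j.
  move=> jq; rewrite !mxE; apply: eq_bigr => l _; rewrite mxE; case: leqP => // ql.
  by rewrite (topblk_row _ xB) // ord_gtF ?mulr0 ?mul0r // (leq_ltn_trans jq).
have vxq : (v *m x) 0 iq != 0.
  apply: contraNN v0 => /eqP e; apply/eqP.
  have: v *m x = 0.
    apply/rowP => j; rewrite [RHS]mxE; have [->//|jq] := eqVneq j iq; exact: xv.
  by move/(congr1 (mulmx^~ (invmx x))); rewrite mulmxK // mul0mx.
have [||||y [yG yB yU]] := IH (g *m x).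
- exact: ltnW.
- by rewrite unitmx_mul gu.
- move=> i j; rewrite leq_eqVlt => /orP[/eqP e|qi] ji; last by rewrite gxE // ji.
  have -> : i = iq by apply: val_inj.
  rewrite gxq; last by rewrite ltnW // e.
  by rewrite xv // -val_eqE ltn_eqF //= e.
- move=> i; rewrite leq_eqVlt => /orP[/eqP e|qi].
    have -> : i = iq by apply: val_inj.
    by rewrite gxq.
  rewrite mxE (bigD1 i) //= (topblk_row _ xB) // eqxx mulr1 big1 ?addr0 ?g0 // => l li.
  case: (ltngtP l i) => [/gT->//|lt|/val_inj e]; rewrite ?mul0r //.
    by rewrite (topblk_row _ xB) ?(negPf li) ?mulr0 // (leq_trans qi) // ltnW.
  by rewrite e eqxx in li.
exists (x *m y); split; [exact: GLOM| |by rewrite mulmxA].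
by apply: topblkM => //; apply: topblkW yB.
Qed.

Lemma iwasawa d g : (d <= n.+1)%N -> g \in unitmx -> topblk d g ->
  exists x, [/\ GLO x, topblk d x & upper (g *m x)].
Proof.
move=> dn gu gB; apply: iwasawa_rec => // [i j di ji|i di].
  by rewrite (topblk_row _ gB) // ord_gtF.
by rewrite (topblk_row _ gB) // eqxx oner_neq0.
Qed.

End DVR.

(** * Bruhat cells and elementary factors *)

Section BottSamelson.
Variables (F : fieldType) (n : nat).
Local Notation M := 'M[F]_n.+1.
Implicit Types (x y u v g : M) (z w : 'cV[F]_n.+1) (d a e : nat).

(** The matrix diag(t) w_l of size [d.+1], padded by the identity; [d = n] and [t = 1] give w_l
    itself. *)
Definition Nmat d (t : nat -> F) : M :=
  \matrix_(i, j) if (i <= d)%N && (j <= d)%N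
                 then (if (i + j == d)%N then (-1) ^+ (d - i) * t i else 0)
                 else (i == j)%:R.

Lemma Nmat_topblk d t : topblk d.+1 (Nmat d t).
Proof. by move=> i j /orP[] h; rewrite mxE [(_ <= d)%N]leqNgt ?h // [(j <= d)%N]leqNgt h andbF. Qed.

Lemma eq_Nmat d t t' : (forall i, (i <= d)%N -> t i = t' i) -> Nmat d t = Nmat d t'.
Proof. by move=> tt'; apply/matrixP => i j; rewrite !mxE; case: leqP => // id; rewrite tt'. Qed.

Lemma Nmat_mulr d t x (i j l : 'I_n.+1) : (j <= d)%N -> l = (d - j)%N :> nat ->
  (x *m Nmat d t) i j = (-1) ^+ j * t l * x i l.
Proof.
move=> jd lE; rewrite mxE (bigD1 l) //= mxE lE leq_subr jd subnK // eqxx /= subKn //.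
rewrite mulrC big1 ?addr0 // => k kl; rewrite mxE jd andbT; case: leqP => kd.
  case: eqP => [e|_]; last by rewrite mulr0.
  by case/eqP: kl; apply: val_inj; rewrite /= lE; lia.
by rewrite ord_gtF ?mulr0 // (leq_ltn_trans jd).
Qed.

Lemma Nmat_mull d t x (i j l : 'I_n.+1) : (i <= d)%N -> l = (d - i)%N :> nat ->
  (Nmat d t *m x) i j = (-1) ^+ (d - i) * t i * x l j.
Proof.
move=> id lE; rewrite mxE (bigD1 l) //= mxE lE leq_subr id subnKC // eqxx /=.
rewrite big1 ?addr0 // => k kl; rewrite mxE id /=; case: leqP => kd.
  case: eqP => [e|_]; last by rewrite mul0r.
  by case/eqP: kl; apply: val_inj; rewrite /= lE; lia.
by rewrite ord_ltF ?mul0r // (leq_ltn_trans id).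
Qed.

Lemma ord_sub d (j : 'I_n.+1) : (d <= n)%N -> exists l : 'I_n.+1, l = (d - j)%N :> nat.
Proof. by move=> dn; exists (inord (d - j)); rewrite inordK // ltnS (leq_trans (leq_subr _ _)). Qed.

Lemma Nmat_unit d t : (d <= n)%N -> (forall i, (i <= d)%N -> t i != 0) -> Nmat d t \in unitmx.
Proof.
(* The inverse is again antidiagonal; the signs at two opposite positions multiply to [(-1) ^+ d],
   which explains this factor. *)
move=> dn t0; have: Nmat d t *m Nmat d (fun i => (-1) ^+ d / t (d - i)%N) = 1%:M.
  apply/matrixP => i j; have [jd|dj] := leqP j d; last first.
    by rewrite (topblkM (@Nmat_topblk _ _) (@Nmat_topblk _ _)) ?dj ?orbT // mxE.
  have [l lE] := ord_sub j dn; rewrite (Nmat_mulr _ _ _ jd lE) !mxE lE leq_subr andbT.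
  case: leqP => id; last by rewrite !ord_gtF ?mulr0 // ?lE (leq_ltn_trans _ id) ?leq_subr.
  have -> : (i + (d - j) == d)%N = (i == j).
    by rewrite -val_eqE /=; apply/eqP/eqP; lia.
  case: eqP => [->|_]; last by rewrite mulr0.
  have e : (-1 : F) ^+ d = (-1) ^+ j * (-1) ^+ (d - j) by rewrite -exprD subnKC.
  have sq k : (-1 : F) ^+ k * (-1) ^+ k = 1 by rewrite -exprD -signr_odd addnn odd_double.
  rewrite subKn // e.
  transitivity (((-1) ^+ j * (-1) ^+ j) * ((-1) ^+ (d - j) * (-1) ^+ (d - j)) : F).
    by field; rewrite t0.
  by rewrite !sq mulr1.
by case/mulmx1_unit.
Qed.

(* The entries of u above the diagonal are matched with entries of v below it. *)
Lemma bruhat_unique d t t' u v : (d <= n)%N ->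
  (forall i, (i <= d)%N -> t i != 0) -> (forall i, (i <= d)%N -> t' i != 0) ->
  unip u -> unip v -> topblk d.+1 u -> topblk d.+1 v ->
  u *m Nmat d t = Nmat d t' *m v ->
  [/\ u = 1%:M, v = 1%:M & forall i, (i <= d)%N -> t i = t' i].
Proof.
move=> dn t0 t'0 [u1 uU] [v1 vU] uB vB e.
have key (i l j k : 'I_n.+1) : (i <= d)%N -> (j <= d)%N -> l = (d - j)%N :> nat ->
    k = (d - i)%N :> nat -> (-1) ^+ j * t l * u i l = (-1) ^+ (d - i) * t' i * v k j.
  by move=> id jd lE kE; rewrite -(Nmat_mulr _ _ _ jd lE) e (Nmat_mull _ _ _ id kE).
have sg (k : nat) : (-1 : F) ^+ k != 0 by rewrite signr_eq0.
have tE i : (i <= d)%N -> t i = t' i.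
  move=> id; have iE : (inord i : 'I_n.+1) = i :> nat by rewrite inordK // ltnS (leq_trans id).
  have [k kE] := ord_sub (inord i) dn; rewrite iE in kE.
  have := key (inord i) (inord i) k k; rewrite u1 v1 !mulr1 kE iE leq_subr subKn //.
  by move/(_ id isT erefl erefl)/(mulfI (sg _)).
have u0 (i l : 'I_n.+1) : (i < l)%N -> u i l = 0.
  move=> il; have [ld|dl] := leqP l d; last by rewrite uB ?dl ?orbT // ord_ltF.
  have [j jE] := ord_sub l dn; have [k kE] := ord_sub i dn.
  have := key i l j k; rewrite jE leq_subr subKn // (leq_trans (ltnW il)) //.
  rewrite [v k j]vU; last by rewrite jE kE; lia.
  by move/(_ isT isT erefl kE)/eqP; rewrite mulr0 !mulf_eq0 (negPf (sg _)) (negPf (t0 _ ld)) => /eqP.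
have v0 (k j : 'I_n.+1) : (k < j)%N -> v k j = 0.
  move=> kj; have [jd|dj] := leqP j d; last by rewrite vB ?dj ?orbT // ord_ltF.
  have [i iE] := ord_sub k dn; have [l lE] := ord_sub j dn.
  have kd : (k <= d)%N by rewrite (leq_trans (ltnW kj)).
  have id : (i <= d)%N by rewrite iE leq_subr.
  have := key i l j k id jd lE; rewrite iE subKn // [u i l]uU; last by rewrite iE lE; lia.
  move/(_ erefl)/esym/eqP; rewrite mulr0 !mulf_eq0 (negPf (sg _)) /= => /orP[h|/eqP//].
  by have := t'0 (d - k)%N (leq_subr _ _); rewrite h.
split=> //; apply/matrixP => i j; rewrite mxE -val_eqE /=.
- by case: (ltngtP i j) => [/u0->|/uU->|/val_inj->] //; rewrite ?u1.
- by case: (ltngtP i j) => [/v0->|/vU->|/val_inj->] //; rewrite ?v1.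
Qed.

Lemma bruhat_cell_unique t t' u u' v v' :
  (forall i, (i <= n)%N -> t i != 0) -> (forall i, (i <= n)%N -> t' i != 0) ->
  unip u -> unip u' -> unip v -> unip v' ->
  u *m Nmat n t *m u' = v *m Nmat n t' *m v' ->
  [/\ u = v, u' = v' & forall i, (i <= n)%N -> t i = t' i].
Proof.
move=> t0 t'0 uU u'U vU v'U e; have [uu u'u] := (unip_unit uU, unip_unit u'U).
have [vu v'u] := (unip_unit vU, unip_unit v'U).
have e' : invmx v *m u *m Nmat n t = Nmat n t' *m (v' *m invmx u').
  rewrite !mulmxA; apply: (canRL (mulmxK u'u)); rewrite -!mulmxA; apply: (canLR (mulKmx vu)).
  by rewrite !mulmxA.
have [h1 h2 h3] := bruhat_unique (leqnn n) t0 t'0 (unipM (unipV vU) uU)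
  (unipM v'U (unipV u'U)) (@topblk_full _ _ _) (@topblk_full _ _ _) e'.
split=> //.
  by rewrite -[RHS]mulmx1 -h1 mulKVmx.
by rewrite -[RHS](mulmxKV u'u) h2 mul1mx.
Qed.

Definition embed2 a (A B C E : F) : M :=
  \matrix_(i, j)
    if i == a :> nat then (if j == a :> nat then A else if j == a.+1 :> nat then B else 0)
    else if i == a.+1 :> nat then (if j == a :> nat then C else if j == a.+1 :> nat then E else 0)
    else (i == j)%:R.

Lemma embed2_mulr m1 (x : 'M[F]_(m1, n.+1)) a A B C E i (j a0 a1 : 'I_n.+1) :
  a0 = a :> nat -> a1 = a.+1 :> nat ->
  (x *m embed2 a A B C E) i j =
    if j == a0 then x i a0 * A + x i a1 * C
    else if j == a1 then x i a0 * B + x i a1 * E else x i j.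
Proof.
move=> h0 h1; have n10 : a1 != a0 by rewrite -val_eqE /= h0 h1 gtn_eqF.
rewrite mxE (bigD1 a0) //= (bigD1 a1) //= !mxE h0 h1 !eqxx (gtn_eqF (ltnSn a)).
rewrite -[j == a0]val_eqE -[j == a1]val_eqE /= h0 h1.
have rest : \sum_(l | (l != a0) && (l != a1)) x i l * embed2 a A B C E l j =
    \sum_(l | (l != a0) && (l != a1)) x i l * (l == j)%:R.
  apply: eq_bigr => l /andP[l0 l1]; rewrite mxE.
  have -> : (l == a :> nat) = false by rewrite -h0; apply: negPf l0.
  by have -> : (l == a.+1 :> nat) = false by rewrite -h1; apply: negPf l1.
rewrite {}rest; have [ja|ja] := eqVneq (j : nat) a.
  rewrite addrA big1 ?addr0 // => l /andP[l0 _].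
  have -> : (l == j) = false by rewrite -val_eqE /= ja -h0; apply: negPf l0.
  by rewrite mulr0.
have [ja1|ja1] := eqVneq (j : nat) a.+1.
  rewrite addrA big1 ?addr0 // => l /andP[_ l1].
  have -> : (l == j) = false by rewrite -val_eqE /= ja1 -h1; apply: negPf l1.
  by rewrite mulr0.
rewrite !mulr0 !add0r (bigD1 j) /=; last by rewrite -!val_eqE /= h0 h1 ja.
by rewrite eqxx mulr1 big1 ?addr0 // => l /andP[_ lj]; rewrite (negPf lj) mulr0.
Qed.

Lemma embed2_mull m1 (x : 'M[F]_(n.+1, m1)) a A B C E (i a0 a1 : 'I_n.+1) j :
  a0 = a :> nat -> a1 = a.+1 :> nat ->
  (embed2 a A B C E *m x) i j =
    if i == a0 then A * x a0 j + B * x a1 j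
    else if i == a1 then C * x a0 j + E * x a1 j else x i j.
Proof.
move=> h0 h1; have embT : (embed2 a A B C E)^T = embed2 a A C B E.
  apply/matrixP => k l; rewrite !mxE.
  rewrite -!val_eqE /=.
  do ![case: eqP => ?]; try (by []); try lia.
have -> : (embed2 a A B C E *m x) i j = (x^T *m embed2 a A C B E) j i.
  by rewrite -embT -trmx_mul [RHS]mxE.
by rewrite (embed2_mulr _ _ _ _ _ _ _ h0 h1) !mxE !(mulrC _ A, mulrC _ B, mulrC _ C, mulrC _ E).
Qed.

Lemma embed2_topblk d a A B C E : (a.+1 < d)%N -> topblk d (embed2 a A B C E).
Proof.
move=> ad i j /orP h; rewrite mxE -!val_eqE /=.
by do ![case: eqP => ? //]; case: h; lia.
Qed.

Lemma embed21 a : embed2 a 1 0 0 1 = 1%:M.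
Proof.
apply/matrixP => i j; rewrite !mxE -!val_eqE /=.
by do ![case: eqP => ? //]; lia.
Qed.

Lemma embed2M a A B C E A' B' C' E' : (a < n)%N ->
  embed2 a A B C E *m embed2 a A' B' C' E' =
  embed2 a (A * A' + B * C') (A * B' + B * E') (C * A' + E * C') (C * B' + E * E').
Proof.
move=> an; have h0 : (inord a : 'I_n.+1) = a :> nat by rewrite inordK // ltnW.
have h1 : (inord a.+1 : 'I_n.+1) = a.+1 :> nat by rewrite inordK.
apply/matrixP => i j; rewrite (embed2_mulr _ _ _ _ _ _ _ h0 h1).
rewrite -!val_eqE /= h0 h1 !mxE h0 h1 -!val_eqE /= h0 h1 !eqxx (gtn_eqF (ltnSn a)).
do ![case: eqP => ? //]; rewrite ?(mul0r, addr0) //; lia.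
Qed.

(* Right multiplication by coltrans z i adds the combination of the columns with
   coefficients z to the column i. *)
Definition coltrans (z : 'cV[F]_n.+1) (i : 'I_n.+1) : M := 1%:M + z *m delta_mx 0 i.

Lemma coltransE z (i k j : 'I_n.+1) : coltrans z i k j = (k == j)%:R + z k 0 * (j == i)%:R.
Proof. by rewrite !mxE big_ord1 !mxE eqxx. Qed.

(** Row [i] of [x] is a unit row, so [delta_mx 0 i] is fixed and only the column [z] is transformed.
    Column operations can thus be pushed through a smaller block. *)
Lemma coltrans_conj z (i : 'I_n.+1) x : x \in unitmx -> topblk i x -> invmx x *m coltrans z i *m x = coltrans (invmx x *m z) i.
Proof.
move=> ux hx; rewrite /coltrans mulmxDr mulmx1 mulmxDl mulVmx // -!mulmxA; congr (_ + _ *m (_ *m _)).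
by apply/rowP => j; rewrite -rowE !mxE (topblk_row _ hx) // eq_sym eqxx.
Qed.

Lemma coltrans_mulv z (i : 'I_n.+1) (w : 'cV[F]_n.+1) : coltrans z i *m w = w + w i 0 *: z.
Proof.
rewrite /coltrans mulmxDl mul1mx -mulmxA -rowE; congr (_ + _).
by apply/colP => k; rewrite !mxE big_ord1 mxE mulrC.
Qed.

Lemma mulmx_coltrans z x (i k j : 'I_n.+1) : j != i -> (x *m coltrans z i) k j = x k j.
Proof. by move=> ji; rewrite /coltrans mulmxDr mulmx1 mulmxA mxE mxE big_ord1 !mxE (negPf ji) mulr0 addr0. Qed.

Lemma mulmx_coltrans_col z x (i k : 'I_n.+1) : (x *m coltrans z i) k i = x k i + (x *m z) k 0.
Proof. by rewrite /coltrans mulmxDr mulmx1 mulmxA !mxE big_ord1 !mxE !eqxx mulr1. Qed.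

Lemma coltransM (z z' : 'cV[F]_n.+1) (i : 'I_n.+1) : z' i 0 = 0 -> coltrans z i *m coltrans z' i = coltrans (z + z') i.
Proof.
move=> z'0; rewrite [coltrans z' i]/coltrans mulmxDr mulmx1 mulmxA coltrans_mulv z'0 scale0r addr0.
by rewrite /coltrans mulmxDl addrA.
Qed.

Lemma coltrans0 (i : 'I_n.+1) : coltrans 0 i = 1%:M.
Proof. by rewrite /coltrans mul0mx addr0. Qed.

Lemma coltrans_unip z (i : 'I_n.+1) : (forall k : 'I_n.+1, (i <= k)%N -> z k 0 = 0) -> unip (coltrans z i).
Proof.
move=> hz; split=> [k|k j jk]; rewrite coltransE.
  rewrite eqxx; case: eqP => [->|_]; last by rewrite mulr0 addr0.
  by rewrite hz // mul0r addr0.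
rewrite ord_gtF // add0r; case: eqP => [e|_]; last by rewrite mulr0.
by rewrite hz ?mul0r // -e ltnW.
Qed.

Lemma coltrans_topblk z d (i : 'I_n.+1) : (forall k : 'I_n.+1, (i <= k)%N -> z k 0 = 0) ->
  i = d :> nat -> topblk d.+1 (coltrans z i).
Proof.
move=> hz <- k j /orP[h|h]; rewrite coltransE.
  by rewrite hz ?mul0r ?addr0 // ltnW.
by rewrite (ord_gtF h) mulr0 addr0.
Qed.

End BottSamelson.

(** * The matrices attached to (m, c), their inverses and their Bruhat factors *)

Section Cell.
Variables (F : fieldType) (O : subringClosed F) (p : F) (n : nat).
Local Notation M := 'M[F]_n.+1.
Implicit Types (x y u v g : M) (z w : 'cV[F]_n.+1) (d a e : nat).

(** Models the condition $(c, p^e) = 1$, which for [e = 0] even allows [c = 0]. *)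
Definition valid e (c : F) := (c \in O) && ((0 < e)%N ==> unitO O c).

Definition cbar e (c : F) : F := if e == 0%N then 0 else c^-1.

Definition stepmx a e (c : F) : M := embed2 n a (cbar e c) (c * cbar e c - 1) (p ^+ e) c.

Fixpoint hessmx d (m : nat -> nat) (c : nat -> F) : M :=
  if d is d'.+1 then hessmx d' m c *m stepmx d' (m d') (c d') else 1%:M.

(** The diagonal of [hessmx] pairs [c (a - 1)] with the inverse of [c a]; the value 1 at [a = 0] is
    the convention for indices with i > j. [cbprev] shifts the inverses in the same way. *)
Definition cprev (c : nat -> F) a : F := if a is a'.+1 then c a' else 1.

Definition cbprev (m : nat -> nat) (c : nat -> F) a : F :=
  if a is a'.+1 then cbar (m a') (c a') else 1.

Definition psum (m : nat -> nat) a b := (\sum_(a <= k < b) m k)%N.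

Lemma psumr m a b : (a <= b)%N -> psum m a b.+1 = (psum m a b + m b)%N.
Proof. by move=> ab; rewrite /psum big_nat_recr. Qed.

Lemma psum_id m a : psum m a a = 0%N.
Proof. by rewrite /psum big_geq. Qed.

Lemma psum_cat m a b d : (a <= b)%N -> (b <= d)%N -> psum m a d = (psum m a b + psum m b d)%N.
Proof. by move=> ab bd; rewrite /psum (big_cat_nat ab bd). Qed.

(* The first column of (hessmx d m c)^-1. *)
Definition inv_col d (m : nat -> nat) (c : nat -> F) : 'cV[F]_n.+1 :=
  \col_j (if (j < d)%N then (-1) ^+ j * c j * p ^+ psum m 0 j
          else if j == d :> nat then (-1) ^+ d * p ^+ psum m 0 d else 0).

Lemma valid_cbar e c : valid e c -> cbar e c \in O.
Proof.
rewrite /valid /cbar; case: eqP => [_ _|/eqP]; first exact: rpred0.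
by rewrite -lt0n => -> /andP[_ /and3P[]].
Qed.

(** This is the determinant of [stepmx]: for [e = 0] the inverse is read as 0 and [p ^+ e] is 1, for
    [e > 0] the product [c * cbar e c] is 1. *)
Lemma valid_det e c : valid e c -> c * cbar e c + (1 - c * cbar e c) * p ^+ e = 1.
Proof.
rewrite /valid /cbar; case: eqP => [->|/eqP].
  by rewrite mulr0 subr0 mulr1 add0r.
rewrite -lt0n => -> /andP[_ /and3P[c0 _ _]].
by rewrite mulfV // subrr mul0r addr0.
Qed.

Lemma stepmxV a e c : (a < n)%N -> valid e c ->
  stepmx a e c *m embed2 n a c (1 - c * cbar e c) (- p ^+ e) (cbar e c) = 1%:M.
Proof.
move=> an /valid_det h; rewrite embed2M // -[RHS](@embed21 F n a).
by congr embed2; rewrite -?[RHS]h; ring.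
Qed.

Lemma stepmx_int a e c : p \in O -> valid e c -> intmx O (stepmx a e c).
Proof.
move=> pO hc i j; have cO : c \in O by case/andP: hc.
have cbO := valid_cbar hc; rewrite mxE.
by do ![case: eqP => _]; rewrite ?rpredX ?rpredB ?rpredM ?rpred1 ?rpred0.
Qed.

Lemma stepmx_GLO a e c : p \in O -> (a < n)%N -> valid e c -> GLO O (stepmx a e c).
Proof.
move=> pO an hc; split; first exact: stepmx_int.
exists (embed2 n a c (1 - c * cbar e c) (- p ^+ e) (cbar e c)); last exact: stepmxV.
move=> i j; have cO : c \in O by case/andP: hc.
have cbO := valid_cbar hc; rewrite mxE.
by do ![case: eqP => _]; rewrite ?rpredN ?rpredX ?rpredB ?rpredM ?rpred1 ?rpred0.
Qed.

Lemma hessmx_topblk d m c : topblk d.+1 (hessmx d m c).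
Proof.
elim: d => [|d IH] /=; first exact: topblk1.
by apply: topblkM; [apply: topblkW IH|apply: embed2_topblk].
Qed.

Lemma hessmx_GLO d m c : p \in O -> (d <= n)%N -> (forall a, (a < d)%N -> valid (m a) (c a)) ->
  GLO O (hessmx d m c).
Proof.
move=> pO; elim: d => [|d IH] dn hc /=; first exact: GLO1.
apply: GLOM; last exact/stepmx_GLO/hc.
by apply: IH => [|a ad]; [apply: ltnW|apply: hc; apply: ltnW].
Qed.

(** A new factor touches only columns [d] and [d + 1], and the earlier product still has a unit
    column at [d + 1]. The entries on and below the diagonal are computed by this recursion. *)
Lemma hessmxSr d m c (i j j0 j1 : 'I_n.+1) : j0 = d :> nat -> j1 = d.+1 :> nat ->
  hessmx d.+1 m c i j =
    if j == j0 then hessmx d m c i j0 * cbar (m d) (c d) + (i == j1)%:R * p ^+ m d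
    else if j == j1 then hessmx d m c i j0 * (c d * cbar (m d) (c d) - 1) + (i == j1)%:R * c d
    else hessmx d m c i j.
Proof.
move=> h0 h1 /=; rewrite (embed2_mulr _ _ _ _ _ _ _ h0 h1).
by rewrite (@topblk_col _ _ _ _ i j1 (@hessmx_topblk d m c)) ?h1.
Qed.

Lemma hessmx_hess d m c (i j : 'I_n.+1) : (d <= n)%N -> (j < d)%N -> (j.+1 < i)%N ->
  hessmx d m c i j = 0.
Proof.
elim: d => // d IH dn jd ji.
have [j0 h0] : exists j0 : 'I_n.+1, j0 = d :> nat by exists (inord d); rewrite inordK // ltnW.
have [j1 h1] : exists j1 : 'I_n.+1, j1 = d.+1 :> nat by exists (inord d.+1); rewrite inordK.
rewrite (hessmxSr _ _ _ _ h0 h1); case: eqVneq => [jj0|jj0].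
  have di : (d.+1 < i)%N by move: ji; rewrite jj0 h0.
  by rewrite (topblk_row _ (@hessmx_topblk d m c)) ?ord_gtF ?h0 ?h1 ?mul0r ?add0r // ltnW // ltnW.
rewrite ord_ltF ?h1 //; apply: IH => //; first exact: ltnW.
by move: jd; rewrite ltnS leq_eqVlt -h0 => /orP[/eqP/val_inj/eqP|//]; rewrite (negPf jj0).
Qed.

Lemma hessmx_sub d m c (i j : 'I_n.+1) : (d <= n)%N -> (j < d)%N -> i = j.+1 :> nat ->
  hessmx d m c i j = p ^+ m j.
Proof.
elim: d => // d IH dn jd ij.
have [j0 h0] : exists j0 : 'I_n.+1, j0 = d :> nat by exists (inord d); rewrite inordK // ltnW.
have [j1 h1] : exists j1 : 'I_n.+1, j1 = d.+1 :> nat by exists (inord d.+1); rewrite inordK.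
rewrite (hessmxSr _ _ _ _ h0 h1); case: eqVneq => [jj0|jj0].
  have -> : i == j1 by rewrite -val_eqE /= ij jj0 h0 h1.
  rewrite (topblk_row _ (@hessmx_topblk d m c)) ?ij ?jj0 ?h0 // ord_gtF ?ij ?jj0 ?h0 //.
  by rewrite mul0r add0r mul1r.
rewrite ord_ltF ?h1 //; apply: IH => //; first exact: ltnW.
by move: jd; rewrite ltnS leq_eqVlt -h0 => /orP[/eqP/val_inj/eqP|//]; rewrite (negPf jj0).
Qed.

Lemma hessmx_last d m c (j : 'I_n.+1) : (d <= n)%N -> j = d :> nat -> hessmx d m c j j = cprev c d.
Proof.
case: d => [|d] dn jd; first by rewrite mxE eqxx.
have [j0 h0] : exists j0 : 'I_n.+1, j0 = d :> nat by exists (inord d); rewrite inordK // ltnW.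
rewrite (hessmxSr _ _ _ _ h0 jd) eqxx ord_gtF ?jd ?h0 //.
rewrite (topblk_row _ (@hessmx_topblk d m c)) ?jd //.
by rewrite ord_gtF ?jd ?h0 // mul0r add0r mul1r.
Qed.

Lemma hessmx_diag d m c (j : 'I_n.+1) : (d <= n)%N -> (j < d)%N ->
  hessmx d m c j j = cprev c j * cbar (m j) (c j).
Proof.
elim: d => // d IH dn jd.
have [j0 h0] : exists j0 : 'I_n.+1, j0 = d :> nat by exists (inord d); rewrite inordK // ltnW.
have [j1 h1] : exists j1 : 'I_n.+1, j1 = d.+1 :> nat by exists (inord d.+1); rewrite inordK.
rewrite (hessmxSr _ _ _ _ h0 h1); case: eqVneq => [jj0|jj0].
  rewrite jj0 (hessmx_last _ _ (ltnW dn) h0) ord_ltF ?h1 ?h0 //.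
  by rewrite mul0r addr0.
rewrite ord_ltF ?h1 //; apply: IH => //; first exact: ltnW.
by move: jd; rewrite ltnS leq_eqVlt -h0 => /orP[/eqP/val_inj/eqP|//]; rewrite (negPf jj0).
Qed.

(** The last factor sends the vector for [d + 1] to the one for [d]: the entry at [d + 1] cancels
    and the entry at [d] is reduced by the determinant identity. *)
Lemma hessmx_inv_col d m c : (d <= n)%N -> (forall a, (a < d)%N -> valid (m a) (c a)) ->
  hessmx d m c *m inv_col d m c = delta_mx 0 0.
Proof.
elim: d => [|d IH] dn hc.
  rewrite mul1mx; apply/colP => i; rewrite !mxE psum_id -val_eqE /= eqxx andbT.
  by case: eqP => //= _; rewrite !mulr1.
have [j0 h0] : exists j0 : 'I_n.+1, j0 = d :> nat by exists (inord d); rewrite inordK // ltnW.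
have [j1 h1] : exists j1 : 'I_n.+1, j1 = d.+1 :> nat by exists (inord d.+1); rewrite inordK.
rewrite -IH ?(ltnW dn) //; last by move=> a ad; apply: hc; apply: ltnW.
rewrite /= -mulmxA; congr (_ *m _); apply/colP => i.
have hd := valid_det (hc d (ltnSn d)); move: hd; set b := cbar _ _ => hd.
rewrite (embed2_mull _ _ _ _ _ _ _ h0 h1) !mxE h0 h1 ltnSn eqxx ltnn psumr // exprS exprD.
case: eqVneq => [->|i0].
  rewrite h0 ltnn eqxx; transitivity
    ((-1) ^+ d * p ^+ psum m 0 d * (c d * b + (1 - c d * b) * p ^+ m d)).
    by rewrite -/b; ring.
  by rewrite hd mulr1.
case: eqVneq => [->|i1].
  by rewrite h1 ltnNge leqnSn /= gtn_eqF //; ring.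
have -> : (i < d.+1)%N = (i < d)%N.
  by rewrite ltnS leq_eqVlt -h0 -[(i == j0 :> nat)]/(i == j0) (negPf i0).
case: ltnP => // _; rewrite -h0 -[(i == j0 :> nat)]/(i == j0) (negPf i0).
by rewrite h0 -h1 -[(i == j1 :> nat)]/(i == j1) (negPf i1).
Qed.

Lemma hessmx_unit d m c : (d <= n)%N -> (forall a, (a < d)%N -> valid (m a) (c a)) ->
  hessmx d m c \in unitmx.
Proof.
elim: d => [|d IH] dn hc; first exact: unitmx1.
rewrite /= unitmx_mul IH ?(ltnW dn) //=; last by move=> a ad; apply: hc; apply: ltnW.
by have /mulmx1_unit[] := stepmxV dn (hc d (ltnSn d)).
Qed.

(** This row of the inverse, multiplied by the inverse column of the next level up, gives a
    superdiagonal entry of the right Bruhat factor. *)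
Lemma hessmx_inv_last d m c (i j : 'I_n.+1) : (d <= n)%N ->
  (forall a, (a < d)%N -> valid (m a) (c a)) -> i = d :> nat -> (j <= d)%N ->
  invmx (hessmx d m c) i j = (-1) ^+ (d - j) * cbprev m c j * p ^+ psum m j d.
Proof.
elim: d i => [|d IH] i dn hc id jd.
  have -> : j = i by apply/val_inj/eqP; rewrite /= id -leqn0.
  by rewrite invmx1 mxE eqxx id psum_id subn0 !mulr1.
have hc' a : (a < d)%N -> valid (m a) (c a) by move=> ad; apply: hc; apply: ltnW.
have [j0 h0] : exists j0 : 'I_n.+1, j0 = d :> nat by exists (inord d); rewrite inordK // ltnW.
have bu := hessmx_unit (ltnW dn) hc'.
have /mulmx1_unit[ku _] := stepmxV dn (hc d (ltnSn d)).
rewrite /= (GLO_invE (y := invmx (stepmx d (m d) (c d)) *m invmx (hessmx d m c))); last first.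
  by rewrite mulmxA mulmxK // mulmxV.
rewrite (GLO_invE (stepmxV dn (hc d (ltnSn d)))) (embed2_mull _ _ _ _ _ _ _ h0 id) eqxx ord_gtF ?id ?h0 //.
have bB := topblkV bu (@hessmx_topblk d m c).
rewrite (@topblk_row _ _ _ _ i j bB) ?id //; move: jd; rewrite leq_eqVlt => /orP[/eqP jd|].
  have -> : j = i by apply: val_inj; rewrite /= id.
  rewrite eqxx (@topblk_col _ _ _ _ j0 i bB) ?id // ord_ltF ?id ?h0 // subnn psum_id.
  by rewrite mulr0 add0r !mulr1 mul1r /cbprev.
rewrite ltnS => jd; rewrite (IH j0 (ltnW dn) hc' h0 jd).
by rewrite ord_gtF ?id // mulr0 addr0 psumr // exprD subSn // exprS; ring.
Qed.

(* Level d corresponds to the row i = n + 1 - d of the paper, and m d a, c d a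
   to its m_(i,i+a), c_(i,i+a). *)
Fixpoint cellmx d (m : nat -> nat -> nat) (c : nat -> nat -> F) : M :=
  if d is d'.+1 then hessmx d (m d) (c d) *m cellmx d' m c else 1%:M.

Definition cell_valid d (m : nat -> nat -> nat) (c : nat -> nat -> F) :=
  forall e a, (a < e)%N -> (e <= d)%N -> valid (m e a) (c e a).

Lemma validxW d m c : cell_valid d.+1 m c -> cell_valid d m c.
Proof. by move=> h e a ae ed; apply: h => //; apply: ltnW. Qed.

Lemma cellmx_topblk d m c : topblk d.+1 (cellmx d m c).
Proof.
elim: d => [|d IH]; first exact: topblk1.
by apply: topblkM; [apply: hessmx_topblk|apply: topblkW IH].
Qed.

Lemma cellmx_GLO d m c : p \in O -> (d <= n)%N -> cell_valid d m c -> GLO O (cellmx d m c).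
Proof.
move=> pO; elim: d => [|d IH] dn hc; first exact: GLO1.
apply: GLOM; last by apply: IH; [apply: ltnW|apply: validxW].
by apply: hessmx_GLO => // a ad; apply: hc.
Qed.

Lemma cellmx_unit d m c : (d <= n)%N -> cell_valid d m c -> cellmx d m c \in unitmx.
Proof.
elim: d => [|d IH] dn hc; first exact: unitmx1.
rewrite unitmx_mul IH ?(ltnW dn) // ?andbT; last exact: validxW.
by apply: hessmx_unit => // a ad; apply: hc.
Qed.

(** The factors of lower level fix row [d], so only the Hessenberg factor of level [d] counts. *)
Lemma cellmx_inv_last d m c (i j : 'I_n.+1) : (d <= n)%N -> cell_valid d m c ->
  i = d :> nat -> (j <= d)%N ->
  invmx (cellmx d m c) i j = (-1) ^+ (d - j) * cbprev (m d) (c d) j * p ^+ psum (m d) j d.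
Proof.
move=> dn hc id jd; have hc' a : (a < d)%N -> valid (m d a) (c d a) by move=> ad; apply: hc.
rewrite -(hessmx_inv_last dn hc' id jd); case: d dn hc hc' id jd => [//|d] dn hc hc' id jd.
have xu := cellmx_unit (ltnW dn) (validxW hc); have bu := hessmx_unit dn hc'.
rewrite (GLO_invE (y := invmx (cellmx d m c) *m invmx (hessmx d.+1 (m d.+1) (c d.+1)))); last first.
  by rewrite mulmxA mulmxK // mulmxV.
by apply: topblk_mull; [apply: (topblkV xu); apply: cellmx_topblk|rewrite id].
Qed.

Lemma eq_hessmx d m m' c c' : (forall a, (a < d)%N -> m a = m' a) ->
  (forall a, (a < d)%N -> c a = c' a) -> hessmx d m c = hessmx d m' c'.
Proof.
elim: d => //= d IH mm' cc'; rewrite IH; first by rewrite mm' ?cc'.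
  by move=> a ad; apply: mm'; apply: ltnW.
by move=> a ad; apply: cc'; apply: ltnW.
Qed.

Lemma eq_cellmx d m m' c c' :
  (forall e a, (a < e)%N -> (e <= d)%N -> m e a = m' e a) ->
  (forall e a, (a < e)%N -> (e <= d)%N -> c e a = c' e a) -> cellmx d m c = cellmx d m' c'.
Proof.
elim: d => // d IH mm' cc'; rewrite /cellmx -/cellmx; congr (_ *m _).
  by apply: eq_hessmx => a ad; [apply: mm'|apply: cc'].
by apply: IH => e a ae ed; [apply: mm'|apply: cc'] => //; apply: ltnW.
Qed.

(* The diagonal part of cellmx d m c, up to the signs of the antidiagonal. *)
Fixpoint torus (m : nat -> nat -> nat) d i : F :=
  if d is d'.+1
  then if i is i'.+1 then p ^+ m d i' * torus m d' i' else (p ^+ psum (m d) 0 d)^-1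
  else 1.

(* left_super m c d a is the entry (a, a+1) of the left unipotent factor of
   cellmx d m c; right_super m c d is the entry (d, d+1) of the right one, which
   is the same for all levels above d. *)
Fixpoint left_super (m : nat -> nat -> nat) (c : nat -> nat -> F) d a : F :=
  if d is d'.+1
  then (cprev (c d) a * cbar (m d a) (c d a)
        + (if a is a'.+1 then p ^+ m d a' * left_super m c d' a' else 0)) / p ^+ m d a
  else 0.

Definition right_super (m : nat -> nat -> nat) (c : nat -> nat -> F) d : F :=
  (\sum_(b < d.+1) c d.+1 b * p ^+ psum (m d.+1) 0 b
     * (cbprev (m d) (c d) b * p ^+ psum (m d) b d)) / p ^+ psum (m d.+1) 0 d.+1.

Lemma torus_neq0 m d i : p != 0 -> torus m d i != 0.
Proof.
move=> p0; elim: d i => [|d IH] [|i] /=; rewrite ?oner_neq0 //.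
  by rewrite invr_eq0 expf_neq0.
by rewrite mulf_neq0 // expf_neq0.
Qed.

Lemma eq_torus m m' d i : (i <= d)%N ->
  (forall e a, (a < e)%N -> (e <= d)%N -> m e a = m' e a) -> torus m d i = torus m' d i.
Proof.
elim: d i => [//|d IH] [|i] id mm' /=.
  by congr (_ ^+ _)^-1; apply: eq_big_nat => a /andP[_ ad]; apply: mm'.
by rewrite mm' // IH // => e a ae ed; apply: mm' => //; apply: leqW.
Qed.

(** Write the matrix as [b *m k]. The operation [coltrans z i1] turns the last column of [b] into a
    multiple of the first basis vector; together with the left factor of [k] this becomes unipotent
    after a cyclic shift of the columns, and [N *m invmx N'] is that shift up to scaling. The
    opposite operation is conjugated by [k] and joins the right factor. *)
Lemma cellmx_bruhat d m c : p != 0 -> (d <= n)%N -> cell_valid d m c ->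
  exists u u', [/\ unip u, topblk d.+1 u, unip u', topblk d.+1 u' & cellmx d m c = u *m Nmat n d (torus m d) *m u']
    /\ (forall i j : 'I_n.+1, (i < d)%N -> j = i.+1 :> nat -> u i j = left_super m c d i)
    /\ (forall i j : 'I_n.+1, (i < d)%N -> j = i.+1 :> nat -> u' i j = right_super m c i).
Proof.
move=> p0; elim: d => [|d IH] dn hc.
  exists 1%:M, 1%:M; split; last by split.
  split; try exact: unip1; try exact: topblk1.
  rewrite mul1mx mulmx1; apply/matrixP => i j; rewrite !mxE !leqn0.
  have ord0E (k : 'I_n.+1) : (k == 0 :> nat) = (k == 0) by rewrite -val_eqE.
  have [/eqP i0|_] //= := eqVneq (i : nat) 0%N; have [/eqP j0|_] //= := eqVneq (j : nat) 0%N.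
  move: i0 j0; rewrite !ord0E => /eqP-> /eqP->.
  by rewrite !addn0 !eqxx mulr1.
have hc' := validxW hc; have dn' := ltnW dn.
have hcd a : (a < d.+1)%N -> valid (m d.+1 a) (c d.+1 a) by move=> ad; apply: hc.
have [uk [uk' [[ukU ukB uk'U uk'B kE] [ukS uk'S]]]] := IH dn' hc'.
set k := cellmx d m c in kE; set b := hessmx d.+1 (m d.+1) (c d.+1).
have kB : topblk d.+1 k by apply: cellmx_topblk.
have ku : k \in unitmx by apply: cellmx_unit.
have bB : topblk d.+2 b by apply: hessmx_topblk.
have bu : b \in unitmx by apply: hessmx_unit.
have [i0 h0] : exists i0 : 'I_n.+1, i0 = d :> nat by exists (inord d); rewrite inordK // ltnW.
have [i1 h1] : exists i1 : 'I_n.+1, i1 = d.+1 :> nat by exists (inord d.+1); rewrite inordK.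
have [w wD] : {w | w = inv_col d.+1 (m d.+1) (c d.+1)} by eexists.
have bw : b *m w = delta_mx 0 0 by rewrite wD; apply: hessmx_inv_col.
have w1E : w i1 0 = (-1) ^+ d.+1 * p ^+ psum (m d.+1) 0 d.+1.
  by rewrite wD mxE h1 ltnn eqxx.
have w10 : w i1 0 != 0 by rewrite w1E mulf_neq0 ?signr_eq0 ?expf_neq0.
(* [z] is the first column of the inverse of [b], scaled to have entry 1 at [i1] and then stripped
   of that entry. *)
pose z : 'cV[F]_n.+1 := \col_j (if (j < i1)%N then w j 0 / w i1 0 else 0).
have zE : w = w i1 0 *: (z + delta_mx i1 0).
  apply/colP => j; rewrite !mxE h1 andbT; case: (ltngtP j d.+1) => jd.
  - by rewrite ord_ltF ?h1 // addr0 mulrC mulfVK.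
  - by rewrite ord_gtF ?h1 // addr0 mulr0 wD mxE ltnNge ltnW //= gtn_eqF.
  - have -> : j = i1 by apply: val_inj; rewrite /= jd h1.
    by rewrite eqxx add0r mulr1.
have z1 (l : 'I_n.+1) : (i1 <= l)%N -> z l 0 = 0 by move=> h; rewrite mxE ltnNge h.
have Nz1 (l : 'I_n.+1) : (i1 <= l)%N -> (- z) l 0 = 0.
  by move=> h; rewrite mxE z1 // oppr0.
have YYi : coltrans z i1 *m coltrans (- z) i1 = 1%:M.
  by rewrite coltransM ?Nz1 // subrr coltrans0.
pose N := Nmat n d (torus m d); pose N' := Nmat n d.+1 (torus m d.+1).
have Nu : N \in unitmx by apply: Nmat_unit => // i _; apply: torus_neq0.
have N'u : N' \in unitmx by apply: Nmat_unit => // i _; apply: torus_neq0.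
have NB : topblk d.+1 N by apply: Nmat_topblk.
have N'B : topblk d.+2 N' by apply: Nmat_topblk.
(* Solved from the desired decomposition; what has to be shown is that [u] is unipotent. *)
have [u uD] : {u | u = b *m coltrans z i1 *m uk *m N *m invmx N'} by eexists.
pose y := invmx k *m coltrans (- z) i1 *m k.
have W (A : M) : topblk d.+1 A -> topblk d.+2 A by apply: topblkW.
have uB : topblk d.+2 u.
  rewrite uD.
  apply: topblkM; last exact: topblkV.
  apply: topblkM; last exact: W.
  apply: topblkM; last exact: W.
  by apply: topblkM => //; apply: coltrans_topblk.
have yE : y = coltrans (invmx k *m - z) i1 by rewrite /y coltrans_conj // h1.
have kz (l : 'I_n.+1) : (i1 <= l)%N -> (invmx k *m - z) l 0 = 0.
  by move=> h; rewrite (topblk_mull _ _ (topblkV ku kB)) ?Nz1 // -h1.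
have yU : unip y by rewrite yE; apply: coltrans_unip.
have yB : topblk d.+2 y by rewrite yE; apply: coltrans_topblk.
have uN : u *m N' = b *m coltrans z i1 *m uk *m N by rewrite uD mulmxKV.
(* The left side is column [i1] of [b *m coltrans z i1]. *)
have bz : b *m z + col i1 b = (w i1 0)^-1 *: delta_mx 0 0.
  apply: (scalerI w10); rewrite colE -mulmxDr scalemxAr -zE bw scalerA mulfV //.
  by rewrite scale1r.
have ucol0 (i : 'I_n.+1) : u i 0 = (i == 0)%:R.
  have := congr1 (fun A : M => A i i1) uN.
  rewrite /= (@Nmat_mulr _ _ _ _ _ _ _ 0) ?h1 ?subnn //=.
  rewrite (topblk_mulr _ _ NB) ?h1 // (topblk_mulr _ _ ukB) ?h1 // mulmx_coltrans_col.
  have := congr1 (fun A : 'cV_n.+1 => A i 0) bz; rewrite !mxE andbT addrC => ->.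
  by rewrite w1E invfM invr_sign; apply: mulfI; rewrite mulf_neq0 ?signr_eq0 ?invr_eq0 ?expf_neq0.
(* The divisor is the ratio of the torus entries at [l + 1] on level [d + 1] and at [l] on level
   [d]; the signs agree because both products are read in column [q]. *)
have ucolS (i j l : 'I_n.+1) : (l <= d)%N -> j = l.+1 :> nat ->
    u i j = (b *m uk) i l / p ^+ m d.+1 l.
  move=> ld jl; have [q qE] := ord_sub l dn'.
  have qd : (q <= d)%N by rewrite qE leq_subr.
  have := congr1 (fun A : M => A i q) uN.
  have lE : l = (d - q)%N :> nat by rewrite qE subKn.
  have jE : j = (d.+1 - q)%N :> nat by rewrite jl lE subSn.
  rewrite /= (Nmat_mulr _ _ _ (leqW qd) jE) (Nmat_mulr _ _ _ qd lE).
  have s0 : (-1 : F) ^+ q != 0 by rewrite signr_eq0.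
  have t0 := @torus_neq0 m d l p0.
  have li1 : l != i1 by rewrite -val_eqE /= h1 ltn_eqF.
  have -> : b *m coltrans z i1 *m uk = b *m uk *m coltrans (invmx uk *m z) i1.
    by rewrite -coltrans_conj ?h1 ?unip_unit // !mulmxA mulmxK ?unip_unit.
  rewrite mulmx_coltrans // -!mulrA jl /= => /(mulfI s0).
  rewrite -mulrA mulrCA => /(mulfI t0) <-.
  by rewrite mulrC mulKf // expf_neq0.
have bu0 (i l : 'I_n.+1) : (l <= d)%N -> (l.+1 < i)%N -> (b *m uk) i l = 0.
  move=> ld li; rewrite mxE big1 // => q _; case: (leqP q l) => [ql|lq].
    by rewrite hessmx_hess ?mul0r ?ltnS ?(leq_trans ql) // (leq_ltn_trans _ li) // ltnS.
  by rewrite (proj2 ukU) ?mulr0.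
have buS (i l : 'I_n.+1) : (l <= d)%N -> i = l.+1 :> nat -> (b *m uk) i l = p ^+ m d.+1 l.
  move=> ld il; rewrite mxE (bigD1 l) //= hessmx_sub ?ltnS // (proj1 ukU) mulr1.
  rewrite big1 ?addr0 // => q ql; case: (ltngtP q l) => [ltql|lq|/val_inj e].
  - by rewrite hessmx_hess ?mul0r ?ltnS ?(leq_trans (ltnW ltql)) // il ltnS.
  - by rewrite (proj2 ukU) ?mulr0.
  - by rewrite e eqxx in ql.
have uU : unip u.
  have usub (i j : 'I_n.+1) : (j <= i)%N -> u i j = (i == j)%:R.
    move=> ji; have [di|id] := ltnP d.+1 i; first by rewrite (topblk_row _ uB).
    have [e|j0] := posnP j; first by have -> : j = 0 by apply: val_inj.
    have [l lE] : exists l : 'I_n.+1, l = j.-1 :> nat.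
      by exists (inord j.-1); rewrite inordK // prednK // ltnW.
    have jl : j = l.+1 :> nat by rewrite lE prednK.
    have ld : (l <= d)%N by rewrite -ltnS -jl (leq_trans ji).
    rewrite (ucolS _ _ _ ld jl); move: ji; rewrite leq_eqVlt => /orP[/eqP/val_inj ij|ji].
      by rewrite -ij eqxx buS // divff // expf_neq0.
    by rewrite bu0 // -?jl // mul0r ord_gtF.
  by split=> [i|i j ji]; rewrite usub ?eqxx ?ord_gtF // ltnW.
exists u, (uk' *m y); split; last split.
- split=> //.
  + exact: unipM.
  + by apply: topblkM => //; apply: W.
  + rewrite -/N' uN.
    transitivity (b *m (coltrans z i1 *m (uk *m N *m uk' *m y))); last by rewrite !mulmxA.
    by rewrite -kE /y -(mulmxA (invmx k)) mulKVmx // (mulmxA (coltrans z i1)) YYi mul1mx.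
- move=> i j id ij; rewrite (ucolS _ _ _ id ij) /=; congr (_ / _).
  (* Two terms of the product survive: the diagonal entry of [b], and its subdiagonal entry times
     the previous superdiagonal entry of [uk]. They are the two terms of [left_super]. *)
  rewrite mxE (bigD1 i) //= hessmx_diag // (proj1 ukU) mulr1; congr (_ + _).
  case iE : (i : nat) => [|i'].
    rewrite big1 // => q qi; rewrite (proj2 ukU) ?mulr0 // iE lt0n -iE; exact: qi.
  have [q qE] : exists q : 'I_n.+1, q = i' :> nat.
    by exists (inord i'); rewrite inordK // -iE ltnW.
  rewrite (bigD1 q) /=; last by rewrite -val_eqE /= qE iE ltn_eqF.
  rewrite hessmx_sub ?iE ?qE //; last by rewrite ltnW // -iE.
  rewrite (ukS q i) ?qE //; last by rewrite -ltnS -iE.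
  rewrite big1 ?addr0 // => l /andP[li lq]; case: (ltngtP l i) => [lt|lt|/val_inj e].
  + rewrite hessmx_hess ?mul0r //; first exact: leq_trans lt (ltnW id).
    by move: lt; rewrite iE !ltnS leq_eqVlt -qE => /orP[/eqP/val_inj e|//]; rewrite e eqxx in lq.
  + by rewrite (proj2 ukU) ?mulr0.
  + by rewrite e eqxx in li.
- move=> i j id ij; rewrite unipM_super // yE coltransE ord_ltF ?ij // add0r.
  (* For [i = d] the entry comes from [y] and is minus row [d] of [invmx k] times [z]; the signs of
     the inverse row, of the inverse column and of its last entry cancel that minus. For [i < d] it
     comes from [uk']. *)
  move: id; rewrite ltnS leq_eqVlt => /orP[/eqP id|id].
    rewrite (topblk_col _ uk'B) ?ij ?id // ord_ltF ?ij // add0r.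
    have -> : j = i1 by apply: val_inj; rewrite /= ij h1 id.
    rewrite eqxx mulr1 mxE /right_super mulr_suml.
    rewrite (big_ord_widen n.+1 (fun q : nat => c d.+1 q * p ^+ psum (m d.+1) 0 q *
      (cbprev (m d) (c d) q * p ^+ psum (m d) q d) / p ^+ psum (m d.+1) 0 d.+1)) //.
    rewrite [RHS]big_mkcond; apply: eq_bigr => l _; rewrite !mxE h1 /=.
    case: ltnP => ld; last by rewrite oppr0 mulr0.
    rewrite (cellmx_inv_last dn' hc' id ld) w1E invr_signM wD mxE ld.
    have e : (-1 : F) ^+ d = (-1) ^+ (d - l) * (-1) ^+ l by rewrite -exprD subnK.
    have sq : ((-1 : F) ^+ (d - l) * (-1) ^+ l) * ((-1) ^+ (d - l) * (-1) ^+ l) = 1.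
      by rewrite -e -exprD -signr_odd addnn odd_double.
    rewrite exprS e; transitivity (((-1) ^+ (d - l) * (-1) ^+ l) * ((-1) ^+ (d - l) * (-1) ^+ l) *
      (c d.+1 l * p ^+ psum (m d.+1) 0 l * (cbprev (m d) (c d) l * p ^+ psum (m d) l d) /
        p ^+ psum (m d.+1) 0 d.+1)); first by ring.
    by rewrite sq mul1r.
  rewrite uk'S // -[j == i1]val_eqE /= h1 ij eqSS ltn_eqF // mulr0 addr0 //.
Qed.
(* The sum of the m_ij over i <= k <= j, in the numbering of level d. *)
Fixpoint diagsum (m : nat -> nat -> nat) d k : nat :=
  if d is d'.+1 then (if k is k'.+1 then (psum (m d) k' d + diagsum m d' k')%N else 0%N) else 0%N.

(** Turns a condition on the torus into linear conditions on [m]. *)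
Lemma torus_diagsum m d i : p != 0 -> (i <= d)%N ->
  torus m d i = p ^ ((diagsum m d i)%:Z - (diagsum m d i.+1)%:Z).
Proof.
move=> p0; elim: d i => [|d IH] [|i] //= id; rewrite ?subrr ?expr0z //.
  have -> : diagsum m d 0 = 0%N by case: (d).
  by rewrite addn0 sub0r -invr_expz -exprnP.
rewrite IH // exprnP -expfzDr //; congr (_ ^ _).
by rewrite (@psum_cat _ i i.+1) // /psum big_nat1; lia.
Qed.

End Cell.

(** * Hessenberg matrices *)

Section Hessenberg.
Variables (F : fieldType) (n : nat).
Local Notation M := 'M[F]_n.+1.
Implicit Types (x y u v g : M) (z w : 'cV[F]_n.+1) (d a e : nat).

Definition hess d x := forall i j : 'I_n.+1, (j < d)%N -> (j.+1 < i)%N -> x i j = 0.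

Lemma upper_hess d b x : upper b -> hess d x -> hess d (b *m x).
Proof.
move=> bU xH i j jd ji; rewrite mxE big1 // => l _; case: (ltnP l i) => [/bU->|il].
  by rewrite mul0r.
by rewrite xH ?mulr0 // (leq_trans ji).
Qed.

Lemma upper_hess_sub d b x (i j : 'I_n.+1) : upper b -> hess d x -> (j < d)%N -> i = j.+1 :> nat ->
  (b *m x) i j = b i i * x i j.
Proof.
move=> bU xH jd ij; rewrite mxE (bigD1 i) //= big1 ?addr0 // => l li.
case: (ltngtP l i) => [/bU->|il|/val_inj e]; first by rewrite mul0r.
  by rewrite xH ?mulr0 // -ij.
by rewrite e eqxx in li.
Qed.

Lemma hess_upper d b x : upper b -> hess d x -> hess d (x *m b).
Proof.
move=> bU xH i j jd ji; rewrite mxE big1 // => l _; case: (ltnP j l) => [/bU->|lj].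
  by rewrite mulr0.
by rewrite xH ?mul0r // ?(leq_ltn_trans lj) // (leq_ltn_trans _ ji).
Qed.

Lemma hess_upper_sub d b x (i j : 'I_n.+1) : upper b -> hess d x -> (j < d)%N -> i = j.+1 :> nat ->
  (x *m b) i j = x i j * b j j.
Proof.
move=> bU xH jd ij; rewrite mxE (bigD1 j) //= big1 ?addr0 // => l lj.
case: (ltngtP l j) => [ltlj|/bU->|/val_inj e]; last by rewrite e eqxx in lj.
  by rewrite xH ?mul0r // ?(ltn_trans ltlj) // ij ltnS.
by rewrite mulr0.
Qed.

(** Descending induction on the row [i] of [g]: in the entry (i+1, j) of [y *m g] the rows of [g]
    above [i] meet zeros of [y], those below [i] vanish by induction or by hypothesis, and row [i]
    is multiplied by a nonzero subdiagonal entry. *)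
Lemma hess_quot d x y g : (d <= n)%N -> hess d x -> hess d y -> x = y *m g ->
  (forall i j : 'I_n.+1, (j < d)%N -> i = j.+1 :> nat -> y i j != 0) ->
  (forall l j : 'I_n.+1, (d <= l)%N -> (j < d)%N -> g l j = 0) ->
  (forall i j : 'I_n.+1, (i < d)%N -> (j < i)%N -> g i j = 0) /\
  (forall i j : 'I_n.+1, (j < d)%N -> i = j.+1 :> nat -> x i j = y i j * g j j).
Proof.
move=> dn xH yH xE y0 g0.
have gU k (i j : 'I_n.+1) : (d - i <= k)%N -> (i < d)%N -> (j < i)%N -> g i j = 0.
  elim: k i j => [|k IH] i j; first by rewrite leqn0 subn_eq0 leqNgt => /negPf->.
  move=> ik id ji; have [q qE] : exists q : 'I_n.+1, q = i.+1 :> nat.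
    by exists (inord i.+1); rewrite inordK // ltnS (leq_trans id).
  have := xH q j (ltn_trans ji id); rewrite qE ltnS => /(_ ji).
  rewrite xE mxE (bigD1 i) //= big1 ?addr0 => [/eqP|l li].
    by rewrite mulf_eq0 (negPf (y0 _ _ id qE)) => /eqP.
  case: (ltngtP l i) => [lti|il|/val_inj e]; last by rewrite e eqxx in li.
    by rewrite yH ?mul0r // ?(ltn_trans lti) // qE ltnS.
  case: (ltnP l d) => ld; last by rewrite g0 ?mulr0 // (ltn_trans ji).
  by rewrite IH ?mulr0 ?(ltn_trans ji) //; lia.
split=> [i j id ji|i j jd ij]; first by apply: (gU d) => //; apply: leq_subr.
rewrite xE mxE (bigD1 j) //= big1 ?addr0 // => l lj.
case: (ltngtP l j) => [ltj|jl|/val_inj e]; last by rewrite e eqxx in lj.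
  by rewrite yH ?mul0r // ?(ltn_trans ltj) // ij ltnS.
case: (ltnP l d) => ld; last by rewrite g0 ?mulr0.
by rewrite (gU d) ?mulr0 ?leq_subr.
Qed.

(** Ascending induction on the columns of [v]: column [j] of the identity between [v *m y] and [x]
    determines column [j + 1] of [v] on and below the diagonal, and the given column 0 starts the
    recursion. *)
Lemma hess_quot_unip d x y v : (d <= n)%N -> hess d y -> hess d x ->
  (forall i j : 'I_n.+1, (j < d)%N -> (v *m y) i j = x i j) ->
  (forall i j : 'I_n.+1, (j < d)%N -> i = j.+1 :> nat -> y i j != 0 /\ x i j = y i j) ->
  topblk d.+1 v -> (forall i, v i 0 = (i == 0)%:R) -> unip v.
Proof.
move=> dn yH xH vE y0 vB v0.
have H k (l i : 'I_n.+1) : (l <= k)%N -> (l <= i)%N -> v i l = (i == l)%:R.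
  elim: k l i => [|k IH] l i.
    by rewrite leqn0 => /eqP e _; have -> : l = 0 by apply: val_inj.
  rewrite leq_eqVlt => /orP[/eqP lk|lk] li; last exact: IH.
  have [ld|dl] := leqP l d; last by rewrite (topblk_col _ vB).
  have [j jk] : exists j : 'I_n.+1, j = k :> nat by exists (inord k); rewrite inordK // -lk ltnW.
  have lj : l = j.+1 :> nat by rewrite jk.
  have jd : (j < d)%N by rewrite -lj.
  have [y0lj xylj] := y0 l j jd lj.
  have := vE i j jd; rewrite mxE (bigD1 l) //= big1 ?addr0 => [|q ql].
    move: li; rewrite leq_eqVlt => /orP[/eqP/val_inj <-|li].
      by rewrite eqxx xylj -{2}[y l j]mul1r => /(mulIf y0lj).
    rewrite xH // -?lj // ord_gtF // => /eqP; rewrite mulf_eq0 (negPf y0lj) orbF.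
    by move/eqP.
  case: (ltngtP q l) => [lt|lq|/val_inj e]; last by rewrite e eqxx in ql.
    have iq : (q < i)%N by apply: leq_trans li.
    by rewrite IH ?ord_gtF ?mul0r // ?(ltnW iq) // -ltnS -lk.
  by rewrite yH ?mulr0 // -lj.
split=> [i|i j ji]; first by rewrite (H i) // eqxx.
by rewrite (H j) ?ord_gtF // ltnW.
Qed.

End Hessenberg.

(** * Change of representatives; Hessenberg matrices as products of elementary factors *)

Section Parametrization.
Variables (F : fieldType) (O : subringClosed F) (p : F) (n : nat).
Hypothesis D : dvr O p.
Local Notation M := 'M[F]_n.+1.
Local Notation GLO := (@GLO F O n).
Local Notation valid := (valid O).
Local Notation cell_valid := (cell_valid O).
Local Notation hessmx := (hessmx p n).
Local Notation cellmx := (cellmx p n).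
Implicit Types (x y u v g : M) (z w : 'cV[F]_n.+1) (d a e : nat).

Let p0 : p != 0 := dvr_p0 D.
Let pO : p \in O := dvr_p D.

Definition congr_pow k (c c' : F) := exists2 t, t \in O & c - c' = p ^+ k * t.

(** For positive [e] the quotient [c' / c] is 1 minus a multiple of [p], so [c'] is a unit by
    locality. *)
Lemma valid_congr_pow e k c c' : (e <= k)%N -> valid e c -> c' \in O -> congr_pow k c c' -> valid e c'.
Proof.
move=> ek /andP[cO cu] c'O [t tO tE]; rewrite /valid c'O /=; apply/implyP => e0.
have /and3P[c0 _ cVO] := implyP cu e0.
have k0 : (0 < k)%N by apply: leq_trans ek.
apply: (@unitO_local _ _ _ D c' c^-1 (p ^+ k.-1 * t * c^-1)) => //.
  by rewrite !rpredM ?rpredX.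
rewrite !mulrA -exprS prednK // -tE mulrBl mulfV //; ring.
Qed.

(** The inverse first columns [w] and [w'] have the same last entry, [p ^+ psum m 0 d] up to sign;
    the congruences are exactly what makes [w' - w] an integral multiple of it. The resulting column
    operation carries [w] to [w'], so the left quotient [v] fixes the first basis vector and is
    unipotent. *)
Lemma hessmx_congr_pow d m c c' : (d <= n)%N ->
  (forall a, (a < d)%N -> valid (m a) (c a)) -> (forall a, (a < d)%N -> valid (m a) (c' a)) ->
  (forall a, (a < d)%N -> congr_pow (psum m a d) (c a) (c' a)) ->
  exists v z (i : 'I_n.+1), [/\ unip v, GLO v & topblk d.+1 v] /\
    [/\ i = d :> nat, intmx O z, (forall k : 'I_n.+1, (i <= k)%N -> z k 0 = 0)
      & hessmx d m c = v *m hessmx d m c' *m coltrans z i].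
Proof.
move=> dn hc hc' cc'.
have [i iE] : exists i : 'I_n.+1, i = d :> nat by exists (inord d); rewrite inordK.
have [w wD] : {w | w = inv_col p n d m c} by eexists.
have [w' w'D] : {w | w = inv_col p n d m c'} by eexists.
have bw : hessmx d m c *m w = delta_mx 0 0 by rewrite wD (@hessmx_inv_col _ O).
have bw' : hessmx d m c' *m w' = delta_mx 0 0 by rewrite w'D (@hessmx_inv_col _ O).
have wi : w i 0 = (-1) ^+ d * p ^+ psum m 0 d by rewrite wD mxE iE ltnn eqxx.
have w'i : w' i 0 = w i 0 by rewrite w'D wD !mxE iE ltnn eqxx.
have wi0 : w i 0 != 0 by rewrite wi mulf_neq0 ?signr_eq0 ?expf_neq0.
pose z : 'cV[F]_n.+1 := (w i 0)^-1 *: (w' - w).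
have zE : w i 0 *: z = w' - w by rewrite scalerA mulfV // scale1r.
have z0 (k : 'I_n.+1) : (i <= k)%N -> z k 0 = 0.
  rewrite leq_eqVlt => /orP[/eqP/val_inj <-|ik]; first by rewrite !mxE w'i subrr mulr0.
  rewrite !mxE wD w'D !mxE; move: ik; rewrite iE => dk.
  by rewrite [(k < d)%N]ltnNge (ltnW dk) /= (gtn_eqF dk) subrr mulr0.
have zO : intmx O z.
  move=> k j; rewrite ord1; have [/z0->|] := leqP i k; first exact: rpred0.
  rewrite iE => kd; have [t tO tE] := cc' k kd.
  rewrite /z 2!mxE wi wD w'D !mxE kd.
  have -> : (-1) ^+ k * c' k * p ^+ psum m 0 k + - ((-1) ^+ k * c k * p ^+ psum m 0 k)
          = p ^+ psum m 0 d * (- (-1) ^+ k * t).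
    transitivity (- ((-1) ^+ k * p ^+ psum m 0 k * (c k - c' k))); first by ring.
    by rewrite tE (psum_cat m (leq0n k) (ltnW kd)) exprD; ring.
  rewrite invr_signM -mulrA mulKf ?expf_neq0 //.
  by rewrite !rpredM ?rpredX ?rpredN ?rpred1 // rpredX ?rpredN ?rpred1.
have bu := hessmx_unit p dn hc; have bu' := hessmx_unit p dn hc'.
have yw : coltrans z i *m w = w' by rewrite coltrans_mulv zE addrC subrK.
have yy : coltrans z i *m coltrans (- z) i = 1%:M.
  by rewrite coltransM ?subrr ?coltrans0 // mxE z0 ?oppr0.
have y'y := mulmx1C yy.
have yO : GLO (coltrans z i).
  split.
    by move=> k j; rewrite coltransE rpredD ?rpredM ?rpred_nat.
  exists (coltrans (- z) i) => // k j.
  by rewrite coltransE rpredD ?rpredM ?rpred_nat // mxE rpredN.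
have yB : topblk d.+1 (coltrans z i) by apply: coltrans_topblk.
have [v vE] : {v | v = hessmx d m c *m coltrans (- z) i *m invmx (hessmx d m c')} by eexists.
have vb : v *m hessmx d m c' = hessmx d m c *m coltrans (- z) i by rewrite vE mulmxKV.
exists v, z, i; split; last first.
  by split=> //; rewrite vb -mulmxA y'y mulmx1.
have vG : GLO v.
  rewrite vE; apply: GLOM; last by apply: GLOV; apply: hessmx_GLO.
  apply: GLOM; first exact: hessmx_GLO.
  by rewrite -(GLO_invE yy); apply: GLOV.
have vB : topblk d.+1 v.
  rewrite vE; apply: topblkM; last by apply: topblkV => //; apply: hessmx_topblk.
  apply: topblkM; first exact: hessmx_topblk.
  by rewrite -(GLO_invE yy); apply: topblkV => //; apply: GLO_unit yO.
split=> //; apply: (@hess_quot_unip _ n d (hessmx d m c) (hessmx d m c')) => //.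
- by move=> k j; apply: hessmx_hess.
- by move=> k j; apply: hessmx_hess.
- by move=> k j jd; rewrite vb mulmx_coltrans // -val_eqE /= iE ltn_eqF.
- by move=> k j jd kj; rewrite !hessmx_sub // expf_neq0.
- move=> k; have := congr1 (fun A : 'cV_n.+1 => A k 0) bw.
  have -> : w = coltrans (- z) i *m w' by rewrite -yw mulmxA y'y mul1mx.
  by rewrite mulmxA -vb -mulmxA bw' -colE !mxE eqxx andbT.
Qed.

Lemma GLO_upper x : upper x -> intmx O x -> (forall i, unitO O (x i i)) -> GLO x.
Proof.
move=> xU xO xd; apply: GLO_det => //; rewrite -det_tr det_trig; last first.
  by apply/is_trig_mxP => i j ij; rewrite mxE xU.
apply: (big_ind (unitO O)); [exact: unitO1|by move=> *; apply: unitOM|by move=> i _; rewrite mxE].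
Qed.

(** The factors are split off beginning with the last. The last row of the block ends in
    [e * p ^+ m d], [e * c] after zeros, which dictates [c]; the inverse of [stepmx] reduces this
    row to [e] on the diagonal. *)
Lemma hessmx_surj d (m : nat -> nat) x : (d <= n)%N -> GLO x -> topblk d.+1 x -> hess d x ->
  (forall i j : 'I_n.+1, (j < d)%N -> i = j.+1 :> nat ->
     exists2 u, unitO O u & x i j = u * p ^+ m j) ->
  exists c b, [/\ forall a, (a < d)%N -> valid (m a) (c a), GLO b, upper b, topblk d.+1 b
    & x = b *m hessmx d m c].
Proof.
elim: d x => [|d IH] x dn xG xB xH xS.
  exists (fun=> 0), x; split=> //; last by rewrite mulmx1.
  by move=> i j ji; rewrite (topblk_row _ xB) ?ord_gtF // (leq_trans _ ji).
have [i0 h0] : exists i0 : 'I_n.+1, i0 = d :> nat by exists (inord d); rewrite inordK // ltnW.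
have [i1 h1] : exists i1 : 'I_n.+1, i1 = d.+1 :> nat by exists (inord d.+1); rewrite inordK.
have n10 : i1 != i0 by rewrite -val_eqE /= h0 h1 gtn_eqF.
have i01 : i1 = i0.+1 :> nat by rewrite h0.
have i0d : (i0 < d.+1)%N by rewrite h0.
have [e eu xe] := xS i1 i0 i0d i01.
have /and3P[e0 eO eVO] := eu; rewrite h0 in xe.
pose c := x i1 i1 / e.
have cE : x i1 i1 = e * c by rewrite mulrC divfK.
have [xO _] := xG; have cO : c \in O by rewrite rpredM.
have cv : valid (m d) c.
  rewrite /valid cO; apply/implyP => m0.
  apply: unitOM; last exact: unitOV.
  (* Expand the entry [(i1, i1)] of [x *m y = 1]: besides the diagonal entry only one entry of that
     row of [x] contributes, and it is divisible by [p], so locality applies. *)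
  have [_ [y yO xy]] := xG.
  apply: (@unitO_local _ _ _ D _ (y i1 i1) (e * p ^+ (m d).-1 * y i0 i1)) => //.
    by rewrite !rpredM ?rpredX.
  have xy1 : (x *m y) i1 i1 = 1 by rewrite xy mxE eqxx.
  rewrite -[RHS]xy1 mxE.
  rewrite (bigD1 i1) //= (bigD1 i0) 1?eq_sym //= big1 ?addr0 => [|l /andP[l1 l0]].
    by rewrite xe -{2}(prednK m0) exprS; ring.
  case: (ltngtP l i1) => [lt|gt|/val_inj e']; last by rewrite e' eqxx in l1.
    have ld : (l < d)%N.
      move: lt; rewrite h1 ltnS leq_eqVlt => /orP[/eqP e'|//].
      by case/eqP: l0; apply: val_inj; rewrite /= h0.
    by rewrite xH ?mul0r ?h1 // ltnW.
  by rewrite (topblk_col _ xB) ?ord_ltF ?mul0r // -h1.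
have kV := stepmxV p dn cv; set k := stepmx p n d (m d) c in kV.
set k' := embed2 _ _ _ _ _ _ in kV.
have kG : GLO k by apply: stepmx_GLO.
have k'G : GLO k' by rewrite -(GLO_invE kV); apply: GLOV.
have [X XE] : {X | X = x *m k'} by eexists.
have XG : GLO X by rewrite XE; apply: GLOM.
have XB : topblk d.+2 X by rewrite XE; apply: topblkM => //; apply: embed2_topblk.
have Xx : X *m k = x by rewrite XE -mulmxA (mulmx1C kV) mulmx1.
have Xij (i j : 'I_n.+1) : (j < d)%N -> X i j = x i j.
  by move=> jd; rewrite XE (embed2_mulr _ _ _ _ _ _ _ h0 h1) !ord_ltF ?h0 ?h1 // ltnW.
have X11 : X i1 i1 = e.
  rewrite XE (embed2_mulr _ _ _ _ _ _ _ h0 h1) (negPf n10) eqxx xe cE.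
  transitivity (e * (c * cbar (m d) c + (1 - c * cbar (m d) c) * p ^+ m d)); first by ring.
  by rewrite (valid_det p cv) mulr1.
have X10 : X i1 i0 = 0.
  by rewrite XE (embed2_mulr _ _ _ _ _ _ _ h0 h1) eqxx xe cE; ring.
have X1 (j : 'I_n.+1) : X i1 j = (i1 == j)%:R * e.
  case: (ltngtP j i1) => [lt|gt|/val_inj->]; last by rewrite eqxx mul1r.
    rewrite ord_gtF // mul0r; case: (ltngtP j d) => [jd|dj|jd].
    - by rewrite Xij // xH ?h1 // ltnW.
    - by move: lt dj; rewrite h1 ltnS ltnNge => ->.
    - by have -> : j = i0 by apply: val_inj; rewrite /= h0.
  by rewrite (topblk_col _ XB) ?ord_ltF ?mul0r // -h1.
(* The last column is moved into an upper triangular factor on the left, which leaves a block one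
   size smaller. *)
pose b1 : M := \matrix_(i, j) if j == i1 then X i i1 else (i == j)%:R.
have b1U : upper b1.
  move=> i j ji; rewrite mxE; case: (j =P i1) => [ji1|_]; last by rewrite ord_gtF.
  by rewrite (topblk_row _ XB) ?ord_gtF -?ji1 // -h1 -ji1.
have b1G : GLO b1.
  apply: GLO_upper => // [i j|i]; rewrite mxE.
    by case: ifP => _; rewrite ?rpred_nat //; case: XG.
  by case: (i =P i1) => [->|_]; rewrite ?X11 // eqxx unitO1.
have b1X : X = b1 *m trunc d.+1 X.
  apply/matrixP => i j; rewrite mxE.
  have t1 : trunc d.+1 X i1 j = (i1 == j)%:R.
    by rewrite (@topblk_row _ _ _ _ i1 j (@trunc_topblk _ _ d.+1 X)) ?h1.
  rewrite (bigD1 i1) //= t1 mxE eqxx.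
  have [ii1|ii1] := eqVneq i i1.
    rewrite ii1 X11 (X1 j) big1 ?addr0 1?mulrC // => l l1.
    by rewrite mxE (negPf l1) eq_sym (negPf l1) mul0r.
  rewrite (bigD1 i) //= mxE (negPf ii1) eqxx mul1r big1 ?addr0; last first.
    by move=> l /andP[l1 li]; rewrite mxE (negPf l1) eq_sym (negPf li) mul0r.
  have [<-|ji1] := eqVneq i1 j.
    by rewrite (@topblk_col _ _ _ _ i i1 (@trunc_topblk _ _ d.+1 X)) ?h1 // (negPf ii1) mulr1 addr0.
  rewrite mulr0 add0r mxE; case: ifP => // /negbT; rewrite negb_and -!leqNgt => h.
  apply: XB; case/orP: h; rewrite leq_eqVlt => /orP[/eqP h|->]; rewrite ?orbT //.
    by case/eqP: ii1; apply: val_inj; rewrite /= h1.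
  by case/eqP: ji1; apply: val_inj; rewrite /= h1.
have b1u := GLO_unit b1G.
have tG : GLO (trunc d.+1 X).
  have -> : trunc d.+1 X = invmx b1 *m X by rewrite {2}b1X mulKmx.
  by apply: GLOM => //; apply: GLOV.
have tE (i j : 'I_n.+1) : (i <= d)%N -> (j < d)%N -> trunc d.+1 X i j = x i j.
  by move=> id jd; rewrite mxE !ltnS id (ltnW jd) Xij.
have [||c' [b [hc' bG bU bB bE]]] := IH (trunc d.+1 X) (ltnW dn) tG (@trunc_topblk _ _ _ _).
- move=> i j jd ji; have [id|di] := leqP i d; first by rewrite tE // xH // ltnW.
  by rewrite (topblk_row _ (@trunc_topblk _ _ d.+1 X)) ?ord_gtF // ltnW.
- move=> i j jd ij; rewrite tE ?ij //; apply: xS; rewrite ?ij //; exact: ltnW.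
pose c2 a := if a == d then c else c' a.
have c2E : hessmx d m c' = hessmx d m c2.
  by apply: eq_hessmx => // a ad; rewrite /c2 ltn_eqF.
exists c2, (b1 *m b); split.
- move=> a; rewrite ltnS leq_eqVlt /c2; case: eqP => [->//|_] /=; exact: hc'.
- exact: GLOM.
- exact: upperM.
- apply: topblkM; last exact: topblkW bB.
  move=> i j h; rewrite mxE; case: (j =P i1) => // e'; rewrite e'; apply: XB.
  by move: h; rewrite e' h1 ltnn orbF => ->.
- by rewrite -Xx b1X bE -mulmxA /= -c2E /c2 eqxx !mulmxA.
Qed.

End Parametrization.

(** * Parametrization of the integral points of the big cell *)

Section Bijection.
Variables (F : fieldType) (O : subringClosed F) (p : F) (n : nat).
Hypothesis D : dvr O p.
Local Notation M := 'M[F]_n.+1.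
Local Notation GLO := (@GLO F O n).
Local Notation valid := (valid O).
Local Notation cell_valid := (cell_valid O).
Local Notation hessmx := (hessmx p n).
Local Notation cellmx := (cellmx p n).
Local Notation congr_pow := (congr_pow O p).
Implicit Types (x y u v g : M) (z w : 'cV[F]_n.+1) (d a e : nat).
Implicit Types (m : nat -> nat -> nat) (c : nat -> nat -> F).

Let p0 : p != 0 := dvr_p0 D.
Let pO : p \in O := dvr_p D.

(** The diagonal of [b] is divided out column by column and absorbed by the torus. *)
Lemma upper_Nmat d b (t : nat -> F) : (d <= n)%N -> upper b -> b \in unitmx -> topblk d.+1 b ->
  exists u, [/\ unip u, topblk d.+1 u
    & b *m Nmat n d t = u *m Nmat n d (fun i => b (inord i) (inord i) * t i)].
Proof.
move=> dn bU bu bB; have b0 i : b i i != 0.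
  by move: bu; rewrite upper_unit // => /forallP.
have uB : topblk d.+1 (\matrix_(i, j) (b i j / b j j)).
  move=> i j h; rewrite mxE; have [->|ij] := eqVneq i j; first by rewrite divff.
  by rewrite bB // (negPf ij) mul0r.
exists (\matrix_(i, j) (b i j / b j j)); split=> //.
  by split=> [i|i j ji]; rewrite mxE ?divff // bU // mul0r.
apply/matrixP => i j; have [jd|dj] := leqP j d; last first.
  by rewrite !(topblk_mulr _ _ (@Nmat_topblk _ _ _ _)) // mxE bB ?dj ?orbT // (bB j) ?dj // eqxx divr1.
have [l lE] := ord_sub j dn; rewrite !(Nmat_mulr _ _ _ jd lE) mxE.
have -> : inord l = l by apply: val_inj; rewrite /= inordK.
by field; apply: b0.
Qed.

(** [choose_rep] sees the whole array of exponents, since the system of representatives may vary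
    with it. The factor [b] comes out only upper triangular; its unipotence is recovered afterwards
    from the torus. *)
Lemma cellmx_surj d (choose_rep : (nat -> nat -> nat) -> nat -> nat -> F -> F) (t : nat -> F) x u u' :
  (d <= n)%N ->
  (forall m e a (c0 : F), (a < e)%N -> (e <= d)%N -> valid (m e a) c0 ->
     choose_rep m e a c0 \in O /\ congr_pow (psum (m e) a e) c0 (choose_rep m e a c0)) ->
  (forall i, (i <= d)%N -> t i != 0) ->
  GLO x -> topblk d.+1 x -> unip u -> topblk d.+1 u -> unip u' -> topblk d.+1 u' ->
  x = u *m Nmat n d t *m u' ->
  exists m c b v, [/\ cell_valid d m c,
    forall e a, (a < e)%N -> (e <= d)%N -> exists2 c0 : F, valid (m e a) c0 & c e a = choose_rep m e a c0,
    [/\ GLO b, upper b & topblk d.+1 b],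
    [/\ GLO v, unip v & topblk d.+1 v] & x = b *m cellmx d m c *m v].
Proof.
elim: d choose_rep t x u u' => [|d IH] choose_rep t x u u' dn choose_repP t0 xG xB uU uB u'U u'B xE.
  exists (fun _ _ => 0%N), (fun _ _ => 0), x, 1%:M; split=> //.
  - by move=> e a ae e0; move: (leq_trans ae e0).
  - by move=> e a ae e0; move: (leq_trans ae e0).
  - split=> // i j ji; rewrite (topblk_row _ xB) ?ord_gtF //.
    exact: leq_trans ji.
  - by split; [exact: GLO1|exact: unip1|exact: topblk1].
  - by rewrite !mulmx1.
have dn' := ltnW dn.
have N1u : Nmat n d (fun=> 1 : F) \in unitmx.
  by apply: Nmat_unit => // i _; apply: oner_neq0.
(* Up to scaling of rows by [t], [g] is the part of [Nmat n d.+1 t *m u'] in rows 1 to d+1 and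
   columns 0 to d; making it upper triangular makes [x] Hessenberg. *)
pose g := Nmat n d (fun=> 1 : F) *m trunc d.+1 u'.
have tu'U : unip (trunc d.+1 u') by apply: trunc_unip.
have tu'B : topblk d.+1 (trunc d.+1 u') by apply: trunc_topblk.
have gB : topblk d.+1 g by apply: topblkM => //; apply: Nmat_topblk.
have gu : g \in unitmx by rewrite unitmx_mul N1u unip_unit.
have [K [KG KB gKU]] := iwasawa D (leqW dn) gu gB.
have Ku := GLO_unit KG.
have gKu : g *m K \in unitmx by rewrite unitmx_mul gu.
pose k := invmx K; have kG : GLO k by apply: GLOV.
have kB : topblk d.+1 k by apply: topblkV.
have [u0 [u0U u0B u0E]] : exists u0, [/\ unip u0, topblk d.+1 u0 &
    invmx (g *m K) *m Nmat n d (fun=> 1 : F)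
    = u0 *m Nmat n d (fun i => invmx (g *m K) (inord i) (inord i) * 1)].
  apply: upper_Nmat => //; first exact: upperV.
    by rewrite unitmx_inv.
  by apply: topblkV => //; apply: topblkM.
(* [k] is the upper triangular matrix [invmx (g *m K)] times [g]; with the diagonal absorbed by the
   torus it is a point of the big cell one size down. *)
have kE : k = u0 *m Nmat n d (fun i => invmx (g *m K) (inord i) (inord i) * 1) *m trunc d.+1 u'.
  rewrite -u0E -mulmxA -/g; apply: GLO_invE; apply: mulmx1C.
  by rewrite -mulmxA mulVmx.
have s0 i : (i <= d)%N -> invmx (g *m K) (inord i) (inord i) * 1 != 0.
  move=> _; rewrite mulr1 upperV_diag // invr_eq0.
  by move: gKu; rewrite upper_unit // => /forallP.
have [B BE] : {B | B = x *m K} by eexists.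
have BG : GLO B by rewrite BE; apply: GLOM.
have BB : topblk d.+2 B by rewrite BE; apply: topblkM => //; apply: topblkW KB.
have xBk : x = B *m k by rewrite BE /k mulmxK.
have NuK (i j q : 'I_n.+1) : i = q.+1 :> nat -> (q <= d)%N -> (j <= d)%N ->
    (Nmat n d.+1 t *m (u' *m K)) i j = t i * (g *m K) q j.
  move=> iq qd jd; have id : (i <= d.+1)%N by rewrite iq.
  have [l lE] := ord_sub q dn'; have lE' : l = (d.+1 - i)%N :> nat by rewrite lE iq subSS.
  rewrite (Nmat_mull _ _ _ id lE') /g -mulmxA (Nmat_mull _ _ _ qd lE) iq subSS -iq mulr1.
  rewrite [_ * t i]mulrC -mulrA -truncMl // [in RHS]mxE !ltnS jd andbT.
  by rewrite lE leq_subr.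
have Bhess : hess d.+1 B /\ (forall i j : 'I_n.+1, (j <= d)%N -> i = j.+1 :> nat -> B i j != 0).
  have NH : hess d.+1 (Nmat n d.+1 t *m (u' *m K)).
    move=> i j jd ji; have [id|di] := leqP i d.+1.
      have [q qE] : exists q : 'I_n.+1, q = i.-1 :> nat.
        by exists (inord i.-1); rewrite inordK // (leq_ltn_trans (leq_pred _)).
      have iq : i = q.+1 :> nat by rewrite qE prednK // (leq_trans _ ji).
      have qd : (q <= d)%N by rewrite -ltnS -iq.
      have jq : (j < q)%N by rewrite -ltnS -iq.
      by rewrite (NuK _ _ _ iq qd jd) gKU // mulr0.
    rewrite (topblk_mull _ _ (@Nmat_topblk _ _ _ _)) // (topblk_mull _ _ u'B) // (topblk_row _ KB).
      by rewrite ord_gtF // (ltn_trans _ ji).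
    exact: ltnW.
  split; first by rewrite BE xE -!mulmxA; apply: upper_hess => //; case: uU.
  move=> i j jd ij; rewrite BE xE -!mulmxA (upper_hess_sub (d := d.+1)) //; last by case: uU.
  rewrite (NuK _ _ _ ij) // (proj1 uU) mul1r mulf_neq0 ?t0 ?ij //.
  by move: gKu; rewrite upper_unit // => /forallP.
have [BH B0] := Bhess.
have [m1 m1P] : exists m1 : nat -> nat, forall i j : 'I_n.+1, (j <= d)%N -> i = j.+1 :> nat ->
    exists2 e, unitO O e & B i j = e * p ^+ m1 j.
  have H (j : 'I_n.+1) : exists k, forall i : 'I_n.+1, (j <= d)%N -> i = j.+1 :> nat ->
      exists2 e, unitO O e & B i j = e * p ^+ k.
    have [jd|dj] := leqP j d; last by exists 0%N.
    have [q qE] : exists q : 'I_n.+1, q = j.+1 :> nat.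
      by exists (inord j.+1); rewrite inordK // ltnS (leq_trans _ dn).
    have [e [l [eu BqE]]] := dvr_int D (proj1 BG q j) (B0 q j jd qE).
    exists l => i _ ij; exists e => //; rewrite -BqE; congr (B _ _).
    by apply: val_inj; rewrite /= ij qE.
  have [f fP] := fin_all_exists H.
  exists (fun a => f (inord a)) => i j jd ij; have [e eu ->] := fP j i jd ij; exists e => //.
  by congr (_ * _ ^+ f _); apply: val_inj; rewrite /= inordK.
(* Level [d + 1] receives its exponents [m1] before the induction hypothesis is used, because the
   representatives at lower levels depend on them. *)
pose upd (T : Type) (f : nat -> nat -> T) (f1 : nat -> T) e a := if e == d.+1 then f1 a else f e a.
have updE T (f : nat -> nat -> T) f1 : upd T f f1 d.+1 = f1 by rewrite /upd eqxx.
have updN T (f : nat -> nat -> T) f1 e a : (e <= d)%N -> upd T f f1 e a = f e a.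
  by move=> ed; rewrite /upd ltn_eqF.
have [|m' [c' [b' [v [c'V c'R [b'G b'U b'B] [vG vU vB] k'E]]]]] :=
  IH (fun m => choose_rep (upd _ m m1)) _ k u0 (trunc d.+1 u') dn' _ s0 kG kB u0U u0B tu'U tu'B kE.
  move=> m e a z ae ed zV; have := @choose_repP (upd _ m m1) e a z ae (leqW ed).
  by rewrite /psum; under eq_bigr do rewrite updN //; rewrite updN //; apply.
pose m := upd _ m' m1.
(* The factor [b'] left over by the lower levels is merged into [B]: it is upper triangular with
   units on the diagonal, so the Hessenberg shape and the exponents [m1] persist. *)
have [||||c1 [b2 [c1V b2G b2U b2B BbE]]] := @hessmx_surj _ _ _ n D d.+1 m1 (B *m b') dn _ _ _ _.
- exact: GLOM.
- by apply: topblkM => //; apply: topblkW b'B.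
- exact: hess_upper.
- move=> i j jd ij; have [e eu eE] := m1P i j jd ij.
  exists (e * b' j j); first by apply: unitOM => //; apply: GLO_upper_diag b'G b'U.
  by rewrite (hess_upper_sub b'U BH jd ij) eE mulrAC.
pose c2 a := choose_rep m d.+1 a (c1 a).
have c2P a : (a < d.+1)%N -> c2 a \in O /\ congr_pow (psum m1 a d.+1) (c1 a) (c2 a).
  move=> ad; have := @choose_repP m d.+1 a (c1 a) ad (leqnn _); rewrite /m updE; apply; exact: c1V.
have c2V a : (a < d.+1)%N -> valid (m1 a) (c2 a).
  move=> ad; have [c2O cc] := c2P a ad.
  apply: (valid_congr_pow D _ (c1V a ad) c2O cc).
  by rewrite /psum big_ltn // leq_addr.
have [v2 [z [i [[v2U v2G v2B] [iE zO z0 b12]]]]] :=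
  hessmx_congr_pow D dn c1V c2V (fun a ad => proj2 (c2P a ad)).
pose k0 := cellmx d m' c'.
have k0G : GLO k0 by apply: cellmx_GLO.
have k0B : topblk d.+1 k0 by apply: cellmx_topblk.
have k0u := GLO_unit k0G.
(* The column operation caused by the change of representatives stands left of [k0]; conjugation by
   [k0] makes it an integral operation on the right. *)
pose z' := invmx k0 *m z.
have z'0 (q : 'I_n.+1) : (i <= q)%N -> z' q 0 = 0.
  by move=> iq; rewrite /z' (topblk_mull _ _ (topblkV k0u k0B)) ?z0 // -iE.
have z'O : intmx O z' by apply: intmxM => //; case: (GLOV k0G).
exists m, (upd _ c' c2), (b2 *m v2), (coltrans z' i *m v); split.
- move=> e a ae; rewrite leq_eqVlt => /orP[/eqP ed|ed].
    by rewrite ed /m !updE; apply: c2V; rewrite -ed.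
  by rewrite /m !updN //; apply: c'V.
- move=> e a ae; rewrite leq_eqVlt => /orP[/eqP ed|ed].
    by rewrite ed /m !updE; exists (c1 a) => //; apply: c1V; rewrite -ed.
  by rewrite /m !updN //; apply: c'R.
- split; [exact: GLOM|apply: upperM => //; exact: (proj2 v2U)|exact: topblkM].
- have yU : unip (coltrans z' i) by apply: coltrans_unip.
  split.
  + apply: GLOM => //; apply: unip_GLO => // q j.
    by rewrite coltransE rpredD ?rpredM ?rpred_nat.
  + exact: unipM.
  + by apply: topblkM; [apply: coltrans_topblk|apply: topblkW vB].
- rewrite xBk k'E -/k0 /cellmx -/cellmx /m !updE.
  have -> : cellmx d (upd _ m' m1) (upd _ c' c2) = k0.
    by apply: eq_cellmx => e a ae ed; rewrite updN.
  have yk : coltrans z i *m k0 = k0 *m coltrans z' i.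
    by rewrite /z' -coltrans_conj ?iE // !mulmxA mulmxV // mul1mx.
  have -> : B *m (b' *m k0 *m v) = (B *m b') *m k0 *m v by rewrite !mulmxA.
  rewrite BbE b12; set B2 := hessmx d.+1 m1 c2.
  have -> : b2 *m (v2 *m B2 *m coltrans z i) *m k0 = b2 *m (v2 *m B2 *m (coltrans z i *m k0)) by rewrite !mulmxA.
  by rewrite yk !mulmxA.
Qed.

(** Both tori consist of powers of [p] and differ by the diagonal of [b], which consists of units;
    uniqueness of the Bruhat decomposition makes this diagonal 1. *)
Lemma cellmx_surj_expz (choose_rep : (nat -> nat -> nat) -> nat -> nat -> F -> F) (k : nat -> int) x u u' :
  (forall m e a (c0 : F), (a < e)%N -> (e <= n)%N -> valid (m e a) c0 ->
     choose_rep m e a c0 \in O /\ congr_pow (psum (m e) a e) c0 (choose_rep m e a c0)) ->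
  GLO x -> unip u -> unip u' -> x = u *m Nmat n n (fun i => p ^ k i) *m u' ->
  exists m c v v', [/\ cell_valid n m c,
    forall e a, (a < e)%N -> (e <= n)%N -> exists2 c0 : F, valid (m e a) c0 & c e a = choose_rep m e a c0,
    forall i, (i <= n)%N -> torus p m n i = p ^ k i,
    [/\ unip v, GLO v, unip v' & GLO v'] & x = v *m cellmx n m c *m v'].
Proof.
move=> choose_repP xG uU u'U xE; have k0 i : (i <= n)%N -> p ^ k i != 0 by move=> _; apply: expfz_neq0.
have [m [c [b [v [mcV hc [bG bU _] [vG vU _] xb]]]]] :=
  cellmx_surj (leqnn n) choose_repP k0 xG (@topblk_full _ _ x) uU (@topblk_full _ _ u) u'U (@topblk_full _ _ u') xE.
have [u1 [u1' [[u1U _ u1'U _ x1E] _]]] := cellmx_bruhat p0 (leqnn n) mcV.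
have bu1 : b *m u1 \in unitmx by rewrite unitmx_mul (GLO_unit bG) unip_unit.
have [u2 [u2U _ u2E]] := upper_Nmat (torus p m n) (leqnn n)
  (upperM bU (proj2 u1U)) bu1 (@topblk_full _ _ _).
have bd i : (b *m u1) i i = b i i by rewrite upperM_diag ?(proj1 u1U) ?mulr1 //; case: u1U.
have bt0 i : (i <= n)%N -> (b *m u1) (inord i) (inord i) * torus p m n i != 0.
  by move=> _; rewrite bd mulf_neq0 ?torus_neq0 // (unitO_neq0 (GLO_upper_diag _ bG bU)).
have xE2 : x = u2 *m Nmat n n (fun i => (b *m u1) (inord i) (inord i) * torus p m n i) *m (u1' *m v).
  by rewrite xb x1E -u2E !mulmxA.
rewrite xE in xE2; have [_ _ h] := bruhat_cell_unique k0 bt0 uU u'U u2U (unipM u1'U vU) xE2.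
have bt i : (i <= n)%N -> b (inord i) (inord i) = 1 /\ torus p m n i = p ^ k i.
  move=> ni; have := h i ni; rewrite bd torus_diagsum //.
  exact: (unitO_expz_eq D (GLO_upper_diag _ bG bU)).
have bUn : unip b.
  split=> // i; have [] := bt i (leq_ord i).
  by have -> : inord i = i by apply: val_inj; rewrite /= inordK.
by exists m, c, b, v; split=> // i ni; have [] := bt i ni.
Qed.

(** The quotient [g] relating the Hessenberg factors is upper triangular, and its first d+1 diagonal
    entries are units and powers of [p], hence 1, which equates the exponents. The second half
    assumes that congruent coefficients are equal: the congruence on the top level can be derived
    only once the lower levels coincide exactly. *)
Lemma cellmx_inj d m m' c c' v v' : (d <= n)%N -> cell_valid d m c -> cell_valid d m' c' ->
  unip v -> intmx O v -> topblk d.+1 v -> unip v' -> intmx O v' -> topblk d.+1 v' ->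
  cellmx d m c = v *m cellmx d m' c' *m v' ->
  (forall e a, (a < e)%N -> (e <= d)%N -> m e a = m' e a) /\
  ((forall e a, (a < e)%N -> (e <= d)%N -> congr_pow (psum (m e) a e) (c e a) (c' e a) -> c e a = c' e a) ->
   forall e a, (a < e)%N -> (e <= d)%N -> c e a = c' e a).
Proof.
elim: d v v' => [|d IH] v v' dn hc hc' vU vO vB v'U v'O v'B xE.
  by split=> [|_] e a ae e0; move: (leq_trans ae e0).
have dn' := ltnW dn; have hk := validxW hc; have hk' := validxW hc'.
set k := cellmx d m c in xE; set k' := cellmx d m' c' in xE.
pose b := hessmx d.+1 (m d.+1) (c d.+1); pose b' := hessmx d.+1 (m' d.+1) (c' d.+1).
have xbk : cellmx d.+1 m c = b *m k by [].
have xbk' : cellmx d.+1 m' c' = b' *m k' by [].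
have kG : GLO k by apply: cellmx_GLO.
have kB : topblk d.+1 k by apply: cellmx_topblk.
have k'G : GLO k' by apply: cellmx_GLO.
have k'B : topblk d.+1 k' by apply: cellmx_topblk.
have ku := GLO_unit kG; have k'u := GLO_unit k'G.
have [g gE] : {g | g = k' *m v' *m invmx k} by eexists.
have bE : b = v *m b' *m g.
  transitivity (v *m (b' *m k') *m v' *m invmx k); last by rewrite gE !mulmxA.
  by rewrite -xbk' -xE xbk mulmxK.
have gk : g *m k = k' *m v' by rewrite gE mulmxKV.
have gB : topblk d.+2 g.
  rewrite gE; apply: topblkM; last by apply: topblkV => //; apply: topblkW kB.
  by apply: topblkM => //; apply: topblkW k'B.
have gG : GLO g.
  rewrite gE; apply: GLOM; last exact: GLOV.
  by apply: GLOM => //; apply: unip_GLO.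
(* Below row [d] both [k'] and [invmx k] act as the identity, so these rows of [g] are those of
   [v']. *)
have grow (l j : 'I_n.+1) : (d < l)%N -> (j <= l)%N -> g l j = (l == j)%:R.
  move=> dl jl; rewrite gE -mulmxA (topblk_mull _ _ k'B) //.
  have kVB := topblkV ku kB; have [jd|dj] := leqP j d.
    rewrite mxE big1 ?ord_gtF ?(leq_ltn_trans jd) // => q _; case: (ltnP q l) => [ql|lq].
      by rewrite (proj2 v'U) ?mul0r.
    have dq : (d < q)%N by apply: leq_trans lq.
    by rewrite (topblk_row _ kVB) // ord_gtF ?mulr0 // (leq_ltn_trans jd).
  rewrite (topblk_mulr _ _ kVB) //; move: jl; rewrite leq_eqVlt => /orP[/eqP/val_inj->|jl].
    by rewrite (proj1 v'U) eqxx.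
  by rewrite (proj2 v'U) ?ord_gtF.
have bH : hess d.+1 b by move=> i j; apply: hessmx_hess.
have b'H : hess d.+1 b' by move=> i j; apply: hessmx_hess.
have vb'S (i j : 'I_n.+1) : (j <= d)%N -> i = j.+1 :> nat -> (v *m b') i j = p ^+ m' d.+1 j.
  move=> jd ij; rewrite (upper_hess_sub (proj2 vU) b'H jd ij) (proj1 vU) mul1r.
  by rewrite /b' hessmx_sub.
have [|||gL gD] := hess_quot dn bH _ bE.
- by apply: upper_hess b'H; case: vU.
- by move=> i j jd ij; rewrite vb'S // expf_neq0.
- move=> l j dl jd; rewrite grow // ?ord_gtF // ?(leq_trans jd) //.
  by rewrite ltnW // (leq_trans jd).
have gU : upper g.
  move=> i j ji; have [id|di] := leqP i d; first exact: gL.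
  by rewrite grow ?ord_gtF // ltnW.
have mg (j : 'I_n.+1) : (j <= d)%N -> m d.+1 j = m' d.+1 j /\ g j j = 1.
  move=> jd; have [i iE] : exists i : 'I_n.+1, i = j.+1 :> nat.
    by exists (inord j.+1); rewrite inordK // ltnS (leq_ltn_trans jd).
  have := gD i j jd iE; rewrite /b hessmx_sub // vb'S // => e.
  have gu := GLO_upper_diag j gG gU.
  have ge : g j j = p ^ ((m d.+1 j)%:Z - (m' d.+1 j)%:Z).
    by rewrite expfzDr // -invr_expz -!exprnP e mulrC mulKf // expf_neq0.
  have := gu; rewrite ge => /(unitO_expz D) e0; split; last by rewrite e0.
  by move/eqP: e0; rewrite subr_eq0 => /eqP[].
have gUn : unip g.
  split=> // i; have [id|di] := leqP i d; last by rewrite grow // eqxx.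
  by have [_] := mg i id.
have gO : intmx O g by case: gG.
(* Truncation turns [g *m k = k' *m v'] into an identity of the lower level, to which the induction
   applies. *)
pose h := trunc d.+1 g; pose v1 := trunc d.+1 v'.
have tO x : intmx O x -> intmx O (trunc d.+1 x).
  by move=> xO i j; rewrite mxE; case: ifP; rewrite ?rpred_nat.
have hU : unip h by apply: trunc_unip.
have hB : topblk d.+1 h by apply: trunc_topblk.
have v1U : unip v1 by apply: trunc_unip.
have v1B : topblk d.+1 v1 by apply: trunc_topblk.
have hk1 : h *m k = k' *m v1 by rewrite -truncMl // gk truncMr.
have hu := unip_unit hU; have hG : GLO h by apply: unip_GLO => //; apply: tO.
have kE : k = invmx h *m k' *m v1 by rewrite -mulmxA -hk1 mulKmx.
have [||||mE cE] := IH (invmx h) v1 dn' hk hk' _ _ _ v1U _ v1B kE.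
- exact: unipV.
- by case: (GLOV hG).
- exact: topblkV.
- exact: tO.
split=> [e a ae|hcc].
  rewrite leq_eqVlt => /orP[/eqP ed|ed]; last exact: mE.
  have ad : (a <= d)%N by rewrite -ltnS -ed.
  by have := mg (inord a); rewrite inordK ?(leq_ltn_trans ad (leqW dn)) // ed => /(_ ad)[].
have {}cE e a : (a < e)%N -> (e <= d)%N -> c e a = c' e a.
  by apply: cE => {}e {}a ae ed; apply: hcc => //; apply: leqW.
move=> e a ae; rewrite leq_eqVlt => /orP[/eqP ed|ed]; last exact: cE.
rewrite ed; apply: hcc => //; first by rewrite -ed.
have kk' : k = k' by apply: eq_cellmx.
have [u [u' [[uU uB u'U u'B kN] _]]] := cellmx_bruhat p0 dn' hk; rewrite -/k in kN.
(* Here [h *m k = k *m v1]; inserting the Bruhat decomposition of [k] and conjugating reduces this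
   to the uniqueness statement. Hence within the block [g] differs from the identity only in its
   last column. *)
have h1 : h = 1%:M.
  have uu := unip_unit uU; have u'u := unip_unit u'U.
  have tn0 i : (i <= d)%N -> torus p m d i != 0 by move=> _; apply: torus_neq0.
  have [||||| h'1 _ _] := @bruhat_unique _ n d (torus p m d) (torus p m d)
    (invmx u *m h *m u) (u' *m v1 *m invmx u') dn' tn0 tn0.
  - by apply: unipM => //; apply: unipM => //; apply: unipV.
  - by apply: unipM; [apply: unipM|apply: unipV].
  - by apply: topblkM => //; apply: topblkM => //; apply: topblkV.
  - by apply: topblkM; [apply: topblkM|apply: topblkV].
  - rewrite !mulmxA; apply: (canRL (mulmxK u'u)); rewrite -!mulmxA; apply: (canLR (mulKmx uu)).
    have -> : h *m (u *m (Nmat n d (torus p m d) *m u')) = h *m k by rewrite kN !mulmxA.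
    by rewrite hk1 -kk' kN !mulmxA.
  - have : u *m (invmx u *m h *m u) *m invmx u = 1%:M by rewrite h'1 mulmx1 mulmxV.
    by rewrite !mulmxA mulmxV // mul1mx mulmxK.
have bw := @hessmx_inv_col _ O p n d.+1 (m d.+1) (c d.+1) dn (fun a ad => hc _ _ ad (leqnn _)).
have bw' := @hessmx_inv_col _ O p n d.+1 (m' d.+1) (c' d.+1) dn (fun a ad => hc' _ _ ad (leqnn _)).
set w := inv_col _ _ _ _ _ in bw; set w' := inv_col _ _ _ _ _ in bw'.
(* Each Hessenberg factor sends its own vector to the first basis vector, and [v] fixes that
   vector. *)
have gw : g *m w = w'.
  have b'u : v *m b' \in unitmx.
    rewrite unitmx_mul unip_unit //; apply: (@GLO_unit _ O _ _ (hessmx_GLO pO dn _)).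
    by move=> q qd; apply: hc'.
  apply: (can_inj (mulKmx b'u)); rewrite mulmxA -bE bw -mulmxA bw'.
  apply/colP => i; rewrite -colE !mxE andbT.
  case: (posnP i) => [i0|ip]; last by rewrite (proj2 vU) // -val_eqE /= gtn_eqF.
  have -> : i = 0 by apply: val_inj.
  by rewrite (proj1 vU).
have ad : (a < d.+1)%N by rewrite -ed.
have aE : (inord a : 'I_n.+1) = a :> nat by rewrite inordK // (leq_ltn_trans _ (leqW dn)).
have dE : (inord d.+1 : 'I_n.+1) = d.+1 :> nat by rewrite inordK.
have mm : psum (m' d.+1) 0 a = psum (m d.+1) 0 a /\ psum (m' d.+1) 0 d.+1 = psum (m d.+1) 0 d.+1.
  have mm q : (q <= d)%N -> m' d.+1 q = m d.+1 q.
    by move=> qd; have := mg (inord q); rewrite inordK ?(leq_ltn_trans qd (leqW dn)) // => /(_ qd)[].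
  by split; apply: eq_big_nat => q /andP[_ qa]; apply: mm => //; apply: leq_trans (ltnW qa) _.
(* At row [a] only the diagonal and the last column of [g] contribute; the last entry of [w]
   supplies the power of [p] in the congruence. *)
have := congr1 (fun A : 'cV_n.+1 => A (inord a) 0) gw.
rewrite !mxE aE ad (proj1 mm) (bigD1 (inord a)) //= (bigD1 (inord d.+1)) /=; last first.
  by rewrite -val_eqE /= dE aE gtn_eqF.
rewrite (proj1 gUn) mul1r !mxE aE dE ad ltnn eqxx big1 ?addr0 => [e1|q /andP[qa qd]]; last first.
  have [qltd|dq] := leqP q d.
    have := congr1 (fun A : M => A (inord a) q) h1.
    by rewrite !mxE aE ad ltnS qltd eq_sym (negPf qa) /= => ->; rewrite mul0r.
  rewrite !mxE ltnNge dq /= -dE ifF ?mulr0 //; exact: negPf qd.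
exists ((-1) ^+ a * (-1) ^+ d * g (inord a) (inord d.+1)).
  by rewrite !rpredM ?rpredX ?rpredN ?rpred1.
apply: (mulfI (expf_neq0 (psum (m d.+1) 0 a) p0)).
rewrite [RHS]mulrA.
have <- : p ^+ psum (m d.+1) 0 d.+1 = p ^+ psum (m d.+1) 0 a * p ^+ psum (m d.+1) a d.+1.
  by rewrite -exprD -psum_cat // ltnW.
have sq : (-1 : F) ^+ a * (-1) ^+ a = 1 by rewrite -exprD -signr_odd addnn odd_double.
transitivity (((-1) ^+ a * (-1) ^+ a) * (p ^+ psum (m d.+1) 0 a * (c d.+1 a - c' d.+1 a))).
  by rewrite sq mul1r.
move: e1; rewrite exprS => e1.
transitivity ((-1) ^+ a * ((-1) ^+ a * c d.+1 a * p ^+ psum (m d.+1) 0 a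
  - (-1) ^+ a * c' d.+1 a * p ^+ psum (m d.+1) 0 a)); first by ring.
by rewrite -e1; ring.
Qed.

End Bijection.

(** * The p-adic numbers and their additive character *)

Section FractionRepresentation.
Import generic_quotient.

Lemma fractionE (R : idomainType) (x : {fraction R}) :
  exists a b : R, b != 0 /\ x = tofrac a / tofrac b.
Proof.
elim/quotW: x => r; exists (fraction.frac r).1, (fraction.frac r).2; have d0 := denom_ratioP r; split=> //.
have t0 : tofrac (fraction.frac r).2 != 0 by rewrite tofrac_eq0.
apply: (canRL (mulfK t0)).
rewrite !piE; apply/eqmodP; rewrite /= FracField.equivfE /FracField.mulf.
by rewrite !numden_Ratio ?(oner_eq0, mulf_neq0) // !mulr1 mulrC.
Qed.

End FractionRepresentation.

Section Padic.
Variables (p : nat) (hp : prime p).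
Local Notation Z := (Defs.Zp hp).
Local Notation Q := (Qp hp).

(** The boolean form of [isZp], in which Z_p can serve as the subring of a [dvr]. *)
Definition OQ : {pred Q} := fun x => `[< isZp x >].

Lemma OQP (x : Q) : reflect (exists a : Z, x = tofrac a) (x \in OQ).
Proof. exact: asboolP. Qed.

Lemma OQ_subring : subring_closed OQ.
Proof.
split=> [|x y|x y].
- by apply/OQP; exists 1; rewrite tofrac1.
- by move=> /OQP[a ->] /OQP[b ->]; apply/OQP; exists (a - b); rewrite tofracB.
- by move=> /OQP[a ->] /OQP[b ->]; apply/OQP; exists (a * b); rewrite tofracM.
Qed.
HB.instance Definition _ := GRing.isSubringClosed.Build Q OQ OQ_subring.

Lemma Zp_res_nat a k : Zp_res (a%:R : Z) k = a%:R.
Proof. by elim: a => [//|a IH]; rewrite [in RHS]mulrSr -IH mulrSr. Qed.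

Lemma Zp_res_le (x : Z) i l : (i <= l)%N -> (Zp_res x l = Zp_res x i %[mod p ^ i.+1])%N.
Proof. by move/subnKC <-; apply: Zp_res_mod. Qed.

Lemma Zp_res_lt (x : Z) k : (Zp_res x k < p ^ k.+1)%N.
Proof.
by move: (Zp_res x k) (pexp_gt1 hp k); case: (p ^ k.+1)%N => [|[|m]] // a _; apply: ltn_ord.
Qed.

Lemma Zp_eq_mod k (a b : nat) :
  ((a%:R : 'Z_(p ^ k.+1)) = b%:R) <-> (a = b %[mod p ^ k.+1])%N.
Proof.
split=> [/(congr1 (@nat_of_ord _))|e]; first by rewrite !Zp_val_natr.
by apply: val_inj; rewrite /= !Zp_val_natr.
Qed.

(** The quotient is a shift of [x]: its residue modulo [p ^ j.+1] is the residue of [x] modulo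
    [p ^ (j + k.+1).+1], divided as an integer by [p ^ k.+1]. *)
Lemma Zp_res_dvd (x : Z) k : Zp_res x k = 0 -> exists y : Z, x = p%:R ^+ k.+1 * y.
Proof.
move=> xk; have p0 : (0 < p)%N := prime_gt0 hp.
have pk0 : (0 < p ^ k.+1)%N by rewrite expn_gt0 p0.
pose f j : 'Z_(p ^ j.+1) := ((Zp_res x (j + k.+1) : nat) %/ p ^ k.+1)%:R.
have fc j : Zred (f j.+1) = f j.
  rewrite /f (Zred_natr hp).
  apply/Zp_eq_mod.
  have := congr1 (@nat_of_ord _) (Zp_coh x (j + k.+1)); rewrite /Zred /= Zp_val_natr //= => <-.
  set a' := (Zp_res x _ : nat).
  rewrite {1}(divn_eq a' (p ^ (j + k.+1).+1)) -addSn expnD mulnA.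
  by rewrite divnMDl // modnMDl.
exists (Coherent fc); apply: Zp_eq => i.
rewrite -natrX; change (Zp_res x i = Zp_res ((p ^ k.+1)%:R : Z) i * f i).
rewrite Zp_res_nat /f -natrM mulnC divnK; last first.
  have ki : (k <= i + k.+1)%N by rewrite addnS ltnW // ltnS leq_addl.
  by apply/eqP; rewrite (Zp_res_le x ki) xk mod0n.
rewrite -[LHS]natr_Zp; apply/Zp_eq_mod/esym/Zp_res_le; exact: leq_addr.
Qed.

(** All residues of [x] are prime to [p], and their inverses form a coherent sequence. *)
Lemma Zp_unit_res (x : Z) : Zp_res x 0 != 0 -> x \is a GRing.unit.
Proof.
move=> x0; have cop k : coprime (p ^ k.+1) (Zp_res x k).
  rewrite coprime_pexpl // prime_coprime //; apply: contraNN x0 => /dvdnP[q qE].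
  have := Zp_res_le x (leq0n k); rewrite qE [RHS]modn_small ?Zp_res_lt // => e.
  have z : (q * p %% p ^ 1 = 0)%N by rewrite expn1 modnMl.
  by apply/eqP/val_inj; rewrite /= -e z.
have xu k : Zp_res x k \is a GRing.unit.
  by rewrite -[Zp_res x k]natr_Zp unitZpE ?pexp_gt1.
pose f j : 'Z_(p ^ j.+1) := (Zp_res x j)^-1.
have fc j : Zred (f j.+1) = f j.
  have e : Zred (f j.+1) * Zred (Zp_res x j.+1) = 1.
    by rewrite -(ZredM hp) /f (mulVr (xu j.+1)) (Zred1 hp).
  rewrite Zp_coh in e; apply: (mulIr (xu j)); apply: (etrans e).
  exact: esym (mulVr (xu j)).
apply/unitrP; exists (Coherent fc).
have e : (Coherent fc : Z) * x = 1.
  by apply: Zp_eq => k; exact: (mulVr (xu k)).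
by split; [exact: e|rewrite mulrC; exact: e].
Qed.

Lemma Zp_decomp (x : Z) : x != 0 -> exists (u : Z) k, u \is a GRing.unit /\ x = u * p%:R ^+ k.
Proof.
move=> x0; have ex : exists i, Zp_res x i != 0.
  apply: contrapT => h; move/eqP: x0; apply; apply: Zp_eq => k.
  by apply/eqP; apply: contrapT => hk; apply: h; exists k; apply/negP.
(* The exponent is the index of the first nonzero residue. *)
case: (ex_minnP ex) => -[|k] xk kmin.
  by exists x, 0%N; split; [apply: Zp_unit_res|rewrite expr0 mulr1].
have [|y yE] := @Zp_res_dvd x k.
  by apply/eqP; apply: contraT => /kmin; rewrite ltnn.
exists y, k.+1; split; last by rewrite mulrC.
apply: Zp_unit_res; apply: contraNN xk => /eqP/Zp_res_dvd[z zE].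
rewrite yE zE mulrA -exprD addn1 -natrX; apply/eqP.
change (Zp_res ((p ^ k.+2)%:R : Z) k.+1 * Zp_res z k.+1 = 0).
rewrite Zp_res_nat (_ : _%:R = 0) ?mul0r //; apply: (proj2 (Zp_eq_mod _ _ 0)).
by rewrite modnn mod0n.
Qed.

Lemma Zp_natr_dvd a k : (exists y : Z, a%:R = p%:R ^+ k * y) -> (p ^ k %| a)%N.
Proof.
case: k => [|k] [y yE]; first by rewrite expn0 dvd1n.
have := congr1 (fun z : Z => Zp_res z k) yE; rewrite /= Zp_res_nat -natrX.
rewrite -[RHS]/(Zp_res ((p ^ k.+1)%:R : Z) k * Zp_res y k) Zp_res_nat.
rewrite [(p ^ k.+1)%:R](proj2 (Zp_eq_mod _ _ 0)) ?modnn ?mod0n // mul0r.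
by move/(proj1 (Zp_eq_mod _ _ 0)) => /eqP; rewrite mod0n.
Qed.


Lemma OQ_nat_dvd a k : (a%:R : Q) / p%:R ^+ k \in OQ -> (p ^ k %| a)%N.
Proof.
have p0 : (p%:R : Z) != 0.
  apply/eqP => /(congr1 (fun z : Z => Zp_res z 1)); rewrite Zp_res_nat.
  move/(proj1 (Zp_eq_mod _ _ 0))/eqP; rewrite mod0n -/(p ^ 2 %| p)%N.
  by move/(dvdn_leq (prime_gt0 hp)); rewrite leqNgt -{1}[p]expn1 ltn_exp2l // prime_gt1.
move=> /OQP[y yE]; apply: Zp_natr_dvd; exists y; apply/eqP; rewrite -tofrac_eq.
rewrite tofracM tofracXn !rmorph_nat -yE mulrC divfK // expf_neq0 //.
by rewrite -(rmorph_nat (@tofrac Z)) tofrac_eq0.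
Qed.

(** If [a] vanished in Q_p, then [a / p ^+ a] would be integral, so [p ^ a] would divide [a],
    although [a < p ^ a]. *)
Lemma natr_Qp_neq0 a : (0 < a)%N -> (a%:R : Q) != 0.
Proof.
move=> a0; apply/negP => /eqP e.
have : (p ^ a %| a)%N by apply: OQ_nat_dvd; rewrite e mul0r rpred0.
by move/(dvdn_leq a0); rewrite leqNgt ltn_expl // prime_gt1.
Qed.

Lemma intr_Qp_neq0 (a : int) : a != 0 -> (a%:~R : Q) != 0.
Proof.
case: a => a a0; first by rewrite -pmulrn natr_Qp_neq0 // lt0n.
by rewrite NegzE rmorphN oppr_eq0 /= -pmulrn natr_Qp_neq0.
Qed.

Lemma OQ_int_dvd (a : int) k : (a%:~R : Q) / p%:R ^+ k \in OQ -> ((p ^ k)%:Z %| a)%Z.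
Proof.
rewrite dvdzE; case: a => a /=; first by rewrite -pmulrn; apply: OQ_nat_dvd.
by rewrite NegzE rmorphN /= -pmulrn mulNr rpredN; apply: OQ_nat_dvd.
Qed.

Lemma Qp_dvr : dvr OQ (p%:R : Q).
Proof.
have pO : (p%:R : Q) \in OQ by rewrite rpred_nat.
have p0 : (p%:R : Q) != 0 by rewrite natr_Qp_neq0 // prime_gt0.
have tu (u : Z) : u \is a GRing.unit -> unitO OQ (tofrac u).
  move=> uu; apply/and3P; split.
  - by rewrite tofrac_eq0; apply: contraTneq uu => ->; rewrite unitr0.
  - by apply/OQP; exists u.
  - by apply/OQP; exists u^-1; rewrite rmorphV.
split=> //.
- apply/negP => h; have : (p ^ 1 %| 1)%N by apply: OQ_nat_dvd; rewrite expr1 mul1r.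
  by rewrite expn1 dvdn1 => /eqP p1; move: hp; rewrite p1.
- move=> x; have [a [b [b0 ->]]] := fractionE x => x0.
  have a0 : a != 0 by apply: contraNneq x0 => ->; rewrite tofrac0 mul0r.
  have [u [k [uu ->]]] := Zp_decomp a0; have [v [l [vu ->]]] := Zp_decomp b0.
  exists (tofrac u / tofrac v), (k%:Z - l%:Z); split.
    by apply: unitOM; [|apply: unitOV]; apply: tu.
  rewrite !tofracM !tofracXn !rmorph_nat expfzDr // -invr_expz -!exprnP invfM.
  by rewrite mulrACA.
Qed.

(** This approximation supplies both the fractional parts and the representatives of residue
    classes. *)
Lemma OQ_digit (x : Q) k : x \in OQ ->
  exists a : nat, (a < p ^ k)%N /\ (x - a%:R) / p%:R ^+ k \in OQ.
Proof.
have p0 : (p%:R : Q) != 0 by rewrite natr_Qp_neq0 // prime_gt0.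
move=> xO; case: k => [|k].
  by exists 0%N; rewrite expn0 subr0 expr0 divr1.
move: xO => /OQP[y ->].
exists (Zp_res y k); rewrite Zp_res_lt; split=> //.
have [|z zE] := @Zp_res_dvd (y - (Zp_res y k : nat)%:R) k.
  change (Zp_res y k - Zp_res (((Zp_res y k : nat)%:R) : Z) k = 0).
  by rewrite Zp_res_nat natr_Zp subrr.
apply/OQP; exists z.
rewrite -(rmorph_nat (@tofrac Z)) -tofracB zE tofracM tofracXn rmorph_nat.
by rewrite mulrAC mulfV ?mul1r // expf_neq0.
Qed.

Lemma unitO_int (a : int) : unitO OQ (a%:~R : Q) = coprimez a p.
Proof.
have p0 : (p%:R : Q) != 0 by rewrite natr_Qp_neq0 // prime_gt0.
have pO : (p%:R : Q) \in OQ by rewrite rpred_nat.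
have D := Qp_dvr.
apply/idP/idP => [u|].
  rewrite coprimezE coprime_sym absz_nat prime_coprime //; apply/negP => pa.
  have : ((p%:Z %| a)%Z) by rewrite dvdzE.
  move/dvdzP => [b bE]; case/negP: (dvr_pV D).
  have /and3P[a0 _ aV] := u.
  suff -> : p%:R^-1 = b%:~R * (a%:~R)^-1 :> Q by rewrite rpredM // rpred_int.
  apply: (mulIf p0); rewrite mulVf // mulrAC -[p%:R]/((p%:Z)%:~R) -rmorphM /= -bE mulfV //.
rewrite /coprimez => /eqP g1; have [u [v e1]] := Bezoutz a p; rewrite g1 in e1.
have e : (u%:~R * a%:~R + v%:~R * p%:R : Q) = 1.
  by rewrite -[p%:R]/((p%:Z)%:~R) -!rmorphM -rmorphD /= e1.
apply: (@unitO_local _ _ _ D _ u%:~R v%:~R); rewrite ?rpred_int //.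
by rewrite -[RHS]e; ring.
Qed.

(** * The additive character of Q_p/Z_p *)

Section Character.
Variable R : realType.

Lemma ratr_Qp (a b : int) : b != 0 -> ratr (a%:~R / b%:~R) = a%:~R / b%:~R :> Q.
Proof.
move=> b0; set q := a%:~R / b%:~R.
have bq : (b%:~R : rat) != 0 by rewrite intr_eq0.
have dq : ((denq q)%:~R : rat) != 0 by rewrite intr_eq0 denq_neq0.
have : (numq q * b)%:~R = (a * denq q)%:~R :> rat.
  by rewrite !intrM numqE mulrAC /q divfK.
move/eqP; rewrite eqr_int => /eqP e.
have bQ := intr_Qp_neq0 b0; have dQ := intr_Qp_neq0 (denq_neq0 q).
apply: (canLR (mulfK dQ)); rewrite mulrAC; apply: (canRL (mulfK bQ)).
by rewrite -!intrM e.
Qed.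

Lemma ratr_QpD (x y : rat) : ratr (x + y) = ratr x + ratr y :> Q.
Proof.
have E (q : rat) : q = (numq q)%:~R / (denq q)%:~R by rewrite divq_num_den.
have [dx dy] := (denq_neq0 x, denq_neq0 y).
have e : x + y = (numq x * denq y + numq y * denq x)%:~R / (denq x * denq y)%:~R.
  by rewrite {1}[x]E {1}[y]E addf_div ?intr_eq0 // -!intrM -intrD.
by rewrite e ratr_Qp ?mulf_neq0 // intrD !intrM -addf_div // intr_Qp_neq0.
Qed.

Lemma ratr_QpN (x : rat) : ratr (- x) = - ratr x :> Q.
Proof. by apply: (addIr (ratr x)); rewrite -ratr_QpD !addNr /ratr mul0r. Qed.

Definition cis (q : rat) : R[i] :=
  let t := 2 * pi * ratr q : R in (cos t +i* sin t)%C.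

Lemma cisD q q' : cis (q + q') = cis q * cis q'.
Proof.
rewrite /cis rmorphD mulrDr; set s := 2 * pi * _; set t := 2 * pi * _.
by rewrite cosD sinD; apply/eqP; rewrite eq_complex /= eqxx addrC mulrC [X in _ + X]mulrC eqxx.
Qed.

Lemma cis_int (a : int) : cis a%:~R = 1.
Proof.
have cisn k : cis k%:R = 1.
  elim: k => [|k IH]; first by rewrite /cis rmorph0 mulr0 cos0 sin0.
  rewrite -natr1 cisD IH mul1r /cis rmorph1 mulr1.
  by rewrite mulr_natl cos2pi sin2pi.
case: a => a; first exact: cisn.
have h : cis (Negz a)%:~R * cis a.+1%:R = 1.
  by rewrite -cisD NegzE rmorphN /= -pmulrn addNr /cis rmorph0 mulr0 cos0 sin0.
by move: h; rewrite cisn mulr1.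
Qed.

Definition pfrac (q : rat) := exists (a : int) k, q = a%:~R / p%:R ^+ k.

Let p0 : (p%:R : Q) != 0. Proof. by rewrite natr_Qp_neq0 // prime_gt0. Qed.
Let p0Q : (p%:R : rat) != 0. Proof. by rewrite pnatr_eq0 -lt0n prime_gt0. Qed.

Lemma ratr_pfrac (a : int) k : ratr (a%:~R / p%:R ^+ k) = a%:~R / p%:R ^+ k :> Q.
Proof.
have := @ratr_Qp a (p ^ k)%:Z; rewrite -!pmulrn !natrX; apply.
by rewrite eqz_nat expn_eq0 negb_and -lt0n prime_gt0.
Qed.

Lemma pfrac_int q : pfrac q -> (ratr q : Q) \in OQ -> exists b : int, q = b%:~R.
Proof.
move=> [a [k ->]]; rewrite ratr_pfrac => /OQ_int_dvd/dvdzP[b ->]; exists b.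
by rewrite intrM -pmulrn natrX mulfK // expf_neq0.
Qed.

Lemma pfracD q q' : pfrac q -> pfrac q' -> pfrac (q + q').
Proof.
move=> [a [k ->]] [b [l ->]]; exists (a * (p ^ l)%:Z + b * (p ^ k)%:Z), (k + l)%N.
by rewrite addf_div ?expf_neq0 // intrD !intrM -!pmulrn !natrX exprD.
Qed.

Lemma pfracN q : pfrac q -> pfrac (- q).
Proof. by move=> [a [k ->]]; exists (- a), k; rewrite rmorphN mulNr. Qed.

Lemma pfrac_ex (x : Q) : exists q, pfrac q /\ x - ratr q \in OQ.
Proof.
have r0 : ratr 0 = 0 :> Q by rewrite /ratr mul0r.
have q0 : pfrac 0 by exists 0, 0%N; rewrite mul0r.
have [->|x0] := eqVneq x 0; first by exists 0; rewrite r0 subr0 rpred0.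
have [u [[k|k] [/unitOW uO ->]]] := dvr_val Qp_dvr x0.
  by exists 0; rewrite r0 subr0 -exprnP rpredM // rpredX // rpred_nat.
have [a [_ aO]] := OQ_digit k.+1 uO.
exists ((a%:Z)%:~R / p%:R ^+ k.+1); split; first by exists a%:Z, k.+1.
by rewrite ratr_pfrac NegzE -invr_expz -exprnP -mulrBl.
Qed.

Lemma fracpartP (x : Q) : pfrac (fracpart x) /\ x - ratr (fracpart x) \in OQ.
Proof.
rewrite /fracpart; set A := [set q | _].
have : A (xget 0 A).
  by apply: xgetPex; have [q [qf /asboolP qO]] := pfrac_ex x; exists q.
by move=> [qf qO]; split=> //; apply/asboolP.
Qed.

(** Two fractional parts of [x] differ by an element of Z[1/p] lying in Z_p, hence by an integer,
    where [cis] is trivial. This removes the choice made in [fracpart]. *)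
Lemma e_eq (x : Q) q : pfrac q -> x - ratr q \in OQ -> e R x = cis q.
Proof.
move=> qf qO; have [q'f q'O] := fracpartP x; rewrite /e -/(cis (fracpart x)).
have [||b bE] := @pfrac_int (fracpart x - q).
- by apply: pfracD => //; apply: pfracN.
- rewrite ratr_QpD ratr_QpN.
  have -> : ratr (fracpart x) - ratr q = (x - ratr q) - (x - ratr (fracpart x)).
    by rewrite opprB [RHS]addrC subrKA.
  exact: rpredB.
by rewrite -[fracpart x](subrK q) bE addrC cisD cis_int mulr1.
Qed.

Lemma eD (x y : Q) : e R (x + y) = e R x * e R y.
Proof.
have [qf qO] := fracpartP x; have [q'f q'O] := fracpartP y.
rewrite -[e R x]/(cis (fracpart x)) -[e R y]/(cis (fracpart y)) -cisD.
apply: e_eq; first exact: pfracD.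
by rewrite ratr_QpD opprD addrACA rpredD.
Qed.

Lemma e_OQ (x : Q) : x \in OQ -> e R x = 1.
Proof.
move=> xO; rewrite -(cis_int 0); apply: e_eq; first by exists 0, 0%N; rewrite mul0r.
by rewrite /ratr mul0r subr0.
Qed.

End Character.
End Padic.

(** * Kloosterman sums *)

Section Groups.
Variables (p : nat) (hp : prime p) (n : nat).
Local Notation Z := (Defs.Zp hp).
Local Notation Q := (Qp hp).
Local Notation M := 'M[Q]_n.+1.
Local Notation GL := (@GLO Q (@OQ p hp) n).

Lemma GLZP (x : M) : GLZ x <-> GL x.
Proof.
split=> [[y yu ->]|[xO [x' x'O xx']]].
  split; first by move=> i j; rewrite mxE; apply/OQP; exists (y i j).
  exists (map_mx (@tofrac Z) (invmx y)).
    by move=> i j; rewrite mxE; apply/OQP; exists (invmx y i j).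
  by rewrite -map_mxM mulmxV // map_mx1.
have lift (a : M) : intmx (@OQ p hp) a -> exists b : 'M[Z]_n.+1, a = map_mx (@tofrac Z) b.
  move=> aO; have aE i j : exists b : Z, a i j = tofrac b by apply/OQP.
  exists (\matrix_(i, j) projT1 (cid (aE i j))).
  by apply/matrixP => i j; rewrite !mxE; case: cid.
have [[y yE] [y' y'E]] := (lift _ xO, lift _ x'O).
exists y => //; have : y *m y' = 1%:M.
  apply/matrixP => i j; apply/eqP; rewrite -tofrac_eq; apply/eqP.
  have := congr1 (fun A : M => A i j) xx'; rewrite yE y'E -map_mxM !mxE => ->.
  by rewrite rmorph_nat.
by case/mulmx1_unit.
Qed.

Lemma wlE : wl hp n = Nmat n n (fun=> 1).
Proof.
apply/matrixP => i j; rewrite !mxE !leq_ord /=.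
by case: ifP => //; rewrite mulr1.
Qed.

Definition torus_exp (r : nat -> nat) i : int :=
  let r' i := if (0 < i <= n)%N then r i else 0%N in (r' i)%:Z - (r' i.+1)%:Z.

Lemma Cstar_wlE r : Cstar hp n r *m wl hp n = Nmat n n (fun i => (p%:R : Q) ^ torus_exp r i).
Proof.
apply/matrixP => i j; rewrite mul_diag_mx !mxE !leq_ord /=.
by case: (_ == n); [rewrite mulrC /torus_exp leq_ord|rewrite mulr0].
Qed.

(** Conjugation by w_l reverses the order of rows and columns up to signs, and so carries [U] to
    [Utr]. *)
Lemma Uw_wl : Uw (wl hp n) = @U p hp n.
Proof.
apply/seteqP; split=> [u []//|u uU]; split=> //.
have wu : wl hp n \in unitmx by rewrite wlE Nmat_unit // => i _; apply: oner_neq0.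
exists (wl hp n *m u *m invmx (wl hp n)); last by rewrite -!mulmxA mulVmx // mulmx1 mulKmx.
set v := wl hp n *m u *m _.
have key (i l k j : 'I_n.+1) : l = (n - j)%N :> nat -> k = (n - i)%N :> nat ->
    (-1) ^+ j * v i l = (-1) ^+ (n - i) * u k j.
  move=> lE kE; have e : v *m Nmat n n (fun=> 1) = Nmat n n (fun=> 1) *m u.
    by rewrite -wlE /v mulmxKV.
  have := congr1 (fun A : M => A i j) e.
  by rewrite /= (Nmat_mulr _ _ _ _ lE) ?leq_ord // (Nmat_mull _ _ _ _ kE) ?leq_ord // !mulr1.
have s0 k : (-1 : Q) ^+ k != 0 by rewrite signr_eq0.
case: uU => u1 uU; split=> [i|i l li]; rewrite mxE.
  have [j jE] := ord_sub i (leqnn n).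
  have ijE : i = (n - j)%N :> nat by rewrite jE subKn // -ltnS.
  have := key i i j j ijE jE; rewrite u1 jE => /(mulfI (s0 _)) //.
have [j jE] := ord_sub i (leqnn n); have [k kE] := ord_sub l (leqnn n).
have ijE : i = (n - j)%N :> nat by rewrite jE subKn // -ltnS.
have := key l i k j ijE kE; rewrite uU; last first.
  by rewrite jE kE; have := ltn_ord l; lia.
by move/eqP; rewrite mulr0 mulf_eq0 (negPf (s0 _)) => /eqP.
Qed.

End Groups.

(** * Translation from levels and offsets to the indices (i, j) *)

Section Levels.
Variables (F : fieldType) (p : F) (n : nat) (M : nat -> nat -> nat) (C : nat -> nat -> F).

Definition at_level (T : Type) (f : nat -> nat -> T) e a := f (n.+1 - e)%N (n.+1 - e + a)%N.

Lemma psum_at_level d b : (d <= n)%N -> (b <= d)%N ->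
  psum (at_level M d) b d = (\sum_(1 <= k < (d - b).+1) M (n.+1 - d) (n.+1 - k))%N.
Proof.
move=> dn bd; rewrite /psum -{1}[b]add0n big_addn big_add1 /= big_nat_rev /=.
apply: eq_big_nat => k /andP[_ kd]; rewrite /at_level add0n; congr (M _ _); lia.
Qed.

Lemma psum_row e a : (e <= n)%N ->
  psum (at_level M e) a e = (\sum_(n.+1 - e + a <= k < n.+1) M (n.+1 - e) k)%N.
Proof.
move=> en; rewrite /psum /at_level [(_ + a)%N]addnC; set i := (n.+1 - e)%N.
have -> : (n.+1 = e + i)%N by rewrite /i; lia.
by rewrite big_addn addnK; apply: eq_big_nat => k _; rewrite addnC.
Qed.

Lemma prod_expr (f : nat -> nat) a b :
  \prod_(a <= k < b) p ^+ f k = p ^+ (\sum_(a <= k < b) f k)%N.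
Proof. by rewrite expr_sum. Qed.

Lemma prod_exprV (f : nat -> nat) a b :
  \prod_(a <= k < b) (p ^+ f k)^-1 = (p ^+ (\sum_(a <= k < b) f k)%N)^-1.
Proof. by rewrite expr_sum prodfV. Qed.

Definition cbarM i j : F :=
  if (j < i)%N then 1 else if M i j == 0%N then 0 else (C i j)^-1.

Hypothesis Cout : forall i j, (0 < i)%N -> (j < i)%N -> C i j = 1.

(** Passing to level [d - 1] and offset [a - 1] raises the row by one and keeps the column
    [n + 1 - d + a], so each step of the recursion contributes one summand over [i]. For [d = n] the
    sum starts at 1. *)
Lemma left_super_at_level d a : (a < d)%N -> (d <= n)%N ->
  left_super p (at_level M) (at_level C) d a =
  \sum_(n.+1 - d <= i < (n.+1 - d + a).+1)
     (C i (n.+1 - d + a).-1 * cbarM i (n.+1 - d + a)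
      * (\prod_(n.+1 - d <= k < i) p ^+ M k (n.+1 - d + a).-1)
      * (\prod_(n.+1 - d <= k < i.+1) (p ^+ M k (n.+1 - d + a))^-1)).
Proof.
elim: d a => // d IH a ad dn; set i0 := (n.+1 - d.+1)%N.
have i0E : (n.+1 - d = i0.+1)%N by rewrite /i0; lia.
have i0p : (0 < i0)%N by rewrite /i0; lia.
have cbE : cbar (at_level M d.+1 a) (at_level C d.+1 a) = cbarM i0 (i0 + a).
  by rewrite /cbarM ltnNge leq_addr.
rewrite big_ltn ?ltnS ?leq_addr // big_geq // big_nat1 mulr1 /= cbE.
case: a ad cbE => [|a] ad cbE; rewrite mulrDl; congr (_ + _).
- by rewrite addn0 Cout ?prednK // /at_level addn0.
- by rewrite mul0r big_geq // addn0.
- by rewrite /at_level -/i0 addnS.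
- rewrite IH // 1?ltnW // i0E mulr_sumr mulr_suml -addSnnS.
  apply: eq_big_nat => i /andP[i0i _].
  have i0i' : (i0 < i.+1)%N by apply: leqW.
  rewrite [in RHS](big_ltn i0i) [in RHS](big_ltn i0i').
  have -> : at_level M d.+1 a = M i0 (i0.+1 + a).-1 by [].
  have -> : at_level M d.+1 a.+1 = M i0 (i0.+1 + a)%N by rewrite addSnnS.
  set x := p ^+ _; set y := p ^+ _; set X := \prod_(_ <= _ < i) _; set Y := \prod_(_ <= _ < i.+1) _.
  set A := C _ _; set B := cbarM _ _; ring.
Qed.

(** The substitution [b = d + 1 - j] reverses the sum, and the quotient of the two partial products
    of level [d + 1] leaves the exponents from [b] to [d] in the denominator. *)
Lemma right_super_at_level d : p != 0 -> (d < n)%N ->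
  right_super p (at_level M) (at_level C) d =
  \sum_(1 <= j < d.+2)
     (C (n.+1 - d.+1)%N (n.+1 - j)%N * cbarM (n.+2 - d.+1)%N (n.+1 - j)%N
      * (\prod_(1 <= k < j) p ^+ M (n.+2 - d.+1)%N (n.+1 - k)%N)
      * (\prod_(1 <= k < j.+1) (p ^+ M (n.+1 - d.+1)%N (n.+1 - k)%N)^-1)).
Proof.
move=> p0 dn; rewrite /right_super big_add1 /= big_nat_rev /= big_mkord mulr_suml.
apply: eq_bigr => -[b /=]; rewrite ltnS => bd _.
rewrite add0n subSS.
rewrite prod_exprV prod_expr !subSS.
have -> : (\sum_(1 <= k < (d - b).+1) M (n.+1 - d) (n.+1 - k))%N = psum (at_level M d) b d.
  by rewrite psum_at_level // ltnW.
have -> : (\sum_(1 <= k < (d - b).+2) M (n - d) (n.+1 - k))%N = psum (at_level M d.+1) b d.+1.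
  by rewrite psum_at_level ?leqW // subSn.
have -> : (n - (d - b) = n - d + b)%N by lia.
(* For [b = 0] the column is one less than the row, and the convention for i > j supplies the value
   1. *)
have -> : cbarM (n.+1 - d)%N (n - d + b)%N = cbprev (at_level M d) (at_level C d) b.
  rewrite /cbarM; case: b bd => [|b] bd.
    by rewrite addn0 ifT //; lia.
  have -> : (n - d + b.+1 = n.+1 - d + b)%N by lia.
  by rewrite ltnNge leq_addr.
rewrite (@psum_cat _ 0 b d.+1) // ?leqW // exprD -[C _ _]/(at_level C d.+1 b).
set A := p ^+ psum _ 0 b; have A0 : A != 0 by apply: expf_neq0.
by field; rewrite A0 expf_neq0.
Qed.

Lemma diagsum_at_level d k : (d <= n)%N -> (k <= d)%N ->
  diagsum (at_level M) d k =
  (\sum_(n.+1 - d <= i < n.+1 - d + k) \sum_(n - d + k <= j < n.+1) M i j)%N.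
Proof.
elim: d k => [|d IH] [|k] dn kd //=; try by rewrite addn0 big_geq.
have e1 : (n.+1 - d = (n.+1 - d.+1).+1)%N by lia.
have dn' := ltnW dn.
rewrite (IH k dn' kd) [in RHS]addnS [in RHS]big_ltn ?ltnS ?leq_addr // e1 addSn.
congr (_ + _)%N.
  have -> : (n - d.+1 + k.+1 = n.+1 - d.+1 + k)%N by lia.
  exact: psum_row.
have -> : (n - d.+1 + k.+1 = n - d + k)%N by lia.
by [].
Qed.

End Levels.

(** * Functions and sums on the pairs i <= j *)

Section Index.
Variable n : nat.

Lemma ext_val (T : Type) (d : T) (f : idx n -> T) (ij : idx n) :
  ext d f (val ij).1 (val ij).2 = f ij.
Proof.
rewrite /ext !inord_val -surjective_pairing.
by rewrite valK.
Qed.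

Lemma idx_ex i j : (0 < i)%N -> (i <= j)%N -> (j <= n)%N ->
  exists ij : idx n, i = (val ij).1 :> nat /\ j = (val ij).2 :> nat.
Proof.
move=> i0 ij jn; have iE : (inord i : 'I_n.+1) = i :> nat by rewrite inordK // ltnS (leq_trans ij).
have jE : (inord j : 'I_n.+1) = j :> nat by rewrite inordK.
have h : (0 < (inord i : 'I_n.+1, inord j : 'I_n.+1).1)%N &&
  ((inord i : 'I_n.+1, inord j : 'I_n.+1).1 <= (inord i : 'I_n.+1, inord j : 'I_n.+1).2)%N.
  by rewrite /= iE jE i0.
by exists (Sub (inord i, inord j) h); rewrite SubK /= iE jE.
Qed.

Lemma ext_out (T : Type) (d : T) (f : idx n -> T) i j :
  ~~ [&& (0 < i)%N, (i <= j)%N & (j <= n)%N] -> ext d f i j = d.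
Proof.
move=> h; rewrite /ext insubF //; apply: contraNF h => /=.
have inE k : (inord k : 'I_n.+1) = (if (k <= n)%N then k else 0%N) :> nat.
  by rewrite val_insubd.
by rewrite !inE; case: (leqP i n) => hi; case: (leqP j n) => hj //=; lia.
Qed.

Lemma idx_sum (m : {ffun idx n -> nat}) k : (1 <= k <= n)%N ->
  (\sum_(ij : idx n | (val ij).1 <= k <= (val ij).2) m ij
   = \sum_(1 <= i < k.+1) \sum_(k <= j < n.+1) ext 0 m i j)%N.
Proof.
move=> /andP[k0 kn].
transitivity (\sum_(ij : idx n | (val ij).1 <= k <= (val ij).2) ext 0 m (val ij).1 (val ij).2)%N.
  by apply: eq_bigr => ij _; rewrite ext_val.
rewrite -(big_sub_cond (fun u : 'I_n.+1 * 'I_n.+1 => (0 < u.1)%N && (u.1 <= u.2)%N)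
  (fun u : 'I_n.+1 * 'I_n.+1 => (u.1 <= k <= u.2)%N) (fun u => ext 0%N m u.1 u.2)).
rewrite big_geq_mkord (@big_ord_widen_cond _ _ _ _ n.+1 (fun i => 1 <= i)%N
  (fun i => \sum_(k <= j < n.+1) ext 0%N m i j)%N) //.
under [RHS]eq_bigr do rewrite big_geq_mkord.
rewrite pair_big_dep /=; apply: eq_bigl => -[i j] /=.
rewrite unfold_in /= !ltnS; lia.
Qed.

End Index.

(** * Representatives of residue classes and the labels (m, c) *)

Section Stratification.
Variables (p : nat) (hp : prime p) (n : nat).
Local Notation Q := (Qp hp).
Local Notation M := 'M[Q]_n.+1.
Local Notation P := (p%:R : Q).
Local Notation O := (@OQ p hp).
Implicit Types (ij : idx n) (m : {ffun idx n -> nat}).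

Definition level_of ij := (n.+1 - (val ij).1)%N.
Definition offset_of ij := ((val ij).2 - (val ij).1)%N.

Lemma idx_bounds ij : (0 < (val ij).1)%N /\ ((val ij).1 <= (val ij).2)%N.
Proof. by have /andP[] := valP ij. Qed.

Lemma level_of_bounds ij : (offset_of ij < level_of ij)%N /\ (level_of ij <= n)%N.
Proof.
have [i0 ij'] := idx_bounds ij; have := ltn_ord (val ij).2.
by rewrite /offset_of /level_of; move: i0 ij'; lia.
Qed.

Lemma level_ofK ij : (n.+1 - level_of ij)%N = (val ij).1 /\ (n.+1 - level_of ij + offset_of ij)%N = (val ij).2.
Proof.
have [i0 ij'] := idx_bounds ij; have := ltn_ord (val ij).2; have := ltn_ord (val ij).1.
by rewrite /offset_of /level_of; move: i0 ij'; split; lia.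
Qed.

Lemma at_level_ext (T : Type) (d : T) (f : idx n -> T) ij : at_level n (ext d f) (level_of ij) (offset_of ij) = f ij.
Proof. by rewrite /at_level; have [-> ->] := level_ofK ij; apply: ext_val. Qed.

(** Every level with an admissible offset comes from a pair (i, j), so statements on [idx] transfer
    to the numbering used for the cells. *)
Lemma idx_all (A : nat -> nat -> Prop) : (forall ij, A (level_of ij) (offset_of ij)) ->
  forall e a, (a < e)%N -> (e <= n)%N -> A e a.
Proof.
move=> h e a ae en; have [|||ij [iE jE]] := @idx_ex n (n.+1 - e) (n.+1 - e + a).
- by lia.
- by lia.
- by lia.
have -> : e = level_of ij by rewrite /level_of -iE; lia.
have -> : a = offset_of ij by rewrite /offset_of -iE -jE; lia.
exact: h.
Qed.

Definition mult_at (m : {ffun idx n -> nat}) := at_level n (ext 0%N m).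
Definition coef_at (g : idx n -> int) := at_level n (fun i j => (ext 1 g i j)%:~R : Q).
Definition cell_of m g := cellmx P n n (mult_at m) (coef_at g).

Lemma mult_atE m ij : mult_at m (level_of ij) (offset_of ij) = m ij.
Proof. exact: at_level_ext. Qed.

Lemma coef_atE g ij : coef_at g (level_of ij) (offset_of ij) = (g ij)%:~R.
Proof. by rewrite /coef_at /at_level; have [-> ->] := level_ofK ij; rewrite ext_val. Qed.

Lemma cmodE m ij : cmod p m ij = (p ^ psum (mult_at m (level_of ij)) (offset_of ij) (level_of ij))%N.
Proof.
have [_ en] := level_of_bounds ij; rewrite /mult_at psum_row // /cmod -expn_sum.
by have [-> ->] := level_ofK ij.
Qed.

Variable rep : forall (m : {ffun idx n -> nat}) ij, 'I_(cmod p m ij) -> int.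
Hypothesis hrep : forall m, rep_system (@rep m).

Lemma coprimez_congr_pow (a b : int) : (p%:Z %| b - a)%Z -> coprimez b p = coprimez a p.
Proof.
move=> h; rewrite !coprimezE /= ![coprime _ p]coprime_sym !prime_coprime //; congr (~~ _).
rewrite -[LHS]/(b \in dvdz p) -[RHS]/(a \in dvdz p) -(subrK a b).
by rewrite rpredDl.
Qed.

Lemma rep_dvd m ij (o : 'I_(cmod p m ij)) : ((cmod p m ij)%:Z %| rep o - (o : nat)%:Z)%Z.
Proof. by rewrite -eqz_mod_dvd; apply/eqP/hrep. Qed.

Lemma p_dvd_cmod m ij : (0 < m ij)%N -> (p%:Z %| (cmod p m ij)%:Z)%Z.
Proof.
move=> m0; rewrite cmodE dvdzE /=; apply: dvdn_exp; last exact: dvdnn.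
have [ae _] := level_of_bounds ij.
by rewrite /psum big_ltn // mult_atE addn_gt0 m0.
Qed.

Lemma rep_unit m ij (o : 'I_(cmod p m ij)) : (0 < m ij)%N ->
  unitO O ((rep o)%:~R : Q) = coprime o (p ^ m ij).
Proof.
move=> m0; rewrite unitO_int (@coprimez_congr_pow (o : nat)%:Z).
  by rewrite coprimezE /= coprime_pexpr.
exact: dvdz_trans (p_dvd_cmod m0) (rep_dvd o).
Qed.

(** For positive [m ij] the modulus is divisible by [p], so being prime to [p] depends only on the
    class; for [m ij = 0] both sides hold. *)
Lemma rep_valid m ij (o : 'I_(cmod p m ij)) :
  valid O (m ij) ((rep o)%:~R : Q) = coprime o (p ^ m ij).
Proof.
rewrite /valid rpred_int /=; case: (posnP (m ij)) => [->|m0]; first by rewrite coprimen1.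
exact: rep_unit.
Qed.

Lemma cell_of_valid m (c : residues p m) : Cpred c ->
  cell_valid O n (mult_at m) (coef_at (fun ij => rep (c ij))).
Proof.
move=> /forallP hc; apply: idx_all => ij.
by rewrite mult_atE coef_atE rep_valid.
Qed.

Lemma rep_ex m ij (z : Q) : z \in O ->
  exists o : 'I_(cmod p m ij), congr_pow O P (psum (mult_at m (level_of ij)) (offset_of ij) (level_of ij)) z (rep o)%:~R.
Proof.
have P0 : P != 0 by rewrite natr_Qp_neq0 // prime_gt0.
move=> zO; have [a [aK aO]] := OQ_digit (psum (mult_at m (level_of ij)) (offset_of ij) (level_of ij)) zO.
rewrite -cmodE in aK; exists (Ordinal aK); set o := Ordinal aK.
have /dvdzP[q qE] := rep_dvd o.
have oE : rep o = a%:Z + q * (p ^ psum (mult_at m (level_of ij)) (offset_of ij) (level_of ij))%N%:Z.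
  by rewrite -cmodE -qE addrC subrK.
set K := psum _ _ _ in oE aO *.
have Pk : P ^+ K != 0 by apply: expf_neq0.
exists ((z - a%:R) / P ^+ K - q%:~R); first by rewrite rpredB // rpred_int.
rewrite oE intrD intrM -!pmulrn natrX mulrBr [_ * (_ / _)]mulrC divfK //.
by rewrite opprD addrA [q%:~R * _]mulrC.
Qed.

Lemma rep_inj m ij (o o' : 'I_(cmod p m ij)) :
  congr_pow O P (psum (mult_at m (level_of ij)) (offset_of ij) (level_of ij)) (rep o)%:~R (rep o')%:~R -> o = o'.
Proof.
have P0 : P != 0 by rewrite natr_Qp_neq0 // prime_gt0.
move=> [t tO tE]; have : ((cmod p m ij)%:Z %| rep o - rep o')%Z.
  rewrite cmodE; apply: (@OQ_int_dvd p hp); rewrite intrB tE mulrC mulKf //.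
  exact: expf_neq0.
have := rep_dvd o; have := rep_dvd o'; rewrite -!eqz_mod_dvd => /eqP h' /eqP h /eqP e.
move: e; rewrite h h' !modz_nat => /eqP; rewrite eqz_nat !modn_small // => /eqP.
exact: val_inj.
Qed.

(* The value xget 0 is only taken for integral z, where the set is nonempty. *)
Definition choose_rep (m : nat -> nat -> nat) e a (z : Q) : Q :=
  xget 0 [set y | exists ij (o : 'I_(cmod p [ffun ij => m (level_of ij) (offset_of ij)] ij)),
    [/\ level_of ij = e, offset_of ij = a, y = (rep o)%:~R & congr_pow O P (psum (m e) a e) z y]].

Lemma mult_at_ffun (m : nat -> nat -> nat) e a : (a < e)%N -> (e <= n)%N ->
  mult_at [ffun ij => m (level_of ij) (offset_of ij)] e a = m e a.
Proof. by apply: (@idx_all (fun e a => mult_at _ e a = m e a)) => ij; rewrite mult_atE ffunE. Qed.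

Lemma psum_ffun (m : nat -> nat -> nat) e a : (e <= n)%N ->
  psum (mult_at [ffun ij => m (level_of ij) (offset_of ij)] e) a e = psum (m e) a e.
Proof. by move=> en; apply: eq_big_nat => k /andP[_ ke]; apply: mult_at_ffun. Qed.

Lemma choose_repP (m : nat -> nat -> nat) e a z : (a < e)%N -> (e <= n)%N -> z \in O ->
  exists ij (o : 'I_(cmod p [ffun ij => m (level_of ij) (offset_of ij)] ij)),
    [/\ level_of ij = e, offset_of ij = a, choose_rep m e a z = (rep o)%:~R
      & congr_pow O P (psum (m e) a e) z (choose_rep m e a z)].
Proof.
move=> ae en zO; have : exists y, exists ij (o : 'I_(cmod p [ffun ij => m (level_of ij) (offset_of ij)] ij)),
    [/\ level_of ij = e, offset_of ij = a, y = (rep o)%:~R & congr_pow O P (psum (m e) a e) z y].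
  move: e a ae en; apply: idx_all => ij.
  have [q qz] := @rep_ex [ffun ij => m (level_of ij) (offset_of ij)] ij z zO.
  exists (rep q)%:~R, ij, q; split=> //.
  by move: qz; rewrite psum_ffun //; case: (level_of_bounds ij).
by move/(xgetPex 0).
Qed.

Lemma choose_rep_valid (m : nat -> nat -> nat) e a z : (a < e)%N -> (e <= n)%N -> valid O (m e a) z ->
  choose_rep m e a z \in O /\ congr_pow O P (psum (m e) a e) z (choose_rep m e a z).
Proof.
move=> ae en /andP[zO _]; have [ij [ o [_ _ rE zr]]] := choose_repP m ae en zO.
by split=> //; rewrite rE rpred_int.
Qed.

Lemma level_of_inj ij ij' : level_of ij = level_of ij' -> offset_of ij = offset_of ij' -> ij = ij'.
Proof.
move=> ee aa; have [i1 j1] := level_ofK ij; have [i2 j2] := level_ofK ij'.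
have e1 : (val ij).1 = (val ij').1 by apply: val_inj; rewrite /= -i1 -i2 ee.
have e2 : (val ij).2 = (val ij').2 by apply: val_inj; rewrite /= -j1 -j2 ee aa.
by apply: val_inj; rewrite [LHS]surjective_pairing [RHS]surjective_pairing e1 e2.
Qed.

(** Converts a cell whose coefficients were produced by [choose_rep] into one labelled by finite
    functions, that is by a term of the sum. *)
Lemma cellmx_choose_rep (m : nat -> nat -> nat) (c : nat -> nat -> Q) : cell_valid O n m c ->
  (forall e a, (a < e)%N -> (e <= n)%N -> exists2 z, valid O (m e a) z & c e a = choose_rep m e a z) ->
  exists (mf : {ffun idx n -> nat}) (cf : residues p mf), [/\ Cpred cf,
    forall e a, (a < e)%N -> (e <= n)%N -> mult_at mf e a = m e a
    & cellmx P n n m c = cell_of mf (fun ij => rep (cf ij))].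
Proof.
move=> mcV hc; pose mf := [ffun ij => m (level_of ij) (offset_of ij)].
have ex ij : exists o : 'I_(cmod p mf ij), c (level_of ij) (offset_of ij) = (rep o)%:~R.
  have [ae en] := level_of_bounds ij; have [z /andP[zO _] ->] := hc _ _ ae en.
  have [ij' [ o [e1 e2 rE _]]] := choose_repP m ae en zO.
  by have e := level_of_inj e1 e2; subst ij'; exists o.
pose f ij := projT1 (cid (ex ij)).
have fE ij : c (level_of ij) (offset_of ij) = (rep (f ij))%:~R by rewrite /f; case: cid.
exists mf, [ffun ij => f ij]; split.
- apply/forallP => ij; rewrite ffunE -rep_valid -fE ffunE.
  by have [ae en] := level_of_bounds ij; apply: mcV.
- by move=> e a ae en; apply: mult_at_ffun.
- apply: eq_cellmx; apply: idx_all => ij; first by rewrite mult_atE ffunE.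
  by rewrite coef_atE ffunE.
Qed.

(** The labels are dependent pairs because the type of [c] involves [m]; the arrays [m] are
    identified first and substituted. *)
Lemma cell_of_inj m m' (c : residues p m) (c' : residues p m') (v v' : M) : Cpred c -> Cpred c' ->
  unip v -> GLO O v -> unip v' -> GLO O v' ->
  cell_of m (fun ij => rep (c ij)) = v *m cell_of m' (fun ij => rep (c' ij)) *m v' ->
  existT (fun m => residues p m) m c = existT (fun m => residues p m) m' c'.
Proof.
move=> hc hc' vU [vO _] v'U [v'O _] xE.
have [mE cE] := cellmx_inj (Qp_dvr hp) (leqnn n) (cell_of_valid hc) (cell_of_valid hc') vU vO (topblk_full v)
  v'U v'O (topblk_full v') xE.
have mm : m = m'.
  apply/ffunP => ij; rewrite -!mult_atE; have [ae en] := level_of_bounds ij; exact: mE.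
subst m'; congr existT; apply/ffunP => ij.
have cc : forall e a, (a < e)%N -> (e <= n)%N ->
    coef_at (fun ij => rep (c ij)) e a = coef_at (fun ij => rep (c' ij)) e a.
  apply: cE; apply: idx_all => ij'; rewrite !coef_atE => h.
  by congr (_%:~R); congr rep; apply: rep_inj h.
have [ae en] := level_of_bounds ij; have := cc _ _ ae en; rewrite !coef_atE => e.
by apply: rep_inj; rewrite e; exists 0; rewrite ?rpred0 // mulr0 subrr.
Qed.

Lemma diagsum_out (m : nat -> nat -> nat) d k : (d < k)%N -> diagsum m d k = 0%N.
Proof.
elim: d k => [//|d IH] [//|k] dk /=; rewrite IH // addn0 /psum big_geq //.
Qed.

Lemma diagsum0 (m : nat -> nat -> nat) d : diagsum m d 0 = 0%N.
Proof. by case: d. Qed.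

Lemma diagsum_mult_at m k : (1 <= k <= n)%N ->
  diagsum (mult_at m) n k = (\sum_(ij : idx n | (val ij).1 <= k <= (val ij).2) m ij)%N.
Proof.
move=> hk; have /andP[_ kn] := hk; rewrite idx_sum // /mult_at diagsum_at_level //.
by rewrite subSnn subnn add0n add1n.
Qed.

Lemma Mset_torus r m : Mset n r m -> forall i, (i <= n)%N -> torus P (mult_at m) n i = P ^ torus_exp n r i.
Proof.
move=> mr i ni; rewrite torus_diagsum ?natr_Qp_neq0 ?prime_gt0 // /torus_exp.
have dE k : diagsum (mult_at m) n k = if (0 < k <= n)%N then r k else 0%N.
  case: ifP => hk; first by rewrite diagsum_mult_at // mr.
  case: k hk => [|k] /= hk; first exact: diagsum0.
  by rewrite diagsum_out // ltnNge hk.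
by rewrite !dE.
Qed.

(** Equal powers of [p] have equal exponents, so the consecutive differences of the two sequences
    agree; both sequences are 0 at index 0. *)
Lemma torus_Mset r m : (forall i, (i <= n)%N -> torus P (mult_at m) n i = P ^ torus_exp n r i) -> Mset n r m.
Proof.
have P0 : P != 0 by rewrite natr_Qp_neq0 // prime_gt0.
move=> h k hk; rewrite -diagsum_mult_at //.
have ce i : (i <= n)%N -> (diagsum (mult_at m) n i)%:Z - (diagsum (mult_at m) n i.+1)%:Z = torus_exp n r i.
  move=> ni; apply/eqP; rewrite -subr_eq0; apply/eqP; apply: (unitO_expz (Qp_dvr hp)).
  have := h i ni; rewrite torus_diagsum // => e.
  by rewrite expfzDr // e -expfzDr // subrr expr0z unitO1.
have dE j : (j <= n)%N -> diagsum (mult_at m) n j = if (0 < j <= n)%N then r j else 0%N.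
  elim: j => [|j IH] jn; first by rewrite diagsum0.
  have := ce j (ltnW jn); rewrite /torus_exp IH ?(ltnW jn) // => /addrI/oppr_inj[->].
  by [].
by have /andP[_ kn] := hk; rewrite dE // hk.
Qed.

End Stratification.

(** * Double cosets and their contributions to the Kloosterman sum *)

Section Summands.
Variables (R : realType) (p : nat) (hp : prime p) (n : nat) (r : nat -> nat).
Local Notation Q := (Qp hp).
Local Notation M := 'M[Q]_n.+1.
Local Notation P := (p%:R : Q).
Local Notation O := (@OQ p hp).
Local Notation t := (Cstar hp n r).
Local Notation w := (wl hp n).
Local Notation N := (Nmat n n (fun i => P ^ torus_exp n r i)).

Let P0 : P != 0. Proof. by rewrite natr_Qp_neq0 // prime_gt0. Qed.
Let t0 i : (i <= n)%N -> P ^ torus_exp n r i != 0. Proof. by move=> _; apply: expfz_neq0. Qed.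

(** Uniqueness of the Bruhat decomposition leaves [xget] only one pair to return. *)
Lemma bruhatE (u u' x : M) : unip u -> unip u' -> x = u *m N *m u' -> bruhat t w x = (u, u').
Proof.
move=> uU u'U xE; rewrite /bruhat; set A := [set g | _].
have Au : A (u, u') by split=> //=; [rewrite Uw_wl|rewrite Cstar_wlE].
have := xgetI (1%:M, 1%:M) Au; case: (xget _ _) => v v' [/= vU v'U].
rewrite Cstar_wlE xE => e; rewrite Uw_wl in v'U.
by have [-> -> _] := bruhat_cell_unique t0 t0 uU u'U vU v'U e.
Qed.

Lemma inord_pred j : (0 < j < n.+1)%N ->
  (inord j : 'I_n.+1) = (inord j.-1 : 'I_n.+1).+1 :> nat.
Proof.
move=> /andP[j0 jn]; have jn' : (j.-1 < n.+1)%N by exact: leq_ltn_trans (leq_pred j) jn.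
by rewrite !inordK // prednK.
Qed.

Lemma characterD (psi : nat -> int) (u v : M) : unip u -> unip v ->
  character R psi (u *m v) = character R psi u * character R psi v.
Proof.
move=> uU vU; rewrite /character -eD -big_split; congr (e R _).
apply: eq_big_nat => j jn; rewrite /= -mulrDr; congr (_ * _).
by apply: unipM_super => //; apply: inord_pred.
Qed.

Lemma character_int (psi : nat -> int) (u : M) : intmx O u -> character R psi u = 1.
Proof.
move=> uO; apply: e_OQ; rewrite big_nat rpred_sum // => j _.
by apply: rpredM; [apply: rpred_int|apply: uO].
Qed.

Lemma UZP (v : M) : UZ v <-> unip v /\ GLO O v.
Proof. by split=> [[vU /GLZP]|[vU /GLZP]]. Qed.

Lemma UwZP (v : M) : UwZ w v <-> unip v /\ GLO O v.
Proof. by rewrite /UwZ Uw_wl; apply: UZP. Qed.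

Lemma dcoset_refl (x : M) : dcoset w x x.
Proof.
have U1 : UZ (1%:M : M) by apply/UZP; split; [exact: unip1|exact: GLO1].
exists 1%:M, 1%:M; split=> //; last by rewrite mul1mx mulmx1.
by apply/UwZP/UZP.
Qed.

Lemma dcoset_eq (x v v' : M) : unip v -> GLO O v -> unip v' -> GLO O v' ->
  dcoset w (v *m x *m v') = dcoset w x.
Proof.
move=> vU vG v'U v'G; have [vu v'u] := (GLO_unit vG, GLO_unit v'G).
apply/seteqP; split=> _ [a [b [/UZP[aU aG] /UwZP[bU bG] ->]]].
  exists (a *m v), (v' *m b); split; last by rewrite !mulmxA.
    by apply/UZP; split; [apply: unipM|apply: GLOM].
  by apply/UwZP; split; [apply: unipM|apply: GLOM].
exists (a *m invmx v), (invmx v' *m b); split.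
- by apply/UZP; split; [apply: unipM => //; apply: unipV|apply: GLOM => //; apply: GLOV].
- by apply/UwZP; split; [apply: unipM => //; apply: unipV|apply: GLOM => //; apply: GLOV].
- exact: mulmx_insert.
Qed.

(** Another element of the double coset changes the Bruhat factors by integral unipotent matrices,
    on which the characters are trivial. *)
Lemma summand_dcoset (psi psi' : nat -> int) (x u u' : M) : unip u -> unip u' ->
  x = u *m N *m u' ->
  (let g := bruhat t w (xget 0 (dcoset w x)) in character R psi g.1 * character R psi' g.2)
  = character R psi u * character R psi' u'.
Proof.
move=> uU u'U xE; have := xgetI 0 (dcoset_refl x).
set y := xget _ _ => -[a [b [/UZP[aU [aO _]] /UwZP[bU [bO _]] yE]]].
have -> : bruhat t w y = (a *m u, u' *m b).
  by apply: bruhatE; [apply: unipM|apply: unipM|rewrite yE xE !mulmxA].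
by rewrite /= !characterD // !(@character_int _ a, @character_int _ b) // mul1r mulr1.
Qed.

Variable psi psi' : nat -> int.
Variable rep : forall (m : {ffun idx n -> nat}) (ij : idx n), 'I_(cmod p m ij) -> int.
Hypothesis hrep : forall m, rep_system (@rep m).

(** The argument of [e] in [KlM], repeated so that both sums agree by conversion. *)
Definition phase (m : {ffun idx n -> nat}) (c : residues p m) : Q :=
    let cc i j : Q := (ext 1 (fun ij => rep (c ij)) i j)%:~R in
    let mm := ext 0%N m in
    let cbar i j : Q :=
      if (j < i)%N then 1 else if mm i j == 0%N then 0 else (cc i j)^-1 in
    let P i j : Q := p%:R ^+ mm i j in
     (\sum_(1 <= j < n.+1) \sum_(1 <= i < j.+1)
         (psi j)%:~R * cc i j.-1 * cbar i j
         * (\prod_(1 <= k < i) P k j.-1)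
         * (\prod_(1 <= k < i.+1) (P k j)^-1))
     + (\sum_(1 <= i < n.+1) \sum_(1 <= j < i.+1)
         (psi' i)%:~R * cc (n.+1 - i)%N (n.+1 - j)%N
         * cbar (n.+2 - i)%N (n.+1 - j)%N
         * (\prod_(1 <= k < j) P (n.+2 - i)%N (n.+1 - k)%N)
         * (\prod_(1 <= k < j.+1) (P (n.+1 - i)%N (n.+1 - k)%N)^-1)).

Lemma KlM_phase m : KlM R hp m psi psi' (@rep m) = \sum_(c : residues p m | Cpred c) e R (phase c).
Proof. by []. Qed.

Lemma cell_of_summand m (c : residues p m) : Mset n r m -> Cpred c ->
  exists u u', [/\ unip u, unip u', cell_of hp m (fun ij => rep (c ij)) = u *m N *m u'
    & character R psi u * character R psi' u' = e R (phase c)].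
Proof.
move=> mr hc; have hV := cell_of_valid hp hrep hc.
have [u [u' [[uU _ u'U _ xE] [uS u'S]]]] := cellmx_bruhat P0 (leqnn n) hV.
exists u, u'; split; [exact: uU|exact: u'U| |].
  by rewrite /cell_of xE (eq_Nmat n (Mset_torus hp mr)).
have Cout i j : (0 < i)%N -> (j < i)%N -> ((ext 1 (fun ij => rep (c ij)) i j)%:~R : Q) = 1.
  move=> i0 ji; rewrite ext_out // negb_and negb_and; apply/orP; right; apply/orP; left.
  by rewrite -ltnNge.
have inE j : (0 < j < n.+1)%N -> (inord j.-1 : 'I_n.+1) = j.-1 :> nat /\ (j.-1 < n)%N.
  move=> /andP[j0 jn]; rewrite inordK; first by rewrite prednK.
  exact: leq_ltn_trans (leq_pred j) jn.
rewrite /character -eD /phase; congr (e R (_ + _)); apply: eq_big_nat => j jn.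
  have [jE jn'] := inE j jn; have /andP[j0 _] := jn.
  rewrite /uentry (uS _ _ _ (inord_pred jn)) jE // left_super_at_level // mulr_sumr.
  rewrite subSnn add1n prednK //.
  by apply: eq_bigr => i _; rewrite !mulrA.
have [jE jn'] := inE j jn; have /andP[j0 _] := jn.
rewrite /uentry (u'S _ _ _ (inord_pred jn)) jE // right_super_at_level // mulr_sumr prednK //.
by apply: eq_bigr => i _; rewrite !mulrA.
Qed.

Lemma cell_of_Cset m (c : residues p m) : Mset n r m -> Cpred c ->
  Cset t w (cell_of hp m (fun ij => rep (c ij))).
Proof.
move=> mr hc; have [u [u' [uU u'U xE _]]] := cell_of_summand mr hc.
split; first by exists u, u'; split=> //; rewrite Cstar_wlE.
apply/GLZP; apply: cellmx_GLO => //; last exact: cell_of_valid.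
by rewrite rpred_nat.
Qed.

Lemma Cset_cell_of (x : M) : Cset t w x -> exists (m : {ffun idx n -> nat}) (c : residues p m),
  [/\ Mset n r m, Cpred c & dcoset w x = dcoset w (cell_of hp m (fun ij => rep (c ij)))].
Proof.
move=> [[u [u' [uU u'U]]]]; rewrite Cstar_wlE => xE /GLZP xG.
have [m [c [v [v' [mcV hc tE [vU vG v'U v'G] xv]]]]] :=
  cellmx_surj_expz (Qp_dvr hp) (@choose_rep_valid p hp n rep hrep) xG uU u'U xE.
have [mf [cf [hcf mE xmE]]] := cellmx_choose_rep hrep mcV hc.
exists mf, cf; split; [|exact: hcf|by rewrite xv xmE; apply: dcoset_eq].
by apply: (torus_Mset (hp := hp)) => i ni; rewrite (eq_torus P ni mE) tE.
Qed.

Lemma Mset_finite : finite_set (Mset n r).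
Proof.
pose B := (\sum_(1 <= k < n.+1) r k)%N.
have f : finite_set [set [ffun ij => nat_of_ord (g ij)] | g in [set: {ffun idx n -> 'I_B.+1}]].
  exact/finite_image/finite_finset.
apply: sub_finite_set f => m mr.
(* [m ij] is a term of the condition for [k] equal to the first index of [ij], so it is at most
   [r k]. *)
have mB ij : (m ij <= B)%N.
  have [i0 i1] := idx_bounds ij; set k := ((val ij).1 : nat).
  have kn : (1 <= k <= n)%N by rewrite i0; apply: leq_ord.
  apply: (@leq_trans (r k)).
    by rewrite -(mr k kn) (bigD1 ij) /= ?leq_addr // leqnn.
  have /andP[k0 kn'] := kn.
  by rewrite /B (bigD1_seq k) ?mem_index_iota ?iota_uniq ?k0 ?ltnS //= leq_addr.
exists [ffun ij => inord (m ij)] => //.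
by apply/ffunP => ij; rewrite !ffunE inordK // ltnS.
Qed.

Definition stratum (m : {ffun idx n -> nat}) (c : residues p m) : set M :=
  dcoset w (cell_of hp m (fun ij => rep (c ij))).

Lemma stratum_inj m m' (c : residues p m) (c' : residues p m') : Cpred c -> Cpred c' ->
  stratum c = stratum c' ->
  existT (fun m => residues p m) m c = existT (fun m => residues p m) m' c'.
Proof.
move=> hc hc' e; have := dcoset_refl (cell_of hp m (fun ij => rep (c ij))).
rewrite -/(stratum c) e => -[v [v' [/UZP[vU vG] /UwZP[v'U v'G] xE]]].
exact: (cell_of_inj hrep hc hc' vU vG v'U v'G xE).
Qed.

Lemma stratum_summand m (c : residues p m) : Mset n r m -> Cpred c ->
  (let g := bruhat t w (xget 0 (stratum c)) in character R psi g.1 * character R psi' g.2)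
  = e R (phase c).
Proof.
move=> mr hc; have [u [u' [uU u'U xE <-]]] := cell_of_summand mr hc.
exact: summand_dcoset.
Qed.

(** The strata of all labels (m, c) enumerate [Xset] without repetition, so both sides become sums
    over one duplicate-free list [s]. *)
Lemma Kl_strata :
  Kl R psi psi' t w = \sum_(m \in Mset n r) KlM R hp m psi psi' (@rep m).
Proof.
pose sm := finmap.enum_fset (fset_set (Mset n r)).
have smE m : (m \in sm) = (m \in Mset n r) by rewrite (in_fset_set Mset_finite m).
have smU : uniq sm by apply: finmap.fset_uniq.
pose s := [seq stratum c | m <- sm, c <- enum (@Cpred p n m)].
have sE : Xset t w = [set` s].
  apply/seteqP; split=> [_ [x /Cset_cell_of[m [c [mr hc ->]]] <-]|D /= /allpairsPdep[m [c [ms hc ->]]]].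
    apply/allpairsPdep; exists m, c; split=> //; first by rewrite smE; apply/mem_set.
    by rewrite mem_enum.
  rewrite mem_enum in hc; rewrite smE in ms; move/set_mem: ms => mr.
  by exists (cell_of hp m (fun ij => rep (c ij))) => //; apply: cell_of_Cset.
have sU : uniq s.
  apply: allpairs_uniq_dep => // [m _|[m c] [m' c']]; first exact: enum_uniq.
  move=> /allpairsPdep[m1 [c1 [_ h1 e1]]] /allpairsPdep[m2 [c2 [_ h2 e2]]] /=.
  rewrite mem_enum in h1; rewrite mem_enum in h2.
  have hc := congr1 (fun q : {m : {ffun idx n -> nat} & residues p m} => Cpred (tagged q)) e1.
  have hc' := congr1 (fun q : {m : {ffun idx n -> nat} & residues p m} => Cpred (tagged q)) e2.
  apply: stratum_inj; [exact: (etrans hc h1)|exact: (etrans hc' h2)].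
rewrite /Kl sE -(fsbig_seq _ _ sU) big_allpairs_dep (fsbig_finite _ _ Mset_finite) /=.
rewrite -/sm big_seq [RHS]big_seq; apply: eq_bigr => m; rewrite smE => /set_mem mr.
rewrite KlM_phase big_enum /=; apply: eq_bigr => c hc.
exact: stratum_summand.
Qed.

End Summands.


Theorem theorem1 (R : realType) (p : nat) (hp : prime p) (n : nat)
    (hn : (2 <= n)%N) (r : nat -> nat) (psi psi' : nat -> int)
    (rep : forall (m : {ffun idx n -> nat}) (ij : idx n),
             'I_(cmod p m ij) -> int)
    (hrep : forall m, rep_system (rep m)) :
  Kl R psi psi' (Cstar hp n r) (wl hp n)
  = \sum_(m \in Mset n r) KlM R hp m psi psi' (rep m).
Proof. exact: Kl_strata. Qed.
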